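(* Let $k$ be a field with $\operatorname{char}(k)=7$ and let $G$ be a solvable transitive subgroup of the symmetric group $S_{14}$, acting on the rational function field $k(x_1,\ldots,x_{14})$ of $14$ variables over $k$ by $k$-automorphisms defined by $\sigma\cdot x_i:=x_{\sigma\cdot i}$ for any $\sigma\in G$ and $1\le i\le 14$. Then the fixed subfield $k(x_1,\ldots,x_{14})^G$ is $k$-rational.
   Context: A finitely generated field extension $L$ of $k$ is called $k$-rational if $L$ is purely transcendental over $k$, i.e. $k$-isomorphic to the quotient field of some polynomial ring over $k$. For a group $G$ acting on a field $L$ by automorphisms, $L^G=\{f\in L:\sigma\cdot f=f\text{ for all }\sigma\in G\}$. *)

(* Defs.v *)
From HB Require Import structures.
From mathcomp Require Import all_boot all_order all_algebra all_fingroup all_solvable.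
From mathcomp Require Import generic_quotient fraction.
From mathcomp Require Import mpoly.

Set Implicit Arguments.
Unset Strict Implicit.
Unset Printing Implicit Defensive.

Import GRing.Theory.
Local Open Scope ring_scope.
Local Open Scope quotient_scope.

(* The map of fraction fields p / q |-> f p / f q induced by f : R -> S; it is
   a well-defined field morphism when f is an injective ring morphism. *)
Definition fracmap (R S : idomainType) (f : R -> S) (x : {fraction R}) :
    {fraction S} :=
  tofrac (f \n_(repr x)) / tofrac (f \d_(repr x)).

Section FracMapTheory.
Variables (R S : idomainType) (f : {rmorphism R -> S}).
Hypothesis f_inj : injective f.

Lemma frac_repr (x : {fraction R}) :
  x = tofrac \n_(repr x) / tofrac \d_(repr x).
Proof.
have d0 : tofrac \d_(repr x) != 0 :> {fraction R}
  by rewrite tofrac_eq0 denom_ratioP.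
apply: (mulIf d0); rewrite mulfVK //.
rewrite -{1}[x]reprK /GRing.mul /= !piE.
apply/eqmodP; rewrite /= /FracField.equivf /FracField.mulf.
by rewrite !numden_Ratio ?mulr1 ?oner_neq0 ?denom_ratioP // mulrC.
Qed.

Lemma fracmap_div (p q : R) : q != 0 ->
  fracmap f (tofrac p / tofrac q)
  = tofrac (f p) / tofrac (f q).
Proof.
move=> q0; set x := (X in fracmap f X); rewrite /fracmap.
have xE := frac_repr x.
have d0 : \d_(repr x) != 0 by apply: denom_ratioP.
move: xE d0; move: (\n_(repr x)) (\d_(repr x)) => n d xE d0.
have f0 (r : R) : r != 0 -> f r != 0.
  by apply: contra_neq => e; apply: f_inj; rewrite e rmorph0.
apply/eqP; rewrite eqr_div ?tofrac_eq0 ?f0 // -!tofracM tofrac_eq -!rmorphM.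
rewrite (inj_eq f_inj) -tofrac_eq !tofracM -eqr_div ?tofrac_eq0 //.
by rewrite -xE.
Qed.

Lemma fracmap_tofrac (p : R) :
  fracmap f (tofrac p) = tofrac (f p).
Proof.
rewrite -[X in fracmap f X]divr1 -(tofrac1 R) fracmap_div ?oner_neq0 //.
by rewrite rmorph1 tofrac1 divr1.
Qed.

Lemma fracmap_zmod_morphism : zmod_morphism (fracmap f).
Proof.
move=> x y; rewrite [x]frac_repr [y]frac_repr.
have := denom_ratioP (repr x); have := denom_ratioP (repr y).
move: (\n_(repr x)) (\d_(repr x)) (\n_(repr y)) (\d_(repr y)).
move=> a b c d d0 b0.
have f0 (r : R) : r != 0 -> f r != 0.
  by apply: contra_neq => e; apply: f_inj; rewrite e rmorph0.
rewrite -mulNr addf_div ?tofrac_eq0 // -tofracN -!tofracM -tofracD.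
rewrite !fracmap_div ?mulf_neq0 // rmorphD !rmorphM rmorphN.
by rewrite -mulNr addf_div ?tofrac_eq0 ?f0 // -tofracN -!tofracM -tofracD.
Qed.

Lemma fracmap_monoid_morphism : monoid_morphism (fracmap f).
Proof.
split=> [|x y]; first by rewrite -(tofrac1 R) fracmap_tofrac rmorph1 tofrac1.
rewrite [x]frac_repr [y]frac_repr.
have := denom_ratioP (repr x); have := denom_ratioP (repr y).
move: (\n_(repr x)) (\d_(repr x)) (\n_(repr y)) (\d_(repr y)).
move=> a b c d d0 b0.
rewrite mulf_div -!tofracM !fracmap_div ?mulf_neq0 // !(rmorphM f) !tofracM.
by rewrite mulf_div.
Qed.
End FracMapTheory.

(* The fixed subfield L^G, for G acting on L by field endomorphisms. *)
Section FixedField.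
Variables (gT : finType) (G : {set gT}) (L : fieldType).
Variable act : gT -> {rmorphism L -> L}.

Definition fixed : {pred L} := [pred f | [forall s in G, act s f == f]].

Lemma fixedP f : reflect (forall s, s \in G -> act s f = f) (f \in fixed).
Proof. exact: 'forall_in_eqP. Qed.

Lemma fixed_divring_closed : divring_closed fixed.
Proof.
split=> [|x y /fixedP xG /fixedP yG|x y /fixedP xG /fixedP yG];
  apply/fixedP=> s sG; first exact: rmorph1.
- by rewrite rmorphB xG ?yG.
- by rewrite fmorph_div xG ?yG.
Qed.

HB.instance Definition _ :=
  GRing.isDivringClosed.Build L fixed fixed_divring_closed.

Record fixedfield : predArgType := FixedField {
  fixedfield_val :> L;
  fixedfield_valP : fixedfield_val \in fixed
}.

HB.instance Definition _ := [isSub for fixedfield_val].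
HB.instance Definition _ := [Choice of fixedfield by <:].
HB.instance Definition _ :=
  [SubChoice_isSubIntegralDomain of fixedfield by <:].
HB.instance Definition _ := [SubIntegralDomain_isSubField of fixedfield by <:].
End FixedField.

Notation ratfun k n := {fraction {mpoly k[n]}}.

Definition ratfunC (k : fieldType) (n : nat) : {rmorphism k -> ratfun k n} :=
  @tofrac {mpoly k[n]} \o @mpolyC n k.

(* An extension L of k, with structure map iota, is k-rational when it is
   k-isomorphic to the fraction field of a polynomial ring over k. *)
Definition rational (k L : fieldType) (iota : {rmorphism k -> L}) : Prop :=
  exists n (phi : {rmorphism ratfun k n -> L}),
    bijective phi /\ forall c, phi (ratfunC k n c) = iota c.

Arguments rational k L iota : clear implicits.

Section PermutationAction.
Variables (k : fieldType) (n : nat).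

(* msym s is the k-algebra morphism of {mpoly k[n]} with 'X_i |-> 'X_(s i). *)
Definition perm_act (s : 'S_n) : ratfun k n -> ratfun k n :=
  fracmap (@msym n k s).

HB.instance Definition _ (s : 'S_n) :=
  GRing.isZmodMorphism.Build (ratfun k n) (ratfun k n) (perm_act s)
    (fracmap_zmod_morphism (@inj_msym n k s)).
HB.instance Definition _ (s : 'S_n) :=
  GRing.isMonoidMorphism.Build (ratfun k n) (ratfun k n) (perm_act s)
    (fracmap_monoid_morphism (@inj_msym n k s)).

Lemma perm_actX (s : 'S_n) (i : 'I_n) :
  perm_act s (tofrac 'X_i) = tofrac 'X_(s i).
Proof.
rewrite /perm_act fracmap_tofrac; last exact: inj_msym.
by rewrite /= /msym mmapX mmap1U.
Qed.

Lemma perm_actC (s : 'S_n) (c : k) : perm_act s (ratfunC k n c) = ratfunC k n c.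
Proof.
rewrite /perm_act /ratfunC /= fracmap_tofrac; last exact: inj_msym.
by rewrite /= /msym mmapC.
Qed.

Variable G : {set 'S_n}.

(* The fixed subfield k(x_1, ..., x_n)^G. *)
Definition perm_fixedfield : fieldType := fixedfield G perm_act.

Lemma ratfunC_fixed (c : k) : ratfunC k n c \in fixed G perm_act.
Proof. by apply/fixedP=> s _; apply: perm_actC. Qed.

Definition fixedC (c : k) : perm_fixedfield := FixedField (ratfunC_fixed c).

Lemma fixedC_zmod_morphism : zmod_morphism fixedC.
Proof. by move=> c d; apply: val_inj; exact: (rmorphB (ratfunC k n)). Qed.

Lemma fixedC_monoid_morphism : monoid_morphism fixedC.
Proof.
split=> [|c d]; apply: val_inj; first exact: (rmorph1 (ratfunC k n)).
exact: (rmorphM (ratfunC k n)).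
Qed.

HB.instance Definition _ :=
  GRing.isZmodMorphism.Build k perm_fixedfield fixedC fixedC_zmod_morphism.
HB.instance Definition _ :=
  GRing.isMonoidMorphism.Build k perm_fixedfield fixedC fixedC_monoid_morphism.
End PermutationAction.

Arguments perm_fixedfield k {n} G.
Arguments fixedC k {n} G c.

(* Main.v *)
(* A minimal normal subgroup of G is elementary abelian and its orbits form a block
   system, with two blocks of size 7 or seven blocks of size 2.

   The basic tool is that if G acts on K(x) by x |-> a x + b with a, b in K, where K is
   G-stable and x is transcendental over K, then K(x)^G = K^G(t) for some t.  As the
   base field contains F_7, a set of seven variables on which an affine group of the
   line over F_7 acts can be replaced by its total mass, its centroid
   v = (sum i x_i) / (sum x_i), and its moments sum (i - v)^j x_i, which only get
   multiplied by constants.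

   With two blocks this reduces the problem to k(v0, v1)^G.  If the translations of G
   form a line, G acts triangularly on (v0, v1).  Otherwise the fixed field of the
   translations is k(z0, z1) with z = v^7 - v, on which G acts monomially, and G acts
   affinely on z0 over k(z1 / z0).

   With seven blocks {x_i, y_i}, put w_i = x_i - y_i.  The kernel N of the action on the
   blocks acts on the w_i by signs that form a cyclic code of length 7.  Up to constants,
   this code is trivial, contains the even words, or is a simplex code; in each case
   k(w)^N lies in k(d_0, .., d_6, p), where the d_i (that is w_i, w_i^2, or the products
   of the w_j over the lines of a Fano plane) are permuted affinely up to sign and p is
   the product of the w_i.  Moreover p^r is the product of the d_i with r = 2 or 3, so
   that the total mass of the d_i is a rational function of their ratios and of p divided
   by a power of this mass. *)

(* Solvability enters twice: a minimal normal subgroup is abelian, and with seven blocks some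
   element of order 7 rotates the blocks in such a way that its conjugates act on them as its
   powers. Either way the points get labels in F_7 on which [G] acts affinely. Independence of
   coordinates comes from counting: at most 14 elements over which the 14 variables are algebraic
   are independent. With seven blocks and a nontrivial code, the count is the obstacle: the d_i, the
   sums x_i + y_i and p are 15 elements, tied by p^r = d_0 ... d_6. Let eta be the total mass of the
   d_i and q = p / eta^e with e r = 6. The centroid, the five moments of order 2 to 6 divided by
   eta, q and the seven moments of the sums make 14 coordinates. They may generate less than the
   whole function field, but the field they generate contains all the invariants. *)
From HB Require Import structures.
Require Import Defs.
From mathcomp Require Import all_boot all_order all_algebra all_fingroup all_solvable.
From mathcomp Require Import generic_quotient fraction.
From mathcomp Require Import mpoly.
From mathcomp Require Import boolp ring zify.

Set Implicit Arguments.
Unset Strict Implicit.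
Unset Printing Implicit Defensive.

Import GRing.Theory.
Local Open Scope ring_scope.

(** * Subfields and algebraic elements *)

Section Subfields.
Variable E : fieldType.

(** Subfields are predicates on one ambient field, so that the fields of a tower and their fixed
    fields compare by inclusion, with no embeddings to carry along. *)
Record subfld := Subfld { sfpred :> {pred E}; subfldP : divring_closed sfpred }.

HB.instance Definition _ (F : subfld) :=
  GRing.isDivringClosed.Build E (sfpred F) (subfldP F).

Lemma adj1_closed (F : subfld) (x : E) : divring_closed
  [pred f | `[< exists p q, [/\ p \is a polyOver F, q \is a polyOver F,
     q.[x] != 0 & f = p.[x] / q.[x] ] >]].
Proof.
split=> [|f g|f g]; rewrite !inE.
- by apply/asboolP; exists 1, 1; rewrite rpred1 hornerC oner_neq0 divr1.
- move=> /asboolP[p [q [Fp Fq q0 ->]]] /asboolP[r [s [Fr Fs s0 ->]]].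
  apply/asboolP; exists (p * s - r * q), (q * s).
  rewrite rpredB ?rpredM // hornerM mulf_neq0 // hornerD hornerN !hornerM.
  by split=> //; field; rewrite q0 s0.
move=> /asboolP[p [q [Fp Fq q0 ->]]] /asboolP[r [s [Fr Fs s0 ->]]].
apply/asboolP; have [r0|r0] := eqVneq r.[x] 0.
  by exists 0, 1; rewrite rpred0 rpred1 r0 mul0r invr0 mulr0 !hornerC oner_neq0 mul0r.
exists (p * s), (q * r); rewrite !rpredM // !hornerM mulf_neq0 //.
by split=> //; field; rewrite q0 r0 s0.
Qed.

Definition adj1 (F : subfld) (x : E) : subfld := Subfld (adj1_closed F x).

Definition adjs (F : subfld) (s : seq E) : subfld := foldl adj1 F s.

Implicit Types F K : subfld.

Lemma adj1P (F : subfld) x f :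
  reflect (exists p q, [/\ p \is a polyOver F, q \is a polyOver F,
     q.[x] != 0 & f = p.[x] / q.[x] ]) (f \in adj1 F x).
Proof. exact: asboolP. Qed.

Lemma adj1_sub (F : subfld) x : {subset F <= adj1 F x}.
Proof.
move=> f Ff; apply/adj1P; exists f%:P, 1.
by rewrite polyOverC Ff rpred1 !hornerC oner_neq0 divr1.
Qed.

Lemma adj1_gen (F : subfld) x : x \in adj1 F x.
Proof.
apply/adj1P; exists 'X, 1.
by rewrite polyOverX rpred1 hornerX hornerC oner_neq0 divr1.
Qed.

Lemma rpred_horner_sub (F K : subfld) x p : {subset F <= K} -> x \in K ->
  p \is a polyOver F -> p.[x] \in K.
Proof.
move=> FK Kx Fp; apply: rpred_horner => //.
by apply/polyOverP=> i; apply: FK; move/polyOverP: Fp.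
Qed.

Lemma adj1_min (F K : subfld) x :
  {subset F <= K} -> x \in K -> {subset adj1 F x <= K}.
Proof.
move=> FK Kx f /adj1P[p [q [Fp Fq _ ->]]].
by rewrite rpred_div // (rpred_horner_sub FK).
Qed.

Lemma adjs_sub F s : {subset F <= adjs F s}.
Proof.
elim: s F => [|x s IHs] F f Ff //=.
by apply: IHs; apply: adj1_sub.
Qed.

Lemma adjs_gen F s : {subset s <= adjs F s}.
Proof.
elim: s F => [|x s IHs] F f //=; rewrite inE => /orP[/eqP->|]; last exact: IHs.
by apply: adjs_sub; apply: adj1_gen.
Qed.

Lemma adjs_min (F K : subfld) s :
  {subset F <= K} -> {subset s <= K} -> {subset adjs F s <= K}.
Proof.
elim: s F => [|x s IHs] F FK sK //=; apply: IHs => [|y ys].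
  by apply: adj1_min => //; apply: sK; rewrite mem_head.
by apply: sK; rewrite inE ys orbT.
Qed.

Lemma adjs_mono (F K : subfld) s t :
  {subset F <= adjs K t} -> {subset s <= t} -> {subset adjs F s <= adjs K t}.
Proof.
move=> FK st; apply: adjs_min => // x xs.
by apply: adjs_gen; apply: st.
Qed.

Lemma adjs_cat F s t : adjs F (s ++ t) = adjs (adjs F s) t.
Proof. exact: foldl_cat. Qed.

Definition alg (F : subfld) (x : E) : Prop :=
  exists p, [/\ p \is a polyOver F, p != 0 & root p x].

Lemma alg_sub (F K : subfld) x : {subset F <= K} -> alg F x -> alg K x.
Proof.
move=> FK [p [Fp p0 px]]; exists p; split=> //.
by apply/polyOverP=> i; apply: FK; move/polyOverP: Fp.
Qed.

Lemma alg_in (F : subfld) x : x \in F -> alg F x.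
Proof.
move=> Fx; exists ('X - x%:P); rewrite polyOverXsubC Fx root_XsubC polyXsubC_eq0.
by [].
Qed.

Lemma alg_horner (F : subfld) x (q : {poly E}) : (size q > 1)%N -> q \is a polyOver F ->
  alg F q.[x] -> alg F x.
Proof.
move=> sq Fq [p [Fp p0 px]]; exists (p \Po q); split.
- by rewrite polyOver_comp.
- by rewrite comp_poly_eq0.
by rewrite /root horner_comp.
Qed.

Fixpoint indep (F : subfld) (s : seq E) : Prop :=
  if s is x :: s' then ~ alg F x /\ indep (adj1 F x) s' else True.

Lemma indep_cat F s t : indep F (s ++ t) <-> indep F s /\ indep (adjs F s) t.
Proof.
elim: s F => [|x s IHs] F /=; first by split=> [|[]].
by rewrite IHs; split=> [[? []]|[[]]].
Qed.

Lemma not_indep F s : ~ indep F s ->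
  exists s1 x s2, s = s1 ++ x :: s2 /\ alg (adjs F s1) x.
Proof.
elim: s F => [|x s IHs] F //=; case: (pselect (alg F x)) => [ax _|nax nind].
  by exists [::], x, s.
have /IHs[s1 [y [s2 [-> ay]]]] : ~ indep (adj1 F x) s by move=> h; apply: nind.
by exists (x :: s1), y, s2.
Qed.

Lemma indep_sub (F K : subfld) s : {subset F <= K} -> indep K s -> indep F s.
Proof.
elim: s F K => [|x s IHs] F K FK //= [nax ind]; split.
  by move=> /(alg_sub FK).
apply: IHs ind => y; apply: adj1_min; last exact: adj1_gen.
by move=> z /FK; apply: adj1_sub.
Qed.

End Subfields.

Section SubfieldType.
Variables (E : fieldType) (F : subfld E).

Record sftype : predArgType := SFType { sfval :> E; sfvalP : sfval \in F }.

HB.instance Definition _ := [isSub for sfval].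
HB.instance Definition _ := [Choice of sftype by <:].
HB.instance Definition _ := [SubChoice_isSubIntegralDomain of sftype by <:].
HB.instance Definition _ := [SubIntegralDomain_isSubField of sftype by <:].

Definition sfinj : {rmorphism sftype -> E} := (val : sftype -> E).

Lemma sfinjP x : sfinj x \in F.
Proof. exact: valP. Qed.

Lemma polyOver_sf (p : {poly E}) :
  p \is a polyOver F -> exists q : {poly sftype}, p = map_poly sfinj q.
Proof.
move=> /polyOverP Fp; exists (\poly_(i < size p) SFType (Fp i)).
apply/polyP=> i; rewrite coef_map coef_poly; case: ltnP => // le_pi.
exact: nth_default.
Qed.

Lemma sf_polyOver (q : {poly sftype}) : map_poly sfinj q \is a polyOver F.
Proof. by apply/polyOverP=> i; rewrite coef_map sfinjP. Qed.

Lemma algE x : alg F x <-> algebraicOver sfinj x.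
Proof.
split=> [[p [Fp p0 px]]|[q q0 qx]]; last first.
  by exists (map_poly sfinj q); rewrite sf_polyOver map_poly_eq0.
have [q qE] := polyOver_sf Fp; exists q; last by rewrite -qE.
by move: p0; rewrite qE map_poly_eq0.
Qed.

Lemma alg_add x y : alg F x -> alg F y -> alg F (x + y).
Proof. by rewrite !algE; apply: algebraic_add. Qed.

Lemma alg_mul x y : alg F x -> alg F y -> alg F (x * y).
Proof. by rewrite !algE; apply: algebraic_mul. Qed.

Lemma alg_inv x : alg F x -> alg F x^-1.
Proof. by rewrite !algE; apply: algebraic_inv. Qed.

Lemma alg_poly x p : p \is a polyOver F -> alg F x -> alg F p.[x].
Proof.
move=> Fp ax; rewrite horner_coef; elim/big_ind: _ => [||i _].
- by apply: alg_in; rewrite rpred0.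
- exact: alg_add.
apply: alg_mul; first by apply: alg_in; move/polyOverP: Fp.
elim: (i : nat) => [|n IHn]; first by rewrite expr0; apply: alg_in; rewrite rpred1.
by rewrite exprS; apply: alg_mul.
Qed.

Lemma alg_adj1 x y : alg F x -> y \in adj1 F x -> alg F y.
Proof.
move=> ax /adj1P[p [q [Fp Fq _ ->]]].
by apply: alg_mul; [|apply: alg_inv]; apply: alg_poly.
Qed.

Lemma polyOver_divp (p q : {poly E}) : p \is a polyOver F -> q \is a polyOver F ->
  p %/ q \is a polyOver F.
Proof.
by move=> /polyOver_sf[p' ->] /polyOver_sf[q' ->]; rewrite -map_divp sf_polyOver.
Qed.

Lemma polyOver_modp (p q : {poly E}) : p \is a polyOver F -> q \is a polyOver F ->
  p %% q \is a polyOver F.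
Proof.
by move=> /polyOver_sf[p' ->] /polyOver_sf[q' ->]; rewrite -map_modp sf_polyOver.
Qed.

End SubfieldType.

Section Algebraic.
Variable E : fieldType.
Implicit Types (F K : subfld E) (x y : E).

Lemma alg_trans F K x : (forall y, y \in K -> alg F y) -> alg K x -> alg F x.
Proof.
move=> KF [p [Kp p0 px]]; apply/algE/integral_algebraic.
have lp : (lead_coef p)^-1 != 0 by rewrite invr_eq0 lead_coef_eq0.
apply: (@integral_root_monic _ _ _ _ ((lead_coef p)^-1 *: p)).
- by rewrite monicE lead_coefZ mulVf ?lead_coef_eq0.
- by rewrite rootZ.
move=> c /(nthP 0)[i _ <-]; apply/integral_algebraic/algE/KF.
rewrite coefZ rpredM ?rpredV ?lead_coefE //.
  by move/polyOverP: Kp.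
by move/polyOverP: Kp.
Qed.

Lemma alg_adjs F s x : (forall y, y \in s -> alg F y) -> alg (adjs F s) x -> alg F x.
Proof.
elim: s F x => [|y s IHs] F x //= sF ax.
have ay : alg F y by apply: sF; rewrite mem_head.
apply: (@alg_trans F (adj1 F y)); first by move=> z; apply: alg_adj1.
apply: IHs ax => z zs; apply: (@alg_sub _ F); first exact: adj1_sub.
by apply: sF; rewrite inE zs orbT.
Qed.

(** The inverse of q.[x], being algebraic, is a polynomial in q.[x], so fractions in [x] are
    polynomials in [x]. Reduction modulo [P] bounds their size, which [fixed_simple_ext] compares
    with a number of conjugates. *)
Lemma alg_adj1_poly F x (P : {poly E}) y :
  P \is a polyOver F -> P != 0 -> root P x -> y \in adj1 F x ->
  exists p, [/\ p \is a polyOver F, (size p < size P)%N & y = p.[x]].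
Proof.
move=> FP P0 Px.
suff inv q : q \is a polyOver F -> q.[x] != 0 ->
    exists2 u, u \is a polyOver F & u.[x] * q.[x] = 1.
  case/adj1P=> p [q [Fp Fq q0 ->]]; have [u Fu uq] := inv q Fq q0.
  exists ((p * u) %% P); rewrite polyOver_modp ?rpredM // ltn_modp //; split=> //.
  have -> : q.[x]^-1 = u.[x] by rewrite -[RHS](mulfK q0) uq mul1r.
  rewrite -hornerM {1}(divp_eq (p * u) P) hornerD hornerM.
  by rewrite (rootP Px) mulr0 add0r.
move=> Fq q0.
have [g [Fg g0 gq]] : alg F q.[x] by apply: alg_poly => //; exists P.
suff [u Fu uq] : exists2 u, u \is a polyOver F & u.[q.[x]] * q.[x] = 1.
  by exists (u \Po q); rewrite ?polyOver_comp // horner_comp.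
elim/poly_ind: g Fg g0 gq => [|g a IHg] Fg g0 gq; first by rewrite eqxx in g0.
have Fg1 : g \is a polyOver F.
  apply/polyOverP=> i; have /polyOverP/(_ i.+1) := Fg.
  by rewrite coefD coefMX coefC /= addr0.
have Fa : a \in F.
  by have /polyOverP/(_ 0) := Fg; rewrite coefD coefMX coefC /= add0r.
move: gq; rewrite /root hornerMXaddC.
(* A relation g(z) z + a = 0 for z = q.[x] gives the inverse - g(z) / a when [a] is nonzero;
   otherwise z cancels and [g] is a shorter relation. *)
have [a0|a0] := eqVneq a 0.
  rewrite a0 addr0 mulf_eq0 (negbTE q0) orbF => gq; apply: IHg => //.
  by apply: contra_neq g0 => ->; rewrite a0 mul0r add0r.
rewrite addr_eq0 => /eqP gq; exists (- a^-1 *: g).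
  by rewrite polyOverZ // rpredN rpredV.
by rewrite hornerZ -mulrA gq mulrN mulNr opprK mulVf.
Qed.
End Algebraic.

Arguments adj1 : simpl never.

(** * Exchange property *)

Section Steinitz.
Variable E : fieldType.
Implicit Types (F K : subfld E) (x y : E) (s t : seq E).

Lemma adj1_common_denom F x (n : nat) (c : nat -> E) :
  (forall i, c i \in adj1 F x) ->
  exists D A, [/\ D \is a polyOver F, D.[x] != 0,
    forall i, A i \is a polyOver F & forall i, (i < n)%N -> c i * D.[x] = (A i).[x]].
Proof.
move=> cF; elim: n => [|n [D [A [FD D0 FA cA]]]].
  by exists 1, (fun=> 0); rewrite rpred1 hornerC oner_neq0; split=> // i; rewrite rpred0.
have /adj1P[p [q [Fp Fq q0 cE]]] := cF n.
exists (D * q), (fun i => if i == n then p * D else A i * q).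
split=> [||i|i]; first by rewrite rpredM.
- by rewrite hornerM mulf_neq0.
- by case: ifP; rewrite rpredM.
rewrite ltnS leq_eqVlt; case: eqVneq => [-> _|_ /= /cA Ai].
  by rewrite !hornerM cE; field.
by rewrite !hornerM mulrA Ai.
Qed.

(** Clearing denominators turns the relation of [y] over F(x) into a polynomial relation in [x] and
    [y] over [F]; [Q] is this relation read as a polynomial in [x]. If it were zero, some nonzero
    coefficient polynomial [B j] would vanish at [y]. *)
Lemma exchange F x y : alg (adj1 F x) y -> ~ alg F y -> alg (adj1 F y) x.
Proof.
move=> [p [Fp p0 py]] nay.
have [D [A [FD D0 FA pA]]] := adj1_common_denom (size p) (polyOverP Fp).
pose B (j : nat) := \poly_(i < size p) (A i)`_j.
have FB j : B j \is a polyOver F.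
  by apply/polyOverP=> i; rewrite coef_poly; case: ifP => _; [exact: (polyOverP (FA i)) | exact: rpred0].
pose Q := \sum_(i < size p) (y ^+ i) *: A i.
have QE j : Q`_j = (B j).[y].
  rewrite coef_sum horner_poly; apply: eq_bigr => i _.
  by rewrite coefZ mulrC.
exists Q; split.
- apply/polyOverP=> j; rewrite QE.
  by apply: (@rpred_horner_sub _ F); [exact: adj1_sub | exact: adj1_gen | ].
- apply/eqP=> Q0; have sp : (0 < size p)%N by rewrite size_poly_gt0.
  have [j Aj] : exists j, (A (size p).-1)`_j != 0.
    apply/not_existsP=> A0.
    have A_0 : A (size p).-1 = 0.
      by apply/polyP=> j; rewrite coef0; apply/eqP; apply: contrapT => /negP; apply: A0.
    have := pA (size p).-1; rewrite prednK // leqnn => /(_ isT)/eqP.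
    by rewrite A_0 horner0 mulf_eq0 (negbTE D0) orbF lead_coef_eq0 (negbTE p0).
  apply: nay; exists (B j); split=> //.
    apply: contra_neq Aj => /polyP/(_ (size p).-1).
    by rewrite coef_poly prednK // leqnn coef0.
  by rewrite /root -QE Q0 coef0.
rewrite /root /Q horner_sum; apply/eqP.
have /rootP := py; rewrite horner_coef => /(congr1 (fun z => z * D.[x])).
rewrite mul0r mulr_suml => e; rewrite -[RHS]e; apply: eq_bigr => i _.
by rewrite hornerZ -pA // mulrC mulrAC.
Qed.

(* The [y] found here is the first element of [t] such that [x] is algebraic over
   the subfield generated by [t] up to [y]. *)
Lemma exchange_seq F t x : ~ alg F x -> alg (adjs F t) x ->
  exists t1 y t2, t = t1 ++ y :: t2 /\ alg (adjs F (x :: t1 ++ t2)) y.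
Proof.
elim: t F => [|y t IHt] F nax //= ax.
case: (pselect (alg (adj1 F y) x)) => [axy|naxy].
  exists [::], y, t; split=> //=; apply: (@alg_sub _ (adj1 F x)); first exact: adjs_sub.
  exact: exchange.
have [t1 [z [t2 [-> az]]]] := IHt (adj1 F y) naxy ax.
exists (y :: t1), z, t2; split=> //; apply: alg_sub az => u.
apply: (@adjs_mono _ F F (y :: x :: t1 ++ t2) (x :: (y :: t1) ++ t2)) => v.
  exact: adjs_sub.
by rewrite !inE => /or3P[]->; rewrite ?orbT.
Qed.

(** Each element of [s] is exchanged for one of [t], which stays algebraic over what remains, and
    the induction continues over the field extended by that element of [s]. *)
Lemma steinitz F s t : indep F s -> (forall x, x \in s -> alg (adjs F t) x) ->
  (size s <= size t)%N.
Proof.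
elim: s F t => [|x s IHs] F t //= [nax ind] sat.
have [|t1 [y [t2 [tE ay]]]] := exchange_seq nax (t := t).
  by apply: sat; rewrite mem_head.
rewrite tE size_cat /= addnS ltnS -size_cat.
apply: (IHs (adj1 F x)) => // z zs.
have az : alg (adjs F t) z by apply: sat; rewrite inE zs orbT.
apply: (@alg_adjs _ _ [:: y]) => [u|].
  by rewrite inE => /eqP->.
apply: alg_sub az => u.
rewrite -adjs_cat.
apply: (@adjs_mono _ F F t (x :: (t1 ++ t2) ++ [:: y])) => v; first exact: adjs_sub.
rewrite tE !inE !mem_cat !inE => /or3P[] ->; by rewrite ?orbT.
Qed.

(** An element of [t] that depended on its predecessors could be deleted, and [s] would be algebraic
    over fewer than [size s] elements. *)
Lemma indep_of_size F s t : indep F s -> (size t <= size s)%N ->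
  (forall x, x \in s -> alg (adjs F t) x) -> indep F t.
Proof.
move=> ind st sat; apply: contrapT => /not_indep[t1 [y [t2 [tE ay]]]].
suff : (size s <= size (t1 ++ t2))%N.
  move=> h; have := leq_trans st h.
  by rewrite tE !size_cat /= addnS ltnn.
apply: (steinitz ind) => x /sat ax.
apply: (@alg_adjs _ _ [:: y]) => [u|].
  rewrite inE => /eqP->; apply: alg_sub ay => v.
  by rewrite adjs_cat; apply: adjs_sub.
apply: alg_sub ax => u; rewrite -adjs_cat.
apply: adjs_mono => v; first exact: adjs_sub.
by rewrite tE !mem_cat !inE => /or3P[] ->; rewrite ?orbT.
Qed.

End Steinitz.

(* Infinitely many conjugates would be roots of the same polynomial. *)
Lemma not_alg_conj (E : fieldType) (F : subfld E) (x : E)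
    (phi : nat -> {rmorphism E -> E}) :
  (forall m f, f \in F -> phi m f = f) -> injective (fun m => phi m x) -> ~ alg F x.
Proof.
move=> phiF phi_inj [p [/polyOverP Fp p0 px]].
have := @max_poly_roots _ p (map (fun m => phi m x) (iota 0 (size p))) p0.
rewrite size_map size_iota ltnn => no; suff : false by []; apply: no => /=.
  apply/allP=> _ /mapP[m _ ->]; rewrite /root.
  have -> : p = map_poly (phi m) p.
    by apply/polyP=> i; rewrite coef_map /= phiF.
  by rewrite horner_map (rootP px) rmorph0.
by rewrite map_inj_uniq ?iota_uniq.
Qed.

(** * Rational function fields *)

Section FractionSubfield.
Variables (R : idomainType) (E : fieldType) (f : {rmorphism R -> E}).

Lemma fracsf_closed : divring_closed
  [pred x | `[< exists p q, f q != 0 /\ x = f p / f q >]].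
Proof.
split=> [|x y|x y]; rewrite !inE.
- by apply/asboolP; exists 1, 1; rewrite rmorph1 oner_neq0 divr1.
- move=> /asboolP[p [q [q0 ->]]] /asboolP[r [s [s0 ->]]].
  apply/asboolP; exists (p * s - r * q), (q * s).
  rewrite rmorphB !rmorphM mulf_neq0 //.
  by split=> //; field; rewrite q0 s0.
move=> /asboolP[p [q [q0 ->]]] /asboolP[r [s [s0 ->]]].
apply/asboolP; have [r0|r0] := eqVneq (f r) 0.
  by exists 0, 1; rewrite r0 mul0r invr0 mulr0 rmorph0 rmorph1 oner_neq0 mul0r.
exists (p * s), (q * r); rewrite !rmorphM mulf_neq0 //.
by split=> //; field; rewrite q0 r0 s0.
Qed.

Definition fracsf : subfld E := Subfld fracsf_closed.

Lemma fracsfP x : reflect (exists p q, f q != 0 /\ x = f p / f q) (x \in fracsf).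
Proof. exact: asboolP. Qed.

Lemma fracsf_im p : f p \in fracsf.
Proof. by apply/fracsfP; exists p, 1; rewrite rmorph1 oner_neq0 divr1. Qed.

Lemma fracsf_min (K : subfld E) : (forall p, f p \in K) -> {subset fracsf <= K}.
Proof. by move=> fK x /fracsfP[p [q [_ ->]]]; rewrite rpred_div. Qed.

Hypothesis f_inj : injective f.

Definition fracext (x : {fraction R}) : E := f \n_(repr x) / f \d_(repr x).

Lemma fracext_div (p q : R) : q != 0 -> fracext (tofrac p / tofrac q) = f p / f q.
Proof.
move=> q0; set x := (X in fracext X); rewrite /fracext.
have d0 : \d_(repr x) != 0 by apply: denom_ratioP.
have xE := frac_repr x; move: xE d0.
move: (\n_(repr x)) (\d_(repr x)) => n d xE d0.
have f0 (r : R) : r != 0 -> f r != 0.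
  by apply: contra_neq => e; apply: f_inj; rewrite e rmorph0.
apply/eqP; rewrite eqr_div ?f0 // -!rmorphM (inj_eq f_inj) -tofrac_eq !tofracM.
by rewrite -eqr_div ?tofrac_eq0 // -xE.
Qed.

Lemma fracext_tofrac (p : R) : fracext (tofrac p) = f p.
Proof.
rewrite -[X in fracext X]divr1 -(tofrac1 R) fracext_div ?oner_neq0 //.
by rewrite rmorph1 divr1.
Qed.

Lemma fracext_zmod_morphism : zmod_morphism fracext.
Proof.
move=> x y; rewrite [x]frac_repr [y]frac_repr.
have := denom_ratioP (repr x); have := denom_ratioP (repr y).
move: (\n_(repr x)) (\d_(repr x)) (\n_(repr y)) (\d_(repr y)).
move=> a b c d d0 b0.
have f0 (r : R) : r != 0 -> f r != 0.
  by apply: contra_neq => e; apply: f_inj; rewrite e rmorph0.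
rewrite -mulNr addf_div ?tofrac_eq0 // -tofracN -!tofracM -tofracD.
rewrite !fracext_div ?mulf_neq0 // rmorphD !rmorphM rmorphN.
by rewrite -mulNr addf_div ?f0.
Qed.

Lemma fracext_monoid_morphism : monoid_morphism fracext.
Proof.
split=> [|x y]; first by rewrite -(tofrac1 R) fracext_tofrac rmorph1.
rewrite [x]frac_repr [y]frac_repr.
have := denom_ratioP (repr x); have := denom_ratioP (repr y).
move: (\n_(repr x)) (\d_(repr x)) (\n_(repr y)) (\d_(repr y)).
move=> a b c d d0 b0.
rewrite mulf_div -!tofracM !fracext_div ?mulf_neq0 // !(rmorphM f).
by rewrite mulf_div.
Qed.

HB.instance Definition _ :=
  GRing.isZmodMorphism.Build {fraction R} E fracext fracext_zmod_morphism.
HB.instance Definition _ :=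
  GRing.isMonoidMorphism.Build {fraction R} E fracext fracext_monoid_morphism.

Definition fracextM : {rmorphism {fraction R} -> E} := fracext.

End FractionSubfield.

Arguments fracsf : simpl never.

Section MpolyMorphisms.
Variables (n : nat) (R : comNzRingType).

Lemma mpoly_rmorph_ext (S : comNzRingType) (f g : {rmorphism {mpoly R[n]} -> S}) :
  (forall c, f c%:MP = g c%:MP) -> (forall i, f 'X_i = g 'X_i) -> f =1 g.
Proof.
move=> fgC fgX p; rewrite [p]mpolyE !rmorph_sum; apply: eq_bigr => m _.
rewrite -mul_mpolyC !rmorphM fgC; congr (_ * _).
rewrite mpolyXE_id !rmorph_prod; apply: eq_bigr => i _.
by rewrite !rmorphXn /= fgX.
Qed.

End MpolyMorphisms.

Section MpolyUni.
Variables (n : nat) (R : comNzRingType).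

Lemma muniX (i : 'I_n) : muni ('X_(widen_ord (leqnSn n) i) : {mpoly R[n.+1]}) = ('X_i)%:P.
Proof.
rewrite muniE msuppX big_seq1 mcoeffX eqxx scale1r mnmE /=.
rewrite (_ : _ == _ = false) /= ?expr0 ?alg_polyC; last first.
  by apply/negbTE; rewrite neq_ltn /= ltn_ord.
congr ('X_[ _ ])%:P; apply/mnmP => j; rewrite !mnmE.
by rewrite -val_eqE.
Qed.

Lemma muniX_max : muni ('X_ord_max : {mpoly R[n.+1]}) = 'X.
Proof.
rewrite muniE msuppX big_seq1 mcoeffX eqxx scale1r mnmE eqxx expr1.
rewrite (_ : [multinom _ | i < n] = 0%MM) ?mpolyX0 ?scale1r //.
apply/mnmP => j; rewrite !mnmE; apply/eqP; rewrite eqb0 -val_eqE /=.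
by rewrite neq_ltn ltn_ord orbT.
Qed.

Lemma ord_widen_or_max (i : 'I_n.+1) :
  i = ord_max \/ exists j : 'I_n, i = widen_ord (leqnSn n) j.
Proof.
have [lt_in|] := ltnP i n; last first.
  by move=> le_ni; left; apply/val_inj/eqP; rewrite eqn_leq le_ni -ltnS ltn_ord.
by right; exists (Ordinal lt_in); apply: val_inj.
Qed.

Lemma muni_eq0 (p : {mpoly R[n.+1]}) : muni p = 0 -> p = 0.
Proof.
pose g : {rmorphism {mpoly R[n.+1]} -> {mpoly R[n.+1]}} :=
  horner_eval ('X_ord_max : {mpoly R[n.+1]}) \o map_poly (@mwiden n R) \o @muni n R.
have gE : g =1 idfun.
  apply: (@mpoly_rmorph_ext _ _ _ g idfun) => [c|i]; rewrite /g /=.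
    by rewrite muniC map_polyC /horner_eval hornerC /= mwidenC.
  have [->|[j ->]] := ord_widen_or_max i.
    by rewrite muniX_max map_polyX /horner_eval hornerX.
  by rewrite muniX map_polyC /horner_eval hornerC /= mwidenX mnmwiden1.
by move=> p0; rewrite -[LHS]gE /g /= p0 !rmorph0.
Qed.

End MpolyUni.

Section Evaluation.
Variables (k E : fieldType) (iota : {rmorphism k -> E}) (h : nat -> E).

(** The values [h] are indexed by all natural numbers, so that evaluations in [n] and [n.+1]
    variables agree and induction on [n] applies. *)
Definition mev n (p : {mpoly k[n]}) : E := mmap iota (fun i : 'I_n => h i) p.

HB.instance Definition _ n := GRing.RMorphism.copy (@mev n)
  (mmap iota (fun i : 'I_n => h i) : {rmorphism {mpoly k[n]} -> E}).

Lemma mevX n (i : 'I_n) : @mev n 'X_i = h i.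
Proof. by rewrite /mev /= mmapX mmap1U. Qed.

Lemma mevC n c : @mev n c%:MP = iota c.
Proof. by rewrite /mev /= mmapC. Qed.

Lemma mev_muni n (p : {mpoly k[n.+1]}) : mev p = (map_poly (@mev n) (muni p)).[h n].
Proof.
pose g : {rmorphism {mpoly k[n.+1]} -> E} :=
  horner_eval (h n) \o map_poly (@mev n) \o @muni n k.
rewrite -[RHS]/(g p); apply: mpoly_rmorph_ext => [c|i]; rewrite /g /=.
  by rewrite muniC map_polyC /horner_eval hornerC /= !mevC.
rewrite mevX; have [->|[j ->]] := ord_widen_or_max i.
  by rewrite muniX_max map_polyX /horner_eval hornerX.
by rewrite muniX map_polyC /horner_eval hornerC /= mevX.
Qed.

Lemma adjs_mev n : {subset adjs (fracsf iota) (mkseq h n) <= fracsf (@mev n)}.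
Proof.
apply: adjs_min => [|x /mapP[i]].
  by apply: fracsf_min => c; rewrite -(@mevC n); apply: fracsf_im.
rewrite mem_iota /= add0n => lt_in ->.
by rewrite -[i]/(val (Ordinal lt_in)) -mevX; apply: fracsf_im.
Qed.

Lemma mev_adjs n p : @mev n p \in adjs (fracsf iota) (mkseq h n).
Proof.
rewrite /mev /= /mmap rpred_sum // => m _; apply: rpredM.
  by apply: adjs_sub; apply: fracsf_im.
apply: rpred_prod => i _; apply: rpredX; apply: adjs_gen.
by apply/mapP; exists (i : nat); rewrite // mem_iota /= ltn_ord.
Qed.

(** A polynomial in the kernel, seen as univariate in its last variable, is a relation for [h n]
    over the field of the earlier values. So its coefficients evaluate to zero, and the induction
    hypothesis applies to them. *)
Lemma mev_inj n : indep (fracsf iota) (mkseq h n) -> injective (@mev n).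
Proof.
move=> ind; apply: raddf_inj => p; move: p.
suff key (p : {mpoly k[n]}) : mev p = 0 -> p = 0 by exact: key.
elim: n ind p => [_|n IHn ind] p.
  have -> : p = (p@_0%MM)%:MP.
    apply/mpolyP=> m; rewrite mcoeffC.
    by rewrite (_ : m = 0%MM) ?eqxx ?mulr1 //; apply/mnmP=> -[].
  by rewrite mevC => /eqP; rewrite fmorph_eq0 => /eqP->; rewrite mpolyC0.
move: ind; rewrite mkseqS -cats1 => /indep_cat[ind [nalg _]] p0.
apply: muni_eq0; apply: contrapT => /eqP mp0; apply: nalg.
exists (map_poly (@mev n) (muni p)); split.
- by apply/polyOverP=> i; rewrite coef_map mev_adjs.
- apply/eqP=> q0; case/eqP: mp0; apply/polyP=> i; rewrite coef0.
  by apply: (IHn ind); rewrite -coef_map q0 coef0.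
by rewrite /root -mev_muni p0.
Qed.

End Evaluation.

(** Independence and generation are tested in [E] because the fixed field is a type of its own,
    while the towers that produce [s] live in the ambient function field. *)
Lemma rational_of_indep (k L E : fieldType) (iota : {rmorphism k -> L})
    (j : {rmorphism L -> E}) (s : seq L) :
  indep (fracsf (j \o iota)) (map j s) ->
  (forall x, j x \in adjs (fracsf (j \o iota)) (map j s)) ->
  rational k L iota.
Proof.
move=> ind gen; pose h i := nth 0 s i; pose n := size s.
have hE : map j s = mkseq (j \o h) n.
  by rewrite -[s in LHS](mkseq_nth 0) /mkseq -map_comp.
have jE (p : {mpoly k[n]}) : j (mev iota h p) = mev (j \o iota) (j \o h) p :> E.
  apply: (@mpoly_rmorph_ext _ _ _ (j \o @mev _ _ iota h n)
     (@mev _ _ (j \o iota) (j \o h) n)) => [c|i] /=.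
    by rewrite !mevC.
  by rewrite !mevX.
rewrite hE in ind gen.
have inj : injective (@mev _ _ iota h n).
  by move=> p q /(congr1 j); rewrite !jE; apply: mev_inj.
exists n, (fracextM inj); split; last first.
  by move=> c; rewrite /= fracext_tofrac //; apply: mevC.
have surj x : exists y, fracextM inj y == x.
  have /adjs_mev/fracsfP[p [q [q0 xE]]] := gen x.
  exists (tofrac p / tofrac q); rewrite /= fracext_div //.
    by rewrite -(inj_eq (fmorph_inj j)) fmorph_div !jE xE.
  by apply: contra_neq q0 => ->; rewrite rmorph0.
exists (fun x => xchoose (surj x)) => [x|x]; last by apply/eqP/(xchooseP (surj x)).
by apply: (fmorph_inj (fracextM inj)); apply/eqP/(xchooseP (surj _)).
Qed.

Section RationalFunctions.
Variables (k : fieldType) (n : nat).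
Local Notation E := (ratfun k n).
Definition rfbase : subfld E := fracsf (ratfunC k n).
Definition rfX (i : 'I_n) : E := tofrac 'X_i.

Lemma ratfun_gen (x : E) : x \in adjs rfbase (map rfX (enum 'I_n)).
Proof.
suff tf p : tofrac p \in adjs rfbase (map rfX (enum 'I_n)).
  by rewrite [x]frac_repr rpred_div.
rewrite [p]mpolyE rmorph_sum rpred_sum // => m _.
rewrite -mul_mpolyC rmorphM rpredM //.
  by apply: adjs_sub; apply: (fracsf_im (ratfunC k n)).
rewrite mpolyXE_id rmorph_prod rpred_prod // => i _.
rewrite rmorphXn rpredX //; apply: adjs_gen.
by apply: (map_f rfX); rewrite mem_enum.
Qed.

(* The automorphisms ['X_i |-> 'X_i + 'X_j ^+ m] give ['X_i] infinitely many conjugates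
   over the subfield generated by the other variables. *)
Section Shift.
Variables (i j : 'I_n) (ij : i != j).

Definition mshift (h : {mpoly k[n]}) : {rmorphism {mpoly k[n]} -> {mpoly k[n]}} :=
  mmap (@mpolyC n k) (fun l => 'X_l + (if l == i then h else 0)).

Lemma mshiftX h l : mshift h 'X_l = 'X_l + (if l == i then h else 0).
Proof. by rewrite /mshift /= mmapX mmap1U. Qed.

Lemma mshift_inj m : injective (mshift ('X_j ^+ m)).
Proof.
apply: (can_inj (g := mshift (- 'X_j ^+ m))) => p.
apply: (@mpoly_rmorph_ext _ _ _ (mshift (- 'X_j ^+ m) \o mshift ('X_j ^+ m)) idfun) => [c|l] /=.
  by rewrite /mshift /= !mmapC.
have Xj h : mshift h 'X_j = 'X_j by rewrite mshiftX eq_sym (negbTE ij) addr0.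
rewrite mshiftX rmorphD mshiftX; case: eqVneq => _; last by rewrite rmorph0 !addr0.
by rewrite rmorphXn /= Xj subrK.
Qed.

HB.instance Definition _ m := GRing.isZmodMorphism.Build E E
  (fracmap (mshift ('X_j ^+ m))) (fracmap_zmod_morphism (@mshift_inj m)).
HB.instance Definition _ m := GRing.isMonoidMorphism.Build E E
  (fracmap (mshift ('X_j ^+ m))) (fracmap_monoid_morphism (@mshift_inj m)).

Definition rfshift m : {rmorphism E -> E} := fracmap (mshift ('X_j ^+ m)).

Lemma rfshiftX m l : rfshift m (rfX l) = rfX l + (if l == i then rfX j ^+ m else 0).
Proof.
rewrite /rfshift /= fracmap_tofrac; last exact: mshift_inj.
rewrite mshiftX rmorphD; congr (_ + _).
by case: ifP => _; rewrite ?rmorph0 ?rmorphXn.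
Qed.

Lemma rfshiftC m c : rfshift m (ratfunC k n c) = ratfunC k n c.
Proof.
rewrite /rfshift /= fracmap_tofrac; last exact: mshift_inj.
by rewrite /mshift /= mmapC.
Qed.

Lemma rfX_inj_exp : injective (fun m => rfX j ^+ m).
Proof.
move=> a b; rewrite /= -!tofracXn => /eqP; rewrite tofrac_eq !mpolyXn => /eqP e.
have := msuppX k (U_(j) *+ a)%MM; rewrite e msuppX => -[/mnmP/(_ j)].
by rewrite !mulmnE mnm1E eqxx !mul1n.
Qed.

End Shift.

(** A dependent variable would be algebraic over the variables enumerated before it; these are fixed
    by the shifts, which give the variable itself infinitely many images. The shifts call for a
    second variable. *)
Lemma ratfun_indep : (1 < n)%N -> indep rfbase (map rfX (enum 'I_n)).
Proof.
move=> n1; apply: contrapT => /not_indep[s1 [x [s2 [sE]]]].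
have sz : (size s1 < size (enum 'I_n))%N.
  by rewrite -(size_map rfX) sE size_cat /= addnS ltnS leq_addr.
have i0 : 'I_n by apply: Ordinal (ltnW n1).
set i := nth i0 (enum 'I_n) (size s1).
have xE : x = rfX i.
  by rewrite -(nth_map i0 (rfX i0)) // sE nth_cat ltnn subnn.
have s1E : s1 = map rfX (take (size s1) (enum 'I_n)).
  by rewrite map_take sE take_size_cat.
have [j ij] : exists j : 'I_n, i != j.
  case: (eqVneq i (Ordinal (ltnW n1))) => [->|]; last by exists (Ordinal (ltnW n1)).
  by exists (Ordinal n1); rewrite -val_eqE.
rewrite xE; apply: (@not_alg_conj _ _ _ (rfshift ij)) => [m|a b /=]; last first.
  by rewrite !(rfshiftX ij) eqxx => /addrI/rfX_inj_exp.
suff fixK : divring_closed [pred f | rfshift ij m f == f].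
  move=> f fs; apply/eqP; move: f fs.
  apply: (@adjs_min _ _ (Subfld fixK)) => [|y].
    by apply: fracsf_min => c; rewrite inE rfshiftC.
  rewrite s1E => /mapP[l ls ->]; rewrite inE rfshiftX.
  have [li|_] := eqVneq l i; last by rewrite addr0.
  have := enum_uniq 'I_n; rewrite -(cat_take_drop (size s1) (enum 'I_n)).
  rewrite cat_uniq => /and3P[_ /hasPn no _].
  have /no : i \in drop (size s1) (enum 'I_n).
    by rewrite (drop_nth i0) // mem_head.
  by rewrite /= -li ls.
split=> [|f g /eqP fe /eqP ge|f g /eqP fe /eqP ge]; rewrite inE.
- by rewrite rmorph1.
- by rewrite rmorphB fe ge.
by rewrite fmorph_div fe ge.
Qed.

End RationalFunctions.

Arguments rfbase : simpl never.

(** * Fixed fields of affine actions *)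

Section FixedFields.
Variables (E : fieldType) (gT : finGroupType) (G : {group gT}).
Variable act : gT -> {rmorphism E -> E}.
Hypothesis actM : forall s t x, act (s * t)%g x = act t (act s x).
Implicit Types (K F : subfld E) (x f : E).

Definition fixed_by x := forall s, s \in G -> act s x = x.

Lemma fixed_by_closed K : divring_closed [pred f | (f \in K) && `[< fixed_by f >]].
Proof.
split=> [|f g|f g]; rewrite !inE.
- by rewrite rpred1; apply/asboolP=> s _; rewrite rmorph1.
- move=> /andP[Kf /asboolP If] /andP[Kg /asboolP Ig]; rewrite rpredB //.
  by apply/asboolP=> s sG; rewrite rmorphB If ?Ig.
- move=> /andP[Kf /asboolP If] /andP[Kg /asboolP Ig]; rewrite rpred_div //.
by apply/asboolP=> s sG; rewrite fmorph_div If ?Ig.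
Qed.

Definition fixsf K : subfld E := Subfld (fixed_by_closed K).

Lemma fixsfP K f : reflect (f \in K /\ fixed_by f) (f \in fixsf K).
Proof. by apply: (iffP andP) => -[Kf /asboolP If]. Qed.

Definition stable K := forall s, s \in G -> forall f, f \in K -> act s f \in K.

Lemma stable_adj1 K x : stable K ->
  (forall s, s \in G -> act s x \in adj1 K x) -> stable (adj1 K x).
Proof.
move=> stK stx s sG f /adj1P[p [q [Kp Kq q0 ->]]].
rewrite fmorph_div -!horner_map.
have sub p' : p' \is a polyOver K -> map_poly (act s) p' \is a polyOver K.
  by move=> /polyOverP Kp'; apply/polyOverP=> i; rewrite coef_map stK.
by rewrite rpred_div //; (apply: rpred_horner_sub; [exact: adj1_sub|exact: stx|exact: sub]).
Qed.

Lemma act1 x : act 1%g x = x.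
Proof. by apply: (fmorph_inj (act 1%g)); rewrite -actM mulg1. Qed.

Lemma fixed_by_norm x : fixed_by (\prod_(s in G) act s x).
Proof.
move=> t tG; rewrite rmorph_prod [RHS](reindex_inj (mulIg t)) /=.
apply: eq_big => [s|s _]; first by rewrite groupMr.
by rewrite actM.
Qed.

(* [t] is a nonconstant fixed element of [K[x]] of least degree in [x]: Euclidean
   division by [t] shows that the fixed elements of [K[x]] are polynomials in [t], and a
   fixed fraction has a fixed denominator, the norm of any denominator. *)
Lemma affine_step K x : stable K -> ~ alg K x ->
  (forall s, s \in G -> exists a b, [/\ a \in K, b \in K & act s x = a * x + b]) ->
  exists t, [/\ t \in adj1 K x, fixed_by t, ~ alg K t &
    forall f, f \in adj1 K x -> fixed_by f -> f \in adj1 (fixsf K) t].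
Proof.
move=> stK nax aff.
have /choice[L LP] : forall s, exists l : {poly E}, s \in G ->
    [/\ l \is a polyOver K, size l = 2%N & act s x = l.[x]].
  move=> s.
  have [sG|nsG] := boolP (s \in G); last by exists 0 => //.
  have [a [b [Ka Kb sx]]] := aff s sG; exists (a *: 'X + b%:P) => _.
  split; first by rewrite rpredD ?polyOverZ ?polyOverX ?polyOverC.
    rewrite -mul_polyC size_MXaddC polyC_eq0 size_polyC.
    (* If [a] were 0, then [act s x] would be [b], which lies in the stable field [K], and so would
       [x]. *)
    have [a0|//] := eqVneq a 0; exfalso; apply: nax; apply: alg_in.
    have := stK s^-1%g (groupVr sG) _ Kb; suff -> : b = act s x by rewrite -actM mulgV act1.
    by rewrite sx a0 mul0r add0r.
  by rewrite hornerD hornerZ hornerX hornerC.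
pose tw s p := map_poly (act s) p \Po L s.
have Ktw s p : s \in G -> p \is a polyOver K -> tw s p \is a polyOver K.
  move=> sG Kp; have [KL _ _] := LP s sG; apply: polyOver_comp => //.
  by apply/polyOverP=> i; rewrite coef_map stK //; move/polyOverP: Kp.
have twx s p : s \in G -> act s p.[x] = (tw s p).[x].
  by move=> sG; have [_ _ sx] := LP s sG; rewrite horner_comp -sx horner_map.
have stw s p : s \in G -> size (tw s p) = size p.
  by move=> sG; have [_ sL _] := LP s sG; rewrite size_comp_poly2 ?size_map_poly.
have inj p q : p \is a polyOver K -> q \is a polyOver K -> p.[x] = q.[x] -> p = q.
  move=> Kp Kq pq; apply/eqP; rewrite -subr_eq0; apply: contrapT => /negP d0.
  by apply: nax; exists (p - q); rewrite rpredB // /root hornerD hornerN pq subrr.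
have [T [KT IT sT minT]] : exists T, [/\ T \is a polyOver K, fixed_by T.[x], (1 < size T)%N &
    forall p, p \is a polyOver K -> fixed_by p.[x] -> (1 < size p)%N -> (size T <= size p)%N].
  pose P n := `[< exists p, [/\ p \is a polyOver K, fixed_by p.[x], (1 < size p)%N & size p = n] >].
  have exP : exists n, P n.
    (* The product of the conjugates of [x] is a fixed polynomial in [x] of degree |G|, so a
       nonconstant one exists. *)
    exists (size (\prod_(s in G) L s)); apply/asboolP; exists (\prod_(s in G) L s).
    split=> //; first by apply: rpred_prod => s /LP[].
      rewrite horner_prod (eq_bigr (fun s => act s x)) => [|s /LP[]//].
      exact: fixed_by_norm.
    rewrite size_prod => [|s /LP[_ sL _]]; last by rewrite -size_poly_gt0 sL.
    rewrite (eq_bigr (fun=> 2%N)) => [|s /LP[]//]; rewrite sum_nat_const.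
    have -> : #|in_mem^~ (mem G)| = #|G| by apply: eq_card.
    by have := cardG_gt0 G; lia.
  case: (ex_minnP exP) => n /asboolP[T [KT IT sT <-]] min.
  by exists T; split=> // p Kp Ip sp; apply: min; apply/asboolP; exists p.
have T0 : T != 0 by rewrite -size_poly_gt0 ltnW.
exists T.[x]; split=> //.
- by apply: rpred_horner_sub KT; [exact: adj1_sub | exact: adj1_gen].
- by move=> aT; apply: nax; apply: alg_horner aT.
have poly_case n (p : {poly E}) : (size p <= n)%N -> p \is a polyOver K -> fixed_by p.[x] ->
    p.[x] \in adj1 (fixsf K) T.[x].
  elim: n p => [|n IHn] p sp Kp Ip.
    by move: sp; rewrite leqn0 size_poly_eq0 => /eqP->; rewrite horner0 rpred0.
  have const (q : {poly E}) : (size q <= 1)%N -> q \is a polyOver K -> fixed_by q.[x] ->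
      q.[x] \in adj1 (fixsf K) T.[x].
    move=> /size1_polyC qE Kq Iq; apply: adj1_sub; apply/fixsfP; split=> //.
    by rewrite qE hornerC; move/polyOverP: Kq.
  have [sp1|sp1] := leqP (size p) 1; first exact: const.
  have Tp := minT p Kp Ip sp1.
  have [q [r [Kq Kr pE sr sq]]] : exists q r : {poly E}, [/\ q \is a polyOver K,
      r \is a polyOver K, p = q * T + r, (size r < size T)%N & (size q <= n)%N].
    exists (p %/ T), (p %% T); rewrite polyOver_divp ?polyOver_modp ?ltn_modp -?divp_eq //.
    split=> //. rewrite size_divp // leq_subLR (leq_trans sp) // -add1n leq_add2r.
    by rewrite -ltnS prednK // ltnW.
  have [Iq Ir] : fixed_by q.[x] /\ fixed_by r.[x].
    suff h s : s \in G -> tw s q = q /\ tw s r = r.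
      by split=> s sG; have [e1 e2] := h s sG; rewrite twx // (e1, e2).
    move=> sG.
    (* Two divisions of [p] by [T] are compared; twisting preserves degrees, so the quotient and the
       remainder are fixed separately. *)
    have e : (q - tw s q) * T = tw s r - r.
      apply: inj; rewrite ?rpredM ?rpredB ?Ktw //.
      rewrite hornerM !hornerD !hornerN -!twx //.
      have := Ip s sG; rewrite pE hornerD hornerM rmorphD rmorphM (IT s sG) => e.
      apply/eqP; rewrite -subr_eq0; apply/eqP.
      have -> : act s r.[x] = q.[x] * T.[x] + r.[x] - act s q.[x] * T.[x] by rewrite -e; ring.
      ring.
    have q0 : q - tw s q = 0.
      apply/eqP; apply: contraT => q0.
      have : (size ((q - tw s q) * T)%R < size T)%N.
        rewrite e; apply: leq_ltn_trans (size_polyD _ _) _.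
        by rewrite size_polyN stw // maxnn.
      rewrite size_mul //; have : (0 < size (q - tw s q)%R)%N by rewrite size_poly_gt0.
      by case: (size _) => // m _; rewrite addSn /= ltnNge leq_addl.
    move: e; rewrite q0 mul0r => /esym/eqP; rewrite subr_eq0 => /eqP ->.
    by split=> //; apply/esym/eqP; rewrite -subr_eq0 q0.
  rewrite pE hornerD hornerM rpredD ?rpredM ?adj1_gen //.
    exact: IHn.
  have [sr1|sr1] := leqP (size r) 1; first exact: const.
  by have := minT _ Kr Ir sr1; rewrite leqNgt sr.
move=> f /adj1P[p [q [Kp Kq q0 fE]]] If.
pose N := \prod_(s in G) tw s q.
have KN : N \is a polyOver K by apply: rpred_prod => s sG; apply: Ktw.
have Nx : N.[x] = \prod_(s in G) act s q.[x].
  by rewrite horner_prod; apply: eq_bigr => s sG; rewrite twx.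
have IN : fixed_by N.[x] by rewrite Nx; apply: fixed_by_norm.
have N0 : N.[x] != 0 by rewrite Nx; apply/prodf_neq0 => s sG; rewrite fmorph_eq0.
pose M := p * \prod_(s in G | s != 1%g) tw s q.
have KM : M \is a polyOver K.
  by rewrite rpredM //; apply: rpred_prod => s /andP[sG _]; apply: Ktw.
have tw1 : tw 1%g q = q by apply: inj; rewrite ?Ktw ?group1 // -twx ?group1 // act1.
have fN : f = M.[x] / N.[x].
  have -> : N = q * \prod_(s in G | s != 1%g) tw s q.
    by rewrite /N (bigD1 1%g) ?group1 //= tw1.
  move: N0; rewrite /N (bigD1 1%g) ?group1 //= tw1 /M !hornerM.
  rewrite mulf_eq0 negb_or => /andP[_ h].
  by rewrite fE; field; rewrite q0 h.
have IM : fixed_by M.[x].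
  suff -> : M.[x] = f * N.[x] by move=> s sG; rewrite rmorphM If ?IN.
  by rewrite fN divfK.
by rewrite fN rpred_div //; apply: (poly_case (size _)) => //.
Qed.

(* Write [f = p.[x]] with [size p <= size r]: since [f] is fixed, [p - f] has the
   [size r] conjugates of [x] as roots, so [p] is the constant [f]. *)
Lemma fixed_simple_ext F x (P : {poly E}) (r : seq gT) f :
  P \is a polyOver F -> P != 0 -> root P x -> (size P <= (size r).+1)%N ->
  (forall s, s \in r -> {in F, forall y, act s y = y}) ->
  uniq [seq act s x | s <- r] -> (forall s, s \in r -> act s f = f) ->
  f \in adj1 F x -> f \in F.
Proof.
move=> FP P0 Px sP rF ur rf /(alg_adj1_poly FP P0 Px)[p [Fp sp fE]].
suff pE : p = f%:P by have /polyOverP/(_ 0) := Fp; rewrite pE coefC.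
apply/eqP; rewrite -subr_eq0; apply: contraT => d0.
have := max_poly_roots d0 (rs := [seq act s x | s <- r]) _ ur.
rewrite size_map => h; suff : (size r < size r)%N by rewrite ltnn.
apply: leq_trans (h _) _; last first.
  apply: leq_trans (size_polyD _ _) _; rewrite geq_max size_polyN.
  rewrite -ltnS (leq_trans sp) //=; apply: leq_trans (size_polyC_leq1 _) _.
  by rewrite -ltnS (leq_trans _ sP) // (root_size_gt1 P0 Px).
apply/allP => _ /mapP[s sr ->]; rewrite /root hornerD hornerN hornerC.
have {1}-> : p = map_poly (act s) p.
  by apply/polyP=> i; rewrite coef_map /= rF //; move/polyOverP: Fp.
by rewrite horner_map -fE rf // subrr.
Qed.

End FixedFields.

(** * Towers of affine actions *)

Arguments fixsf : simpl never.

Section AffineChains.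
Variables (E : fieldType) (gT : finGroupType) (G : {group gT}).
Variable act : gT -> {rmorphism E -> E}.
Hypothesis actM : forall s t x, act (s * t)%g x = act t (act s x).
Implicit Types (K B : subfld E).

Definition affine_over K x := forall g, g \in G ->
  exists a b, [/\ a \in K, b \in K & act g x = a * x + b].

Fixpoint affine_tower K s : Prop :=
  if s is x :: s' then affine_over K x /\ affine_tower (adj1 K x) s' else True.

Lemma affine_tower_const K s : (forall x, x \in s -> affine_over K x) -> affine_tower K s.
Proof.
elim: s K => [|x s IHs] K //= aff; split; first by apply: aff; rewrite mem_head.
apply: IHs => y ys g gG; have [|a [b [Ka Kb e]]] := aff y _ g gG; first by rewrite inE ys orbT.
by exists a, b; split=> //; apply: adj1_sub.
Qed.

Lemma affine_tower_stable K s : stable G act K -> affine_tower K s ->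
  stable G act (adjs K s).
Proof.
elim: s K => [|x s IHs] K stK //= [aff tow]; apply: IHs tow; apply: stable_adj1 => // g gG.
have [a [b [Ka Kb ->]]] := aff g gG.
by rewrite rpredD // ?rpredM ?adj1_gen //; apply: adj1_sub.
Qed.

(** [B] stands for the fixed field of [K]: each [x] contributes one generator by [affine_step], and
    the induction passes to [adj1 K x] and [adj1 B t0]. Leaving both fields free lets a chain start
    over a field whose invariants were found by other means. *)
Lemma affine_chain K B s : stable G act K -> {subset B <= K} ->
  (forall f, f \in K -> fixed_by G act f -> f \in B) -> indep K s -> affine_tower K s ->
  exists t, [/\ size t = size s, forall y, y \in t -> y \in adjs K s /\ fixed_by G act y,
    indep B t & forall f, f \in adjs K s -> fixed_by G act f -> f \in adjs B t].
Proof.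
elim: s K B => [|x s IHs] K B stK BK KB /=; first by move=> *; exists [::].
move=> [nax ind] [aff tow].
have [t0 [Kt0 It0 nat0 fixt0]] := affine_step actM stK nax aff.
have stK1 : stable G act (adj1 K x) by apply: (@affine_tower_stable K [:: x]).
have B1K1 : {subset adj1 B t0 <= adj1 K x}.
  by apply: adj1_min => // y /BK; apply: adj1_sub.
have K1B1 f : f \in adj1 K x -> fixed_by G act f -> f \in adj1 B t0.
  move=> Kf If; apply: adj1_min (fixt0 f Kf If); last exact: adj1_gen.
  by move=> y /fixsfP[Ky Iy]; apply/adj1_sub/KB.
have [t [st tP indt fixt]] := IHs _ _ stK1 B1K1 K1B1 ind tow.
exists (t0 :: t); split=> //=; first by rewrite st.
  move=> y; rewrite inE => /orP[/eqP->|/tP//]; split=> //.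
  exact: adjs_sub.
by split=> // a0; apply: nat0; apply: alg_sub a0.
Qed.

End AffineChains.

Lemma perm_actM (k : fieldType) (n : nat) (s t : 'S_n) x :
  perm_act (s * t)%g x = perm_act t (perm_act s x) :> ratfun k n.
Proof.
suff h p : @perm_act k n (s * t)%g (tofrac p) = perm_act t (perm_act s (tofrac p)).
  rewrite [x]frac_repr; move: (\n_(repr x)) (\d_(repr x)) => a b.
  have D u c d : perm_act u (c / d) = perm_act u c / perm_act u d :> ratfun k n.
    exact: (fmorph_div (@perm_act k n u)).
  by rewrite (D (s * t)%g) (D s) (D t) !h.
rewrite /perm_act !fracmap_tofrac; try exact: inj_msym.
congr tofrac; apply: (@mpoly_rmorph_ext _ _ _ (msym (s * t)%g) (msym t \o msym s)) => [c|i] /=.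
  by rewrite /msym !mmapC.
by rewrite /msym !mmapX !mmap1U mmapX mmap1U permM.
Qed.

Lemma rational_of_fixed (k : fieldType) (n : nat) (G : {group 'S_n})
    (t : seq (ratfun k n)) :
  (forall y, y \in t -> fixed_by G (@perm_act k n) y) -> indep (rfbase k n) t ->
  (forall f, fixed_by G (@perm_act k n) f -> f \in adjs (rfbase k n) t) ->
  rational k (perm_fixedfield k G) (fixedC k G).
Proof.
move=> It indt gent.
pose j : {rmorphism perm_fixedfield k G -> ratfun k n} :=
  (val : perm_fixedfield k G -> ratfun k n).
have [s sE] : exists s : seq (perm_fixedfield k G), map j s = t.
  elim: t It {indt gent} => [|x t IHt] It; first by exists [::].
  have [|s <-] := IHt; first by move=> y yt; apply: It; rewrite inE yt orbT.
  have xG : x \in fixed G (@perm_act k n) by apply/fixedP/It/mem_head.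
  by exists (FixedField xG :: s).
have sub1 : {subset fracsf (j \o fixedC k G) <= rfbase k n}.
  by apply: fracsf_min => c; apply: (fracsf_im (ratfunC k n)).
have sub2 : {subset rfbase k n <= fracsf (j \o fixedC k G)}.
  by apply: fracsf_min => c; apply: (fracsf_im (j \o fixedC k G)).
apply: (@rational_of_indep _ _ _ _ j s); rewrite sE.
  exact: (indep_sub sub1 indt).
move=> x; have : j x \in adjs (rfbase k n) t.
  by apply: gent => g gG; have /fixedP h := fixedfield_valP x; apply: h.
by apply: adjs_mono => // y /sub2; apply: adjs_sub.
Qed.

(** * Moments of seven points in characteristic 7 *)

Section Moments.
Variables (E : fieldType) (charE : 7 \in [pchar E]).

Definition fe (i : 'F_7) : E := (i : nat)%:R.

Lemma fe_mod m : (m %% 7)%:R = m%:R :> E.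
Proof. by rewrite {2}(divn_eq m 7) natrD natrM (pcharf0 charE) mulr0 add0r. Qed.

Lemma feD i j : fe (i + j) = fe i + fe j.
Proof. by rewrite /fe -natrD -[RHS]fe_mod. Qed.

Lemma feM i j : fe (i * j) = fe i * fe j.
Proof. by rewrite /fe -natrM -[RHS]fe_mod. Qed.

Lemma fe0 : fe 0 = 0. Proof. by []. Qed.
Lemma fe1 : fe 1 = 1. Proof. by []. Qed.

Lemma feN i : fe (- i) = - fe i.
Proof. by apply/eqP; rewrite -addr_eq0 -feD addNr. Qed.

Lemma fe_eq0 i : (fe i == 0) = (i == 0).
Proof.
have [->|i0] := eqVneq i 0; first by rewrite fe0 eqxx.
apply/eqP=> e; have : fe (i^-1 * i) = 0 by rewrite feM e mulr0.
by rewrite mulVf // fe1 => /eqP; rewrite oner_eq0.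
Qed.

Lemma fe_inj : injective fe.
Proof.
move=> i j e; apply/eqP; rewrite -subr_eq0 -fe_eq0 feD feN.
by rewrite e subrr.
Qed.

Lemma feV i : fe i^-1 = (fe i)^-1.
Proof.
have [->|i0] := eqVneq i 0; first by rewrite invr0 fe0 invr0.
by apply: (mulfI (x := fe i)); rewrite ?fe_eq0 // -feM !mulfV ?fe_eq0.
Qed.

Lemma feX i m : fe (i ^+ m) = fe i ^+ m.
Proof. by elim: m => [|m IHm]; rewrite ?expr0 // !exprS feM IHm. Qed.

Lemma fe_expr6 i : fe i ^+ 6 = (i != 0)%:R.
Proof.
rewrite -feX; have -> : i ^+ 6 = (i != 0)%:R by apply/eqP; case: i => -[|[|[|[|[|[|[|]]]]]]].
by case: (i != 0).
Qed.

Lemma rmorph_fe (f : {rmorphism E -> E}) i : f (fe i) = fe i.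
Proof. exact: rmorph_nat. Qed.

Lemma rpred_fe (K : subfld E) i : fe i \in K.
Proof. exact: rpred_nat. Qed.

Lemma affine_fe_in (K : subfld E) x c b : x \in K -> (x - fe b) / fe c \in K.
Proof. by move=> Kx; rewrite rpred_div ?rpredB ?rpred_fe. Qed.

Lemma fe_frac_in (K : subfld E) n a b c d e :
  (-1) ^+ n / fe e \in K /\ (fe a * fe b - fe c * fe d) / fe e \in K.
Proof. by rewrite !rpred_div ?rpredX ?rpredN1 ?rpredB ?rpredM ?rpred_fe. Qed.

Definition moment (X : 'F_7 -> E) (v : E) (j : nat) : E :=
  \sum_i (fe i - v) ^+ j * X i.

Definition centroid X := moment X 0 1 / moment X 0 0.

Lemma moment0 X v : moment X v 0 = moment X 0 0.
Proof. by apply: eq_bigr => i _; rewrite !expr0. Qed.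

Lemma moment1 X : moment X 0 0 != 0 -> moment X (centroid X) 1 = 0.
Proof.
move=> m0; have -> : moment X (centroid X) 1 = moment X 0 1 - centroid X * moment X 0 0.
  rewrite /moment mulr_sumr -sumrB; apply: eq_bigr => i _.
  by rewrite !expr1 expr0; ring.
by rewrite divfK // subrr.
Qed.

(* [1 - (i - l) ^+ 6] is the indicator of [i = l] on ['F_7]; expand it in powers of
   [i - v]. *)
Lemma moment_recover X v l : X l = moment X v 0 -
  \sum_(j < 7) ((v - fe l) ^+ (6 - j) *+ 'C(6, j)) * moment X v j.
Proof.
transitivity (\sum_i (1 - (fe i - fe l) ^+ 6) * X i).
  rewrite (bigD1 l) //= subrr expr0n subr0 mul1r big1 ?addr0 // => i il.
  by rewrite -feN -feD fe_expr6 subr_eq0 il subrr mul0r.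
have -> : \sum_(j < 7) ((v - fe l) ^+ (6 - j) *+ 'C(6, j)) * moment X v j =
    \sum_i (\sum_(j < 7) (v - fe l) ^+ (6 - j) * (fe i - v) ^+ j *+ 'C(6, j)) * X i.
  rewrite /moment; under eq_bigr => j _ do rewrite mulr_sumr.
  rewrite exchange_big /=; apply: eq_bigr => i _; rewrite mulr_suml.
  by apply: eq_bigr => j _; rewrite mulrA !mulrnAl.
rewrite /moment -sumrB; apply: eq_bigr => i _.
rewrite -exprDn expr0 mulrBl; congr (_ - _ ^+ _ * _); ring.
Qed.

Lemma moment_in (K : subfld E) X v j :
  (forall i, X i \in K) -> v \in K -> moment X v j \in K.
Proof.
move=> KX Kv; apply: rpred_sum => i _.
by rewrite rpredM ?rpredX ?rpredB ?rpred_fe.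
Qed.

Lemma recover_in (K : subfld E) X v l : v \in K ->
  (forall j, (j <= 6)%N -> moment X v j \in K) -> X l \in K.
Proof.
move=> Kv KM; rewrite (moment_recover X v l) rpredB ?KM // rpred_sum // => j _.
apply: rpredM; last by apply: KM; rewrite -ltnS.
by apply: rpredMn; apply: rpredX; apply: rpredB => //; apply: rpred_fe.
Qed.

Section Transformation.
Variables (f : {rmorphism E -> E}) (X X' : 'F_7 -> E) (d : E) (c b : 'F_7).
Hypotheses (c0 : c != 0) (fX : forall i, f (X i) = d * X' (c * i + b)).

(** With i' = c i + b and v' = c f(v) + b one has i - f(v) = (i' - v') / c, so a moment of order [j]
    only picks up the factor d / c^j. *)
Lemma moment_map v v' j : f v = (v' - fe b) / fe c ->
  f (moment X v j) = d * moment X' v' j / fe c ^+ j.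
Proof.
move=> fv; have fc0 : fe c != 0 by rewrite fe_eq0.
have inj : injective (fun i => c * i + b) by move=> i i' /addIr/(mulfI c0).
rewrite rmorph_sum mulr_sumr mulr_suml [RHS](reindex_inj inj) /=; apply: eq_bigr => i _.
rewrite rmorphM rmorphXn rmorphB fX fv (rmorph_fe f).
rewrite feD feM -exprVn.
have -> : fe i - (v' - fe b) / fe c = (fe c * fe i + fe b - v') * (fe c)^-1 by field.
by rewrite exprMn; ring.
Qed.

Lemma moment00_map : f (moment X 0 0) = d * moment X' 0 0.
Proof.
(* The centres are v = 0 and v' = b; a moment of order 0 does not depend on its centre. *)
have f0 : f 0 = (fe b - fe b) / fe c by rewrite rmorph0 subrr mul0r.
by rewrite (moment_map _ f0) expr0 divr1 moment0.
Qed.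

Lemma centroid_map : d != 0 -> moment X' 0 0 != 0 ->
  f (centroid X) = (centroid X' - fe b) / fe c.
Proof.
move=> d0 m0; have fc0 : fe c != 0 by rewrite fe_eq0.
have f0 : f 0 = (fe b - fe b) / fe c by rewrite rmorph0 subrr mul0r.
rewrite /centroid fmorph_div !(moment_map _ f0) expr0 expr1 !moment0.
have -> : moment X' (fe b) 1 = moment X' 0 1 - fe b * moment X' 0 0.
  rewrite /moment mulr_sumr -sumrB; apply: eq_bigr => i _.
  by rewrite !expr1 expr0; ring.
by field; apply/and4P; split; rewrite ?oner_neq0.
Qed.

End Transformation.

Lemma fe_expr7 i : fe i ^+ 7 = fe i.
Proof.
rewrite exprS fe_expr6; have [->|_] := eqVneq i 0; rewrite ?fe0 ?mul0r //=.
by rewrite mulr1.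
Qed.

Lemma frob7 (x y : E) : (x + y) ^+ 7 = x ^+ 7 + y ^+ 7.
Proof. exact: (pFrobenius_autD_comm charE (mulrC x y)). Qed.

(** The map x^7 - x is F_7-linear in characteristic 7 and vanishes on F_7. *)
Lemma artin_schreier v (c b : 'F_7) : c != 0 ->
  ((v - fe b) / fe c) ^+ 7 - (v - fe b) / fe c = (v ^+ 7 - v) / fe c.
Proof.
move=> c0; have fc0 : fe c != 0 by rewrite fe_eq0.
rewrite expr_div_n frob7 -feN !fe_expr7 feN; field.
by [].
Qed.

End Moments.

Lemma mem_second (T : eqType) (a x : T) l : x \in a :: x :: l.
Proof. by rewrite in_cons mem_head orbT. Qed.

Lemma mem_third (T : eqType) (a b x : T) l : x \in a :: b :: x :: l.
Proof. by rewrite in_cons mem_second orbT. Qed.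

Lemma mem_fourth (T : eqType) (a b c x : T) l : x \in a :: b :: c :: x :: l.
Proof. by rewrite in_cons mem_third orbT. Qed.

Lemma mem_two (T : eqType) (a b x : T) : x \in [:: a; b] -> x = a \/ x = b.
Proof. by rewrite !inE => /orP[]/eqP; [left | right]. Qed.

Lemma mem_pair_maps (T : eqType) (a b x : T) (f g : nat -> T) l :
  x \in [:: a; b] ++ map f l ++ map g l ->
  [\/ x = a, x = b, exists j, x = f j | exists j, x = g j].
Proof.
rewrite !mem_cat !inE -orbA.
move=> /or4P[/eqP->|/eqP->|/mapP[j _ ->]|/mapP[j _ ->]].
- exact: Or41.
- exact: Or42.
- by apply: Or43; exists j.
by apply: Or44; exists j.
Qed.

Lemma half_sum_in (E : fieldType) (K : subfld E) (a b : E) : 2%:R != 0 :> E ->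
  a + b \in K -> a - b \in K -> a \in K /\ b \in K.
Proof.
move=> two0 Ks Kd.
have aE : a = ((a + b) + (a - b)) / 2%:R by field.
have bE : b = ((a + b) - (a - b)) / 2%:R by field.
have K2 : 2%:R \in K by apply: rpred_nat.
split; [rewrite aE | rewrite bE]; apply: rpred_div => //.
  exact: rpredD.
exact: rpredB.
Qed.

(** * The permutation action on the function field *)

Section PermutationAction.
Variables (k : fieldType) (n : nat).
Local Notation E := (ratfun k n).
Local Notation act := (@perm_act k n).
Local Notation rfb := (rfbase k n).

Lemma perm_act_rfX (s : 'S_n) i : perm_act s (rfX k i) = rfX k (s i).
Proof. exact: perm_actX. Qed.

Lemma rfbase_act (s : 'S_n) x : x \in rfb -> perm_act s x = x.
Proof.
move=> /fracsfP[p [q [_ ->]]].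
by rewrite [LHS]fmorph_div; congr (_ / _); apply: perm_actC.
Qed.

Lemma rfbase_stable (G : {group 'S_n}) : stable G act rfb.
Proof. by move=> s _ f fb /=; rewrite rfbase_act. Qed.

Lemma fixed_adjs (s : 'S_n) (l : seq E) : (forall x, x \in l -> act s x = x) ->
  forall y, y \in adjs rfb l -> act s y = y.
Proof.
move=> fl y yl; suff cl : divring_closed [pred g | act s g == g].
  apply/eqP; apply: (@adjs_min _ _ (Subfld cl) l _ _ y yl) => [z zb|z zl].
    by apply/eqP; apply: rfbase_act.
  by apply/eqP; apply: fl.
split=> [|u w|u w]; rewrite !inE.
- by rewrite [act s 1]rmorph1.
- by move=> /eqP u1 /eqP w1; rewrite [act s _]rmorphB /= u1 w1.
- by move=> /eqP u1 /eqP w1; rewrite [act s _]fmorph_div /= u1 w1.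
Qed.

Lemma stable_adjs (G : {group 'S_n}) (K : subfld E) (l : seq E) : stable G act K ->
  (forall x, x \in l -> forall s, s \in G -> perm_act s x \in adjs K l) ->
  stable G act (adjs K l).
Proof.
move=> stK stl s sG f fl.
suff cl : divring_closed [pred g | act s g \in adjs K l].
  apply: (@adjs_min _ _ (Subfld cl) l _ _ f fl) => [y Ky|y yl].
    by apply: adjs_sub; apply: stK.
  exact: stl.
split=> [|x y|x y]; rewrite !inE.
- by rewrite [act s 1]rmorph1 rpred1.
- by move=> x1 y1; rewrite [act s _]rmorphB rpredB.
- by move=> x1 y1; rewrite [act s _]fmorph_div rpred_div.
Qed.

Lemma gen_full (t : seq E) : (forall i, rfX k i \in adjs rfb t) -> forall x, x \in adjs rfb t.
Proof.
move=> tX x; apply: adjs_min (ratfun_gen x); first exact: adjs_sub.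
by move=> _ /mapP[i _ ->]; apply: tX.
Qed.

Lemma gen_indep (t : seq E) : (1 < n)%N -> (size t <= n)%N ->
  (forall i, alg (adjs rfb t) (rfX k i)) -> indep rfb t.
Proof.
move=> n1 st tX; apply: (indep_of_size (ratfun_indep k n1)).
  by rewrite size_map size_enum_ord.
by move=> _ /mapP[i _ ->]; apply: tX.
Qed.

Lemma perm_affine (G : {group 'S_n}) (K : subfld E) x :
  (forall s, s \in G -> exists a b, [/\ a \in K, b \in K & perm_act s x = a * x + b]) ->
  affine_over G act K x.
Proof. by []. Qed.

Lemma tofrac_neq0 (p : {mpoly k[n]}) (a : 'I_n -> k) : p.@[a] != 0 -> tofrac p != 0 :> E.
Proof. by rewrite tofrac_eq0; apply: contra_neq => ->; rewrite meval0. Qed.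

Lemma ratfun_char p : p \in [pchar k] -> p \in [pchar E].
Proof. exact: (rmorph_pchar (ratfunC k n)). Qed.

End PermutationAction.

Lemma line_keep (F : fieldType) (v0 v1 d0 d1 b0 b1 e : F) : e != 0 -> d0 != 0 -> d1 != 0 ->
  d1 * ((v0 - b0) / (e * d0 / d0)) - d0 * ((v1 - b1) / (e * d1 / d1)) =
  (-1) ^+ 0 / e * (d1 * v0 - d0 * v1) + (d0 * b1 - d1 * b0) / e.
Proof. by move=> e0 d00 d10; rewrite ?expr0 ?expr1; field; rewrite e0 d00 d10. Qed.

Lemma line_swap (F : fieldType) (v0 v1 d0 d1 b0 b1 e : F) : e != 0 -> d0 != 0 -> d1 != 0 ->
  d1 * ((v1 - b0) / (e * d1 / d0)) - d0 * ((v0 - b1) / (e * d0 / d1)) =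
  (-1) ^+ 1 / e * (d1 * v0 - d0 * v1) + (d1 * b1 - d0 * b0) / e.
Proof. by move=> e0 d00 d10; rewrite ?expr0 ?expr1; field; rewrite e0 d00 d10. Qed.

Lemma line_coord (F : fieldType) (v0 d0 d1 b0 c w : F) : c != 0 -> d0 != 0 ->
  ((d1 * v0 - w) / d0 - b0) / c = d1 / (d0 * c) * v0 + (- w / d0 - b0) / c.
Proof. by move=> e0 d00; field; rewrite e0 d00. Qed.

Lemma ratio_keep (F : fieldType) (z0 z1 c0 c1 : F) : z0 != 0 -> c0 != 0 -> c1 != 0 ->
  (z1 / c1) / (z0 / c0) = c0 / c1 * (z1 / z0).
Proof. by move=> z00 c00 c10; field; rewrite z00 c00 c10. Qed.

Lemma ratio_swap (F : fieldType) (z0 z1 c0 c1 : F) :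
  z0 != 0 -> z1 != 0 -> c0 != 0 -> c1 != 0 ->
  (z0 / c1) / (z1 / c0) = c0 / c1 / (z1 / z0).
Proof. by move=> z00 z10 c00 c10; field; rewrite z00 z10 c00 c10. Qed.

(** Multiplication by [c] permutes [C], so the product of the elements of [C] is unchanged when
    multiplied by c^|C|. *)
Lemma expf_card_set (F : finFieldType) (C : {set F}) c : 0 \notin C -> c != 0 ->
  (forall x, x \in C -> c * x \in C) -> c ^+ #|C| = 1.
Proof.
move=> C0 c0 cC; have injc : injective (fun x => c * x) by apply: mulfI.
have CE : [set c * x | x in C] = C.
  apply/eqP; rewrite eqEcard (card_imset _ injc) leqnn andbT.
  by apply/subsetP=> _ /imsetP[x xC ->]; apply: cC.
have P0 : \prod_(x in C) x != 0.
  by apply/prodf_neq0 => x xC; apply: contraNneq C0 => <-.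
apply: (mulIf P0); rewrite mul1r -[in RHS]CE big_imset /=; last by move=> x y _ _ /injc.
by rewrite big_split prodr_const.
Qed.

(** The polynomial X^2m - y X^m + a vanishes when X^m is t^m or a / t^m. Its degree 2m is to match
    the number of images of [t] under a dihedral group. *)
Lemma dihedral_poly (E : fieldType) (K : subfld E) (t y a : E) m : (0 < m)%N -> t != 0 ->
  y = t ^+ m + a / t ^+ m -> y \in K -> a \in K ->
  exists P : {poly E}, [/\ P \is a polyOver K, size P = (m + m).+1 & root P t].
Proof.
move=> m0 t0 yE Ky Ka; exists ('X^(m + m) + (a%:P - y *: 'X^m)); split.
- apply: rpredD; first exact: polyOverXn.
  apply: rpredB; first by rewrite polyOverC.
  by apply: polyOverZ => //; apply: polyOverXn.
- rewrite size_polyDl ?size_polyXn // ltnS; apply: leq_trans (size_polyD _ _) _.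
  rewrite geq_max size_polyN; apply/andP; split.
    by apply: leq_trans (size_polyC_leq1 _) _; rewrite addn_gt0 m0.
  by apply: leq_trans (size_scale_leq _ _) _; rewrite size_polyXn -addn1 leq_add2l.
rewrite /root hornerD hornerXn hornerD hornerC hornerN hornerZ hornerXn yE exprD.
have := expf_neq0 m t0; move: (t ^+ m) => u u0.
by apply/eqP; field.
Qed.

Lemma div_div_swap (F : fieldType) (c e t : F) : e != 0 -> t != 0 ->
  c / (e / t) = c / e * t.
Proof. by move=> e0 t0; field; rewrite e0 t0. Qed.

Lemma swap_sum (F : fieldType) (u a : F) : u != 0 -> a != 0 -> a / u + a / (a / u) = u + a / u.
Proof. by move=> u0 a0; field; rewrite u0 a0. Qed.

Lemma sq_of_conj (F : fieldType) (c c' e t : F) : c' != 0 -> t != 0 ->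
  c * (e / t) = c' * t -> t ^+ 2 = c * e / c'.
Proof.
move=> c0 t0 h; have -> : t ^+ 2 = c' * t * t / c' by field.
by rewrite -h; field; rewrite c0 t0.
Qed.

(** * Two blocks of size seven *)

Section TwoBlocks.
Variables (k : fieldType) (chark : 7 \in [pchar k]).
Local Notation E := (ratfun k 14).
Local Notation act := (@perm_act k 14).
Local Notation rfb := (rfbase k 14).
Let charE : 7 \in [pchar E] := ratfun_char 14 chark.
Local Notation fe := (@fe E).
Variables (G : {group 'S_14}) (lab : bool -> 'F_7 -> 'I_14).
Hypotheses (lab_inj : forall B i B' i', lab B i = lab B' i' -> B = B' /\ i = i')
  (lab_surj : forall x, exists B i, x = lab B i).
Hypothesis HG : forall s, s \in G -> exists (sw : bool) (c b : bool -> 'F_7),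
  (forall B, c B != 0) /\ forall B i, s (lab B i) = lab (B (+) sw) (c B * i + b B).

Let X B i : E := rfX k (lab B i).
Let m B : E := moment (X B) 0 0.
Let v B : E := centroid (X B).
Let z B : E := v B ^+ 7 - v B.
Let U B j : E := moment (X B) (v B) j / z B ^+ j.

(** Nonvanishing in the fraction field is read off from values at points; here the only nonzero
    coordinate of the point lies in block B'. *)
Lemma block_sum_eval B B' :
  m B = tofrac (\sum_i 'X_(lab B i)) /\
  (\sum_i 'X_(lab B i)).@[fun l => (l == lab B' 0)%:R] = (B == B')%:R :> k.
Proof.
split.
  by rewrite /m /moment rmorph_sum; apply: eq_bigr => i _; rewrite expr0 mul1r.
rewrite (raddf_sum (meval _)) (bigD1 0) //= mevalXU big1 => [|i i0].
  rewrite addr0; have [->|BB] := eqVneq B B'; first by rewrite eqxx.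
  by case: eqP => // /lab_inj[e _]; rewrite e eqxx in BB.
by rewrite mevalXU; case: eqP => // /lab_inj[_ e]; rewrite e eqxx in i0.
Qed.

Lemma m_neq0 B : m B != 0.
Proof.
have [-> e] := block_sum_eval B B.
apply: (tofrac_neq0 (a := fun l => (l == lab B 0)%:R)).
by rewrite e eqxx oner_neq0.
Qed.

Lemma m_neq : m false != m true.
Proof.
have [-> e] := block_sum_eval false true; have [-> e'] := block_sum_eval true true.
rewrite -subr_eq0 -tofracB.
apply: (tofrac_neq0 (a := fun l => (l == lab true 0)%:R)).
by rewrite mevalB e e' sub0r oppr_eq0 oner_neq0.
Qed.

Lemma act_block_of (s : 'S_14) (sw : bool) (c b : bool -> 'F_7) : (forall B, c B != 0) ->
  (forall B i, s (lab B i) = lab (B (+) sw) (c B * i + b B)) ->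
  [/\ (forall B, act s (m B) = m (B (+) sw)),
   (forall B, act s (v B) = (v (B (+) sw) - fe (b B)) / fe (c B)),
   (forall B, act s (z B) = z (B (+) sw) / fe (c B)) &
   (forall B j, act s (U B j) = U (B (+) sw) j)].
Proof.
move=> c0 sE.
have sX B i : act s (X B i) = 1 * X (B (+) sw) (c B * i + b B).
  by rewrite mul1r /X -sE; apply: perm_act_rfX.
have sv B : act s (v B) = (v (B (+) sw) - fe (b B)) / fe (c B).
  exact: (centroid_map charE (c0 B) (sX B) (oner_neq0 _) (m_neq0 _)).
have sz B : act s (z B) = z (B (+) sw) / fe (c B).
  rewrite [act s _]rmorphB rmorphXn /= sv.
  exact: artin_schreier.
split=> // [B|B j].
  rewrite /m -(moment0 _ (v B)) (moment_map charE (c0 B) (sX B) _ (sv B)).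
  by rewrite expr0 divr1 mul1r moment0.
rewrite [act s _]fmorph_div (moment_map charE (c0 B) (sX B) _ (sv B)).
rewrite rmorphXn /= sz mul1r expr_div_n invf_div mulrA divfK //.
by rewrite expf_neq0 // fe_eq0.
Qed.

(* The [U B j] are permuted by [G] exactly as the two blocks: the multiplier [c B] of a
   group element acts by [(c B) ^- j] both on the [j]th centred moment and on [z B ^+ j]. *)
Definition block_coords : seq E :=
  [:: v false; v true; m false; m true]
  ++ [seq moment (X B) (v B) j | B <- [:: false; true], j <- iota 2 5].

(** Twelve elements completing the two centroids. The antisymmetric parts of the [U B j] are
    multiplied by [m false - m true], which changes sign with them when the blocks are swapped; so
    at most this difference is not fixed by [G], and it only changes sign. *)
Definition block_invs : seq E :=
  [:: m false + m true; m false - m true]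
  ++ [seq U false j + U true j | j <- iota 2 5]
  ++ [seq (m false - m true) * (U false j - U true j) | j <- iota 2 5].

Lemma block_recover (K : subfld E) : (forall B, v B \in K) -> (forall B, m B \in K) ->
  (forall B j, (2 <= j <= 6)%N -> moment (X B) (v B) j \in K) -> forall x, rfX k x \in K.
Proof.
move=> Kv Km KM x; have [B [i ->]] := lab_surj x.
apply: (recover_in charE (X := X B) i (Kv B)) => -[|[|j]] j6; last exact: KM.
  by rewrite moment0; apply: Km.
by rewrite moment1 ?rpred0 //; apply: m_neq0.
Qed.

Lemma block_coords_indep : indep rfb block_coords.
Proof.
apply: gen_indep => // x; apply: alg_in.
have gen y : y \in block_coords -> y \in adjs rfb block_coords by apply: adjs_gen.
apply: block_recover => [[]|[]|B j j26]; apply: gen.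
- exact: mem_second.
- exact: mem_head.
- exact: mem_fourth.
- exact: mem_third.
rewrite mem_cat; apply/orP; right; apply/allpairsP; exists (B, j); split.
- by case: (B).
- by rewrite [(B, j).2]/= mem_iota; lia.
by [].
Qed.

Lemma block_v_indep : indep rfb [:: v false; v true].
Proof. by have /(indep_cat rfb [:: v false; v true])[] := block_coords_indep. Qed.

Lemma block_v_trans B : ~ alg rfb (v B).
Proof.
have [n0 [n1 _]] := block_v_indep; case: B; last exact: n0.
by move=> a; apply: n1; apply: alg_sub a; apply: adj1_sub.
Qed.

Lemma block_z_neq0 B : z B != 0.
Proof.
apply/eqP=> z0; apply: (@block_v_trans B); exists ('X^7 - 'X); split.
- by rewrite rpredB ?polyOverXn ?polyOverX.
- by rewrite -size_poly_eq0 size_polyDl ?size_polyXn // size_polyN size_polyX.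
by rewrite /root hornerD hornerN hornerXn hornerX; apply/eqP; exact: z0.
Qed.

Lemma block_z_in (K : subfld E) B : v B \in K -> z B \in K.
Proof. by move=> Kv; rewrite rpredB ?rpredX. Qed.

Lemma block_moment_in (K : subfld E) B j :
  v B \in K -> U B j \in K -> moment (X B) (v B) j \in K.
Proof.
move=> Kv KU; have z0 : z B ^+ j != 0 by apply: expf_neq0; apply: block_z_neq0.
have -> : moment (X B) (v B) j = U B j * z B ^+ j by apply/esym; apply: divfK.
by rewrite rpredM ?rpredX ?block_z_in.
Qed.

Lemma block_invs_recover (K : subfld E) : (forall B, v B \in K) ->
  (forall y, y \in block_invs -> y \in K) -> forall x, rfX k x \in K.
Proof.
move=> Kv gen.
have two0 : 2%:R != 0 :> E by rewrite -[2%:R]/(fe 2) fe_eq0.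
have KT : m false - m true \in K by apply: gen; exact: mem_second.
have Km B : m B \in K.
  have [|K0 K1] := half_sum_in (a := m false) (b := m true) two0 _ KT;
     last by case: B; [exact: K1 | exact: K0].
  by apply: gen; exact: mem_head.
have T0 : m false - m true != 0 by rewrite subr_eq0 m_neq.
apply: block_recover => // B j j26.
have jI : j \in iota 2 5 by rewrite mem_iota; lia.
have [||K0 K1] := half_sum_in (K := K) (a := U false j) (b := U true j) two0.
- apply: gen; rewrite !mem_cat; apply/orP; right; apply/orP; left.
  by apply: (map_f (fun j => U false j + U true j)).
- rewrite -[U _ _ - _](mulKf T0) rpredM ?rpredV //.
  apply: gen; rewrite !mem_cat; apply/orP; right; apply/orP; right.
  by apply: (map_f (fun j => (m false - m true) * (U false j - U true j))).
by apply: block_moment_in => //; case: (B); [exact: K1 | exact: K0].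
Qed.

Lemma block_invs_gen i :
  rfX k i \in adjs (adjs rfb [:: v false; v true]) block_invs.
Proof.
apply: block_invs_recover => [B|y]; last exact: adjs_gen.
by apply: adjs_sub; apply: adjs_gen; case: B; [exact: mem_second | exact: mem_head].
Qed.

(** [G] scales the [block_invs] by signs, so they form an affine tower over k(v0, v1), and
    [affine_chain] over [adjs rfb l] completes any generators [l] of the invariants of k(v0, v1) to
    generators of all invariants. *)
Lemma two_blocks_rational (l : seq E) :
  (forall y, y \in l -> y \in adjs rfb [:: v false; v true] /\ fixed_by G act y) ->
  indep rfb l ->
  (forall f, f \in adjs rfb [:: v false; v true] -> fixed_by G act f -> f \in adjs rfb l) ->
  rational k (perm_fixedfield k G) (fixedC k G).
Proof.
set K := adjs rfb [:: v false; v true] => lK indl fixl.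
have stK : stable G act K.
  apply: stable_adjs; first exact: rfbase_stable.
  move=> x xl s sG; have [sw [c [b [c0 sE]]]] := HG sG.
  have [_ sv _ _] := act_block_of c0 sE.
  have KvB B : v B \in K by apply: adjs_gen; case: B; [exact: mem_second | exact: mem_head].
  have {xl} [B ->] : exists B, x = v B.
    by case: (mem_two xl) => ->; [exists false | exists true].
  have -> : perm_act s (v B) = _ := sv B.
  by apply: affine_fe_in; apply: KvB.
have ind : indep K block_invs.
  suff /(indep_cat rfb [:: v false; v true])[] : indep rfb ([:: v false; v true] ++ block_invs) by [].
  by apply: gen_indep => // x; apply: alg_in; rewrite adjs_cat block_invs_gen.
have [|||t [st tP indt fixt]] := affine_chain (@perm_actM k 14) (B := adjs rfb l) stK _ _ ind.
- by apply: adjs_min => [y|y /lK[]//]; apply: adjs_sub.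
- exact: fixl.
- apply: affine_tower_const => x xinv s sG; have [sw [c [b [c0 sE]]]] := HG sG.
  have [sm _ _ sU] := act_block_of c0 sE.
  suff [a [Ka e]] : exists a, a \in K /\ act s x = a * x.
    by exists a, 0; rewrite rpred0 addr0.
  have sgn : act s (m false - m true) = (-1) ^+ sw * (m false - m true).
    by rewrite [act s _]rmorphB /= !sm; case: (sw); rewrite /= ?expr0 ?expr1; ring.
  case: (mem_pair_maps xinv) => [->|->|[j ->]|[j ->]].
  - exists 1; rewrite rpred1 mul1r; split=> //.
    rewrite [act s _]rmorphD /= !sm.
    by case: (sw) => //=; rewrite addrC.
  - exists ((-1) ^+ sw); rewrite rpredX ?rpredN ?rpred1 //; split=> //.
  - exists 1; rewrite rpred1 mul1r; split=> //.
    rewrite [act s _]rmorphD /= !sU.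
    by case: (sw) => //=; rewrite addrC.
  exists 1; rewrite rpred1 mul1r; split=> //.
  transitivity (act s (m false - m true) * act s (U false j - U true j)).
    exact: (rmorphM (@perm_act k 14 s)).
  have -> : act s (U false j - U true j) = act s (U false j) - act s (U true j).
    exact: (rmorphB (@perm_act k 14 s)).
  rewrite sgn !sU.
  by case: (sw); rewrite /= ?expr0 ?expr1; ring.
apply: (@rational_of_fixed _ _ _ (l ++ t)) => [y||f If].
- by rewrite mem_cat => /orP[/lK[]|/tP[]].
- by apply/indep_cat; split.
rewrite adjs_cat; apply: fixt => //.
rewrite /K -adjs_cat; apply: gen_full => i.
by rewrite adjs_cat block_invs_gen.
Qed.

(* The case where the translations in [G] form a single line [<d>]: [G] then acts
   affinely on the [d]-invariant combination [w] of the two centroids. *)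
Lemma two_blocks_rational_line (d : bool -> 'F_7) : (forall B, d B != 0) ->
  (forall s, s \in G -> exists (sw : bool) (c b : bool -> 'F_7) (e : 'F_7),
    [/\ (forall B, c B != 0), (forall B i, s (lab B i) = lab (B (+) sw) (c B * i + b B)) &
        forall B, c B * d B = e * d (B (+) sw)]) ->
  rational k (perm_fixedfield k G) (fixedC k G).
Proof.
move=> d0 Hd; pose w := fe (d true) * v false - fe (d false) * v true.
have fd0 B : fe (d B) != 0 by rewrite fe_eq0.
have vw : v true = (fe (d true) * v false - w) / fe (d false).
  by rewrite /w opprB addrC subrK mulrAC mulfV ?mul1r.
have sub1 : {subset adjs rfb [:: w; v false] <= adjs rfb [:: v false; v true]}.
  have gen y : y \in [:: v false; v true] -> y \in adjs rfb [:: v false; v true] by apply: adjs_gen.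
  move: (adjs rfb _) gen (@adjs_sub _ rfb [:: v false; v true]) => K gen rK.
  have K0 : v false \in K by apply: gen; apply: mem_head.
  have K1 : v true \in K by apply: gen; apply: mem_second.
  apply: adjs_min => [|y /mem_two[->|->]]; [exact: rK | | exact: K0].
  rewrite /w; apply: rpredB; apply: rpredM; try exact: rpred_fe; [exact: K0 | exact: K1].
have sub2 : {subset adjs rfb [:: v false; v true] <= adjs rfb [:: w; v false]}.
  have gen y : y \in [:: w; v false] -> y \in adjs rfb [:: w; v false] by apply: adjs_gen.
  move: (adjs rfb [:: w; _]) gen (@adjs_sub _ rfb [:: w; v false]) => K gen rK.
  have K0 : v false \in K by apply: gen; apply: mem_second.
  have K1 : w \in K by apply: gen; apply: mem_head.
  apply: adjs_min => [|y /mem_two[->|->]]; [exact: rK | exact: K0 |].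
  rewrite vw; apply: rpred_div; last exact: rpred_fe.
  by apply: rpredB; [apply: rpredM; [exact: rpred_fe | exact: K0] | exact: K1].
have ind : indep rfb [:: w; v false].
  apply: (indep_of_size block_v_indep) => // x xv; apply/alg_in/sub2.
  exact: adjs_gen.
have tow : affine_tower G act rfb [:: w; v false].
  split; [|split=> //]; apply: perm_affine => s sG; have [sw [c [b [e [c0 sE cd]]]]] := Hd s sG.
    have [_ sv _ _] := act_block_of c0 sE.
    have e0 : fe e != 0.
      rewrite (fe_eq0 charE); apply/eqP=> e0; have := cd false; rewrite e0 mul0r => /eqP.
      by rewrite mulf_eq0 (negbTE (c0 _)) (negbTE (d0 _)).
    (* The multipliers on both blocks are determined by the one scalar [e]; this makes the image of
       [w] affine in [w] alone. *)
    have fcE B : fe (c B) = fe e * fe (d (B (+) sw)) / fe (d B).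
      have := congr1 fe (cd B); rewrite !(feM charE) => <-.
      by apply/esym/mulfK/fd0.
    have sw_w : act s w = fe (d true) * act s (v false) - fe (d false) * act s (v true).
      by rewrite [act s w]rmorphB !rmorphM; congr (_ * _ - _ * _); exact: rmorph_fe.
    rewrite [act s w]sw_w !sv !fcE.
    have [Ka _] := fe_frac_in rfb sw 0 0 0 0 e.
    have [_ Kb] := fe_frac_in rfb sw (d sw) (b true) (d (~~ sw)) (b false) e.
    exists ((-1) ^+ sw / fe e), ((fe (d sw) * fe (b true) - fe (d (~~ sw)) * fe (b false)) / fe e).
    split; [exact: Ka | exact: Kb |].
    rewrite /w; case: (sw).
      exact: (line_swap (v false) (v true) (fe (b false)) (fe (b true)) e0 (fd0 false) (fd0 true)).
    exact: (line_keep (v false) (v true) (fe (b false)) (fe (b true)) e0 (fd0 false) (fd0 true)).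
  have [_ sv _ _] := act_block_of c0 sE.
  have fc0 : fe (c false) != 0 by rewrite fe_eq0.
  have Kw := adj1_gen rfb w; have Kfe i := rpred_fe (adj1 rfb w) i.
  move: (adj1 rfb w) Kw Kfe => K Kw Kfe; rewrite [act s _]sv; case: (sw) => /=.
    exists (fe (d true) / (fe (d false) * fe (c false))),
      ((- w / fe (d false) - fe (b false)) / fe (c false)); split.
    - by rewrite rpred_div ?rpredM ?Kfe.
    - by rewrite rpred_div ?rpredB ?rpred_div ?rpredN ?Kfe ?Kw.
    by rewrite vw; exact: (line_coord (v false) (fe (d true)) (fe (b false)) w fc0 (fd0 false)).
  exists (fe (c false))^-1, (- fe (b false) / fe (c false)); split.
  - by rewrite rpredV Kfe.
  - by rewrite rpred_div ?rpredN ?Kfe.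
  by rewrite mulrBl mulrC mulNr.
have fix0 f : f \in rfb -> fixed_by G act f -> f \in rfb by [].
have [l [_ lP indl fixl]] :=
  affine_chain (@perm_actM k 14) (@rfbase_stable k 14 G) (fun x h => h) fix0 ind tow.
apply: (two_blocks_rational (l := l)); [| exact: indl |].
  by move=> y /lP[/sub1 Ky Iy]; split; [exact: Ky | exact: Iy].
by move=> f /sub2 Kf; apply: fixl.
Qed.

Section Full.
Hypothesis shifts : forall (B : bool) (e : 'F_7), exists2 s : 'S_14, s \in G &
  forall B' i, s (lab B' i) = lab B' (i + if B' == B then e else 0).
Variables (tau : 'S_14) (ct bt : bool -> 'F_7).
Hypotheses (tauG : tau \in G) (ct0 : forall B, ct B != 0)
  (tauE : forall B i, tau (lab B i) = lab (~~ B) (ct B * i + bt B)).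

Let t : E := z true / z false.

Lemma block_shift (s : 'S_14) (B : bool) (e : 'F_7) :
  (forall B' i, s (lab B' i) = lab B' (i + if B' == B then e else 0)) ->
  [/\ act s (v B) = v B - fe e, act s (v (~~ B)) = v (~~ B) & forall B', act s (z B') = z B'].
Proof.
move=> sE; have c0 (B' : bool) : (fun=> 1 : 'F_7) B' != 0 by [].
have sE' B' i : s (lab B' i) = lab (B' (+) false) (1 * i + if B' == B then e else 0).
  by rewrite sE addbF mul1r.
have [_ sv sz _] := @act_block_of s false (fun=> 1) (fun B' => if B' == B then e else 0) c0 sE'.
split=> [||B']; rewrite ?sv ?sz addbF fe1 divr1 //.
  by rewrite eqxx.
by rewrite (_ : (~~ B == B) = false) ?fe0 ?subr0 //; case: (B).
Qed.

Lemma artin_schreier_poly (K : subfld E) B : z B \in K ->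
  [/\ 'X^7 - 'X - (z B)%:P \is a polyOver K, size ('X^7 - 'X - (z B)%:P) = 8%N &
      root ('X^7 - 'X - (z B)%:P) (v B)].
Proof.
move=> Kz; split; first by rewrite !rpredB ?polyOverXn ?polyOverX ?polyOverC.
  rewrite -addrA size_polyDl ?size_polyXn //.
  apply: leq_ltn_trans (size_polyD _ _) _; rewrite !size_polyN size_polyX size_polyC.
  by case: (_ != _).
rewrite /root !hornerD !hornerN hornerXn hornerX hornerC; apply/eqP.
exact: subrr.
Qed.

(** [v B] is a root of an Artin-Schreier polynomial of degree 7 over [F], and the seven translations
    of block [B] give it seven distinct images while fixing [F]. *)
Lemma descend (F : subfld E) (B : bool) f : z B \in F ->
  (forall e (s : 'S_14), s \in G ->
    (forall B' i, s (lab B' i) = lab B' (i + if B' == B then e else 0)) ->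
    forall y, y \in F -> act s y = y) ->
  f \in adj1 F (v B) -> fixed_by G act f -> f \in F.
Proof.
move=> Fz Ffix fF If.
have /choice[S SP] : forall e, exists s : 'S_14, s \in G /\
    forall B' i, s (lab B' i) = lab B' (i + if B' == B then e else 0).
  by move=> e; have [s sG sE] := shifts B e; exists s.
have [FP sP rP] := artin_schreier_poly Fz.
have P0 : 'X^7 - 'X - (z B)%:P != 0 by rewrite -size_poly_gt0 sP.
apply: (fixed_simple_ext (act := act) (r := map S (enum 'F_7)) FP P0 rP _ _ _ _ fF).
- by rewrite sP size_map -cardE card_Fp.
- by move=> _ /mapP[e _ ->] y Fy; have [sG sE] := SP e; apply: (Ffix e).
- rewrite -map_comp map_inj_uniq ?enum_uniq // => e e' /=.
  have [_ /block_shift[-> _ _]] := SP e; have [_ /block_shift[-> _ _]] := SP e'.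
  by move=> e1; apply: (fe_inj charE); apply: oppr_inj; apply: (addrI (v B)); exact: e1.
by move=> _ /mapP[e _ ->]; apply: If; have [] := SP e.
Qed.

Lemma act_ratio s : s \in G ->
  exists2 c : 'F_7, c != 0 & act s t = fe c * t \/ act s t = fe c / t.
Proof.
move=> sG; have [sw [c [b [c0 sE]]]] := HG sG; have [_ _ sz _] := act_block_of c0 sE.
exists (c false / c true); first by rewrite mulf_neq0 ?invr_eq0.
have fc0 B : fe (c B) != 0 by rewrite (fe_eq0 charE).
have -> : act s t = act s (z true) / act s (z false).
  exact: (fmorph_div (@perm_act k 14 s)).
rewrite !sz (feM charE) (feV charE) /t.
case: (sw); [right | left].
  exact: (ratio_swap (block_z_neq0 false) (block_z_neq0 true) (fc0 false) (fc0 true)).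
exact: (ratio_keep (z true) (block_z_neq0 false) (fc0 false) (fc0 true)).
Qed.

Lemma act_ratio_tau : exists2 e : 'F_7, e != 0 & act tau t = fe e / t.
Proof.
have sE B i : tau (lab B i) = lab (B (+) true) (ct B * i + bt B) by rewrite addbT tauE.
have [_ _ sz _] := act_block_of ct0 sE.
exists (ct false / ct true); first by rewrite mulf_neq0 ?invr_eq0.
have fc0 B : fe (ct B) != 0 by rewrite (fe_eq0 charE).
have -> : act tau t = act tau (z true) / act tau (z false).
  exact: (fmorph_div (@perm_act k 14 tau)).
rewrite !sz (feM charE) (feV charE) /t.
exact: (ratio_swap (block_z_neq0 false) (block_z_neq0 true) (fc0 false) (fc0 true)).
Qed.

Lemma ratio_neq0 : t != 0.
Proof. by rewrite /t; apply: mulf_neq0; [|rewrite invr_eq0]; apply: block_z_neq0. Qed.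

Lemma block_v_alg (K : subfld E) B : z B \in K -> alg K (v B).
Proof.
move=> /artin_schreier_poly[KP sP rP].
by exists ('X^7 - 'X - (z B)%:P); split=> //; rewrite -size_poly_gt0 sP.
Qed.

Lemma ratio_indep : indep rfb [:: t; z false].
Proof.
have Kt : t \in adjs rfb [:: t; z false] by apply: adjs_gen; apply: mem_head.
have Kz : z false \in adjs rfb [:: t; z false] by apply: adjs_gen; apply: mem_second.
apply: (indep_of_size block_v_indep) => // x /mem_two[]->; apply: block_v_alg => //.
have -> : z true = t * z false by apply/esym/divfK/block_z_neq0.
by move: (adjs rfb _) Kt Kz => K Kt Kz; rewrite rpredM.
Qed.

Definition multipliers : {set 'F_7} :=
  [set c | (c != 0) && `[< exists2 s, s \in G & act s t = fe c * t >]].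

Lemma multipliersP c :
  reflect (c != 0 /\ exists2 s, s \in G & act s t = fe c * t) (c \in multipliers).
Proof. by rewrite inE; apply: (iffP andP) => -[c0 /asboolP]. Qed.

Lemma act_scale s c (x : E) : act s (fe c * x) = fe c * act s x.
Proof.
transitivity (act s (fe c) * act s x); first exact: (rmorphM (@perm_act k 14 s)).
by congr (_ * _); apply: rmorph_fe.
Qed.

Lemma multipliers_mul c x : c \in multipliers -> x \in multipliers -> c * x \in multipliers.
Proof.
move=> /multipliersP[c0 [s sG sE]] /multipliersP[x0 [r rG rE]]; apply/multipliersP.
split; first by rewrite mulf_neq0.
exists (s * r)%g; first exact: groupM.
by rewrite perm_actM sE act_scale rE (feM charE) mulrA.
Qed.

Lemma multipliers_exp c : c \in multipliers -> c ^+ #|multipliers| = 1.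
Proof.
move=> cC; have [c0 _] := multipliersP _ cC; apply: expf_card_set => // [|x xC].
  by rewrite inE eqxx.
exact: multipliers_mul.
Qed.

Lemma multipliers_gt0 : (0 < #|multipliers|)%N.
Proof.
apply/card_gt0P; exists 1; apply/multipliersP; split=> //.
by exists 1%g; rewrite ?group1 // fe1 mul1r; apply: (act1 (@perm_actM k 14)).
Qed.

Lemma act_exp s c (x : E) n : act s x = c -> act s (x ^+ n) = c ^+ n.
Proof. by move=> <-; apply: (rmorphXn (@perm_act k 14 s)). Qed.

Lemma ratio_trans : ~ alg rfb t.
Proof. by have [] := ratio_indep. Qed.

Lemma ratio_sq_neq c : t ^+ 2 != fe c.
Proof.
apply/eqP=> tE; apply: ratio_trans; exists ('X^2 - (fe c)%:P); split.
- by apply: rpredB; [exact: polyOverXn | rewrite polyOverC; exact: rpred_fe].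
- by rewrite -size_poly_gt0 size_polyDl ?size_polyXn // size_polyN ltnS (leq_trans (size_polyC_leq1 _)).
by rewrite /root hornerD hornerN hornerXn hornerC; apply/eqP; rewrite tE; apply: subrr.
Qed.

(* [G] acts on [t] by [t |-> c * t] and [t |-> c * e / t] with [c] in a group of order
   [n], so [t ^+ n + e ^+ n / t ^+ n] generates the fixed field of [k(t)]. *)
Lemma ratio_fixed : exists y, [/\ y \in adj1 rfb t, fixed_by G act y, ~ alg rfb y &
  forall f, f \in adj1 rfb t -> fixed_by G act f -> f \in adj1 rfb y].
Proof.
have [e e0 te] := act_ratio_tau; set C := multipliers; set n := #|C|.
have n0 : (0 < n)%N by apply: multipliers_gt0.
pose a := fe (e ^+ n); pose y := t ^+ n + a / t ^+ n.
have t0 := ratio_neq0; have tn0 : t ^+ n != 0 by apply: expf_neq0.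
have fe0 c : c != 0 -> fe c != 0 by rewrite (fe_eq0 charE).
have actV s x : act s (a / x) = a / act s x.
  transitivity (act s a / act s x); first exact: (fmorph_div (@perm_act k 14 s)).
  by congr (_ / _); apply: rmorph_fe.
have actD s x x' : act s (x + x') = act s x + act s x'.
  exact: (rmorphD (@perm_act k 14 s)).
have Iy : fixed_by G act y.
  move=> s sG; rewrite -[LHS]/(perm_act s y) /y actD actV.
  have [c c0 [sE|sE]] := act_ratio sG; rewrite (act_exp n sE).
    have cC : c \in C by apply/multipliersP; split=> //; exists s.
    by rewrite exprMn -(feX charE) (multipliers_exp cC) fe1 mul1r.
  (* [s] followed by [tau] inverts [t] twice, hence scales it, by c / e. *)
  have ceC : c / e \in C.
    apply/multipliersP; split; first by rewrite mulf_neq0 ?invr_eq0.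
    exists (s * tau)%g; first exact: groupM.
    rewrite perm_actM sE.
    transitivity (act tau (fe c) / act tau t); first exact: (fmorph_div (@perm_act k 14 tau)).
    rewrite te [act tau (fe c)]rmorph_fe (feM charE) (feV charE).
    exact: (div_div_swap (fe c) (fe0 e e0) t0).
  have cn : c ^+ n = e ^+ n.
    by apply/eqP; rewrite -subr_eq0 -(divfK (expf_neq0 n e0) (c ^+ n)) -expr_div_n
      (multipliers_exp ceC) mul1r subrr.
  rewrite expr_div_n -(feX charE) cn -/a.
  exact: (swap_sum tn0 (fe0 _ (expf_neq0 n e0))).
have [P [PK sP rP]] := dihedral_poly n0 t0 (erefl y) (adj1_gen rfb y) (rpred_fe (adj1 rfb y) (e ^+ n)).
have P0 : P != 0 by rewrite -size_poly_gt0 sP.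
have alg_t : alg (adj1 rfb y) t by exists P.
have yt : y \in adj1 rfb t.
  have := adj1_gen rfb t; have := rpred_fe (adj1 rfb t) (e ^+ n); rewrite -/a.
  rewrite /y; move: (adj1 rfb t) => K Ka Kt.
  by rewrite rpredD ?rpred_div ?rpredX.
exists y; split; [exact: yt | exact: Iy | |].
  move=> ay; apply: ratio_trans; apply: (alg_trans _ alg_t) => u.
  exact: alg_adj1.
move=> f ft If.
have /choice[S SP] c : exists s, c \in C -> s \in G /\ act s t = fe c * t.
  have [/multipliersP[_ [s sG sE]]|nc] := boolP (c \in C); first by exists s.
  by exists 1%g.
(* One element of [G] for each of the images c t and c e / t, which are as many as the degree of
   [P]. *)
pose r := map S (enum C) ++ map (fun c => (S c * tau)%g) (enum C).
have rG s : s \in r -> s \in G.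
  rewrite mem_cat => /orP[]/mapP[c]; rewrite mem_enum => /SP[sG _] -> //.
  exact: groupM.
have St : map (fun s => act s t) (map S (enum C)) = map (fun c => fe c * t) (enum C).
  by rewrite -map_comp; apply/eq_in_map => c; rewrite mem_enum => /SP[].
have Tt : map (fun s => act s t) (map (fun c => (S c * tau)%g) (enum C)) =
    map (fun c => fe c * (fe e / t)) (enum C).
  rewrite -map_comp; apply/eq_in_map => c; rewrite mem_enum => /SP[_ sE] /=.
  by rewrite perm_actM sE act_scale te.
have injx (x : E) : x != 0 -> injective (fun c => fe c * x).
  by move=> x0 c c' /(mulIf x0) /(fe_inj charE).
have et0 : fe e / t != 0 := mulf_neq0 (fe0 e e0) (invr_neq0 t0).
have u1 : uniq (map (fun c => fe c * t) (enum C)) by rewrite (map_inj_uniq (injx t t0)) enum_uniq.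
have u2 : uniq (map (fun c => fe c * (fe e / t)) (enum C)).
  by rewrite (map_inj_uniq (injx _ et0)) enum_uniq.
apply: (fixed_simple_ext (act := act) (r := r) PK P0 rP _ _ _ _ (f := f)).
- by rewrite sP size_cat !size_map -cardE.
- move=> s /rG sG u /adj1P[p [q [Kp Kq _ ->]]].
  suff h p' : p' \is a polyOver rfb -> act s p'.[y] = p'.[y].
    transitivity (act s p.[y] / act s q.[y]); first exact: (fmorph_div (@perm_act k 14 s)).
    by rewrite !h.
  move=> /polyOverP Kp'; rewrite -[LHS](horner_map (@perm_act k 14 s)).
  rewrite [X in _.[X]](Iy s sG); congr (_.[y]); apply/polyP => i.
  by rewrite coef_map; apply: rfbase_act; apply: Kp'.
- rewrite map_cat St Tt cat_uniq u1 u2 andbT.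
  (* A common image of the two kinds would make t^2 a constant. *)
  apply/hasPn=> _ /mapP[c cC ->]; apply/mapP=> -[c' c'C e1].
  have [c'0 _] : c' != 0 /\ True.
    by move: c'C; rewrite mem_enum => /multipliersP[].
  have /eqP[] := ratio_sq_neq (c * e / c').
  rewrite (feM charE) (feV charE) (feM charE).
  exact: (sq_of_conj (fe0 c' c'0) t0 e1).
- by move=> s /rG; apply: If.
move: ft; apply: adj1_min; last exact: adj1_gen.
by move=> u; rewrite -[adj1 _ t]/(adjs _ [:: t]) => ur; apply: adjs_sub; apply: adj1_sub.
Qed.

(** One Artin-Schreier descent per block brings the invariants of k(v0, v1) into k(z0, z1) = k(t,
    z0). Over k(t), whose invariants are k(y), an element of [G] multiplies z0 by a constant or by a
    constant times t. *)
Lemma two_blocks_rational_full : rational k (perm_fixedfield k G) (fixedC k G).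
Proof.
have [y [yt Iy ay fixy]] := ratio_fixed.
have [nt [nz _]] := ratio_indep.
have act_t s : s \in G -> act s t \in adj1 rfb t.
  move=> sG; have [c _ [->|->]] := act_ratio sG;
  have := adj1_gen rfb t; have := rpred_fe (adj1 rfb t) c; move: (adj1 rfb t) => K Kc Kt.
    by rewrite rpredM.
  by rewrite rpred_div.
have stK : stable G act (adj1 rfb t) by apply: stable_adj1 => //; apply: rfbase_stable.
have BK : {subset adj1 rfb y <= adj1 rfb t}.
  by apply: adj1_min; [exact: adj1_sub | exact: yt].
have tow : affine_tower G act (adj1 rfb t) [:: z false].
  split=> //; apply: perm_affine => s sG.
  have [sw [c [b [c0 sE]]]] := HG sG; have [_ _ sz _] := act_block_of c0 sE.
  have Kt := adj1_gen rfb t; have Kc := rpred_fe (adj1 rfb t) (c false).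
  move: (adj1 rfb t) Kt Kc => K Kt Kc.
  exists (if sw then t / fe (c false) else (fe (c false))^-1), 0; split; rewrite ?rpred0 //.
    by case: (sw); [exact: rpred_div | rewrite rpredV; exact: Kc].
  rewrite sz addr0; case: (sw); last by rewrite mulrC.
  by rewrite mulrAC; congr (_ / _); apply/esym/divfK/block_z_neq0.
have [|l [_ lP indl fixl]] :=
  affine_chain (@perm_actM k 14) stK BK fixy (s := [:: z false]) _ tow; first by split.
have sub (K : subfld E) : (forall B, v B \in K) -> t \in K /\ z false \in K.
  by move=> Kv; rewrite /t rpred_div ?block_z_in.
have Kv B : v B \in adjs rfb [:: v false; v true].
  by apply: adjs_gen; case: B; [exact: mem_second | exact: mem_head].
have [Kt Kz] := sub _ Kv.
have subK : {subset adjs rfb [:: t; z false] <= adjs rfb [:: v false; v true]}.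
  by apply: adjs_min => [|u /mem_two[]->]; [exact: adjs_sub | exact: Kt | exact: Kz].
apply: (two_blocks_rational (l := y :: l)).
- move=> u; rewrite in_cons => /orP[/eqP->|/lP[/subK ? ?]]; last by split.
  split; [apply: subK; exact: (@adj1_sub _ (adj1 rfb t) (z false) y yt) | exact: Iy].
- by split.
move=> f Kf If.
suff : f \in adjs rfb [:: t; z false] by move=> fz; apply: fixl.
have f1 : f \in adjs rfb [:: v false; z true].
  apply: (descend (B := true)) If; first by apply: adjs_gen; apply: mem_second.
    move=> e s sG sE; apply: fixed_adjs => x /mem_two[]->.
      by have [_ -> _] := block_shift sE.
    by have [_ _ ->] := block_shift sE.
  apply: (adjs_min _ _ Kf) => [u|u /mem_two[]->].
  - by move=> ur; apply: adj1_sub; apply: adjs_sub.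
  - by apply: adj1_sub; apply: adjs_gen; apply: mem_head.
  exact: adj1_gen.
have f2 : f \in adjs rfb [:: z false; z true].
  apply: (descend (B := false)) If; first by apply: adjs_gen; apply: mem_head.
    move=> e s sG sE; apply: fixed_adjs => x /mem_two[]->.
      by have [_ _ ->] := block_shift sE.
    by have [_ _ ->] := block_shift sE.
  apply: (adjs_min _ _ f1) => [u|u /mem_two[]->].
  - by move=> ur; apply: adj1_sub; apply: adjs_sub.
  - exact: adj1_gen.
  by apply: adj1_sub; apply: adjs_gen; apply: mem_second.
have zt : z true = t * z false by apply/esym/divfK/block_z_neq0.
have Kt' : t \in adjs rfb [:: t; z false] by apply: adjs_gen; apply: mem_head.
have Kz' : z false \in adjs rfb [:: t; z false] by apply: adjs_gen; apply: mem_second.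
apply: (adjs_min _ _ f2) => [u|u /mem_two[]->]; [exact: adjs_sub | exact: Kz' |].
by rewrite zt; move: (adjs rfb _) Kt' Kz' => K; apply: rpredM.
Qed.

End Full.

End TwoBlocks.

Lemma mem_maps_mid (T : eqType) (q x : T) (f g : nat -> T) l l' :
  x \in map f l ++ q :: map g l' ->
  [\/ exists j, x = f j, x = q | exists j, x = g j].
Proof.
rewrite mem_cat in_cons => /or3P[/mapP[j _ ->]|/eqP->|/mapP[j _ ->]].
- by apply: Or31; exists j.
- exact: Or32.
by apply: Or33; exists j.
Qed.

Lemma frac_scale (F : fieldType) (x y z e : F) : e != 0 -> x != 0 -> z != 0 ->
  e * y / z / (e * x) = 1 / z * (y / x).
Proof. by move=> e0 x0 z0; field; rewrite e0 x0 z0. Qed.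

(** * Seven blocks of size two *)

Section SevenPoints.
Variables (k : fieldType) (chark : 7 \in [pchar k]).
Local Notation E := (ratfun k 14).
Local Notation act := (@perm_act k 14).
Local Notation rfb := (rfbase k 14).
Let charE : 7 \in [pchar E] := ratfun_char 14 chark.
Local Notation fe := (@fe E).
Variables (G : {group 'S_14}) (d u : 'F_7 -> E) (q : E).
Let eta := moment d 0 0.
Let contains (K : subfld E) := [/\ {subset rfb <= K}, q \in K,
  forall i, d i \in K & forall i, u i \in K].
Hypothesis actG : forall s, s \in G -> exists (c b : 'F_7) (m n : nat),
  [/\ c != 0, forall i, act s (d i) = (-1) ^+ m * d (c * i + b),
      forall i, act s (u i) = u (c * i + b) & act s q = (-1) ^+ n * q].
Hypothesis eta0 : eta != 0.
(* This lets [q] replace the total mass [eta] as a coordinate, so that the other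
   coordinates can be taken homogeneous of degree 0 in [d]. *)
Hypothesis eta_in : forall K : subfld E, {subset rfb <= K} -> q \in K ->
  (forall i, d i / eta \in K) -> eta \in K.
Hypothesis alg_over : forall K, contains K -> forall i, alg K (rfX k i).
Hypothesis inv_in : forall K, contains K -> forall f, fixed_by G act f -> f \in K.

Let v := centroid d.
(** With [v] these are 14 coordinates. The moments of [d] of order 0 and 1 are absent: divided by
    [eta] they are 1 and 0. The moments of [u] are centred at the centroid of [d], as the same
    affine maps move both families. *)
Let tl : seq E := [seq moment d v j / eta | j <- iota 2 5] ++
  q :: [seq moment u v j | j <- iota 0 7].

Lemma moment_scale X (a w : E) j : moment (fun i => X i / a) w j = moment X w j / a.
Proof. by rewrite /moment mulr_suml; apply: eq_bigr => i _; rewrite mulrA. Qed.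

(** The ratios [d i / eta] come back from their moments, and [eta] from the ratios and [q]; only
    then are the [d i] available. *)
Lemma seven_contains (K : subfld E) : {subset rfb <= K} -> v \in K ->
  (forall y, y \in tl -> y \in K) -> contains K.
Proof.
move=> rK Kv gen.
have Kq : q \in K by apply: gen; rewrite mem_cat mem_head orbT.
have Ky i : d i / eta \in K.
  apply: (recover_in charE (X := fun i => d i / eta) i Kv) => -[|[|j]] j6; rewrite moment_scale.
  - by rewrite moment0 divff // rpred1.
  - by rewrite moment1 // mul0r rpred0.
  apply: gen; rewrite mem_cat; apply/orP; left.
  by apply: (map_f (fun j => moment d v j / eta)); rewrite mem_iota; lia.
have Ke := eta_in rK Kq Ky.
split=> // i; first by rewrite -[d i](divfK eta0); apply: rpredM; [exact: Ky | exact: Ke].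
apply: (recover_in charE (X := u) i Kv) => j j6.
apply: gen; rewrite mem_cat; apply/orP; right; rewrite in_cons; apply/orP; right.
by apply: (map_f (fun j => moment u v j)); rewrite mem_iota; lia.
Qed.

Lemma seven_full : contains (adjs rfb (v :: tl)).
Proof.
apply: seven_contains.
- exact: adjs_sub.
- by apply: adjs_gen; apply: mem_head.
by move=> y yl; apply: adjs_gen; rewrite in_cons yl orbT.
Qed.

Lemma sign_frac_in (K : subfld E) m (c : 'F_7) j : (-1) ^+ m / fe c ^+ j \in K.
Proof. by rewrite rpred_div ?rpredX ?rpredN1 ?rpred_fe. Qed.

Lemma seven_points_rational : rational k (perm_fixedfield k G) (fixedC k G).
Proof.
have ind : indep rfb (v :: tl).
  by apply: gen_indep => //; apply: alg_over; apply: seven_full.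
(* The sign of [s] on the [d i] cancels in the quotients by [eta]. The exponents 0 give all scaling
   factors a common shape. *)
have sv s : s \in G -> exists (c b : 'F_7) (m n : nat),
    [/\ c != 0, act s v = (v - fe b) / fe c,
      forall j, act s (moment d v j / eta) = (-1) ^+ 0 / fe c ^+ j * (moment d v j / eta),
      forall j, act s (moment u v j) = (-1) ^+ 0 / fe c ^+ j * moment u v j &
      act s q = (-1) ^+ n * q].
  move=> sG; have [c [b [m [n [c0 sd su sq]]]]] := actG sG; exists c, b, m, n.
  have m0 : (-1) ^+ m != 0 :> E by rewrite signr_eq0.
  have sv : act s v = (v - fe b) / fe c := centroid_map charE c0 sd m0 eta0.
  have su' i : act s (u i) = 1 * u (c * i + b) by rewrite mul1r su.
  have sM j : act s (moment d v j) = (-1) ^+ m * moment d v j / fe c ^+ j.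
    exact: (moment_map charE c0 sd j sv).
  split=> // j; last first.
    rewrite [LHS](moment_map charE c0 su' j sv) expr0.
    by rewrite !mul1r mulrC.
  transitivity (act s (moment d v j) / act s eta).
    exact: (fmorph_div (@perm_act k 14 s)).
  have -> : eta = moment d v 0 by rewrite moment0.
  rewrite !sM !expr0 divr1.
  have x0 : moment d v 0 != 0 by rewrite moment0; exact: eta0.
  have z0 : fe c ^+ j != 0 by apply: expf_neq0; rewrite (fe_eq0 charE).
  exact: (frac_scale (moment d v j) m0 x0 z0).
have tow : affine_tower G act rfb (v :: tl).
  split.
    apply: perm_affine => s /sv[c [b [_ [_ [c0 -> _ _ _]]]]].
    exists (fe c)^-1, (- fe b / fe c).
    have Kb := rpred_fe rfb b; have Kc := rpred_fe rfb c; move: (rfb) Kb Kc => K Kb Kc.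
    split; [by rewrite rpredV | by rewrite rpred_div ?rpredN |].
    by rewrite mulrBl mulrC mulNr.
  apply: affine_tower_const => x xl; apply: perm_affine => s sG.
  have [c [b [_ [n [c0 _ sM su sq]]]]] := sv s sG.
  suff [m [c' [j e]]] : exists m c' j, act s x = (-1) ^+ m / fe c' ^+ j * x.
    exists ((-1) ^+ m / fe c' ^+ j), 0; split; [exact: sign_frac_in | exact: rpred0 |].
    by rewrite addr0.
  case: (mem_maps_mid xl) => [[j ->]|->|[j ->]].
  - by exists 0%N, c, j; apply: sM.
  - by exists n, c, 0%N; rewrite expr0 divr1; apply: sq.
  by exists 0%N, c, j; apply: su.
have fix0 f : f \in rfb -> fixed_by G act f -> f \in rfb by [].
have [l [_ lP indl fixl]] :=
  affine_chain (@perm_actM k 14) (@rfbase_stable k 14 G) (fun x h => h) fix0 ind tow.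
apply: (@rational_of_fixed _ _ _ l) => [y /lP[_ Iy]|//|f If]; first exact: Iy.
by apply: fixl => //; apply: (inv_in seven_full).
Qed.

End SevenPoints.

(** * Cyclic binary codes of length seven *)

Section BinaryCodes.
Local Notation word := ('F_7 -> bool).
Implicit Types (f g : word) (a c b i j : 'F_7).

(* For [a = 1, 3] the operators [parity a] are multiplications by the two primitive
   idempotents of degree 3 of F_2[x]/(x^7 - 1), and the [on_line a i] are the lines of
   the two cyclic Fano planes; the translates of [simplex_word a] are the complements of
   the lines, i.e. the nonzero words of the simplex code. *)
Definition parity a f i := f i (+) (f (i + 3 * a) (+) (f (i + 5 * a) (+) f (i + 6 * a))).
Definition simplex_word a i := i \in [:: 0; 3 * a; 5 * a; 6 * a].
Definition on_line a i j := j \in [:: i + a; i + 2 * a; i + 4 * a].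
Definition line_sum a f i := f (i + a) (+) (f (i + 2 * a) (+) f (i + 4 * a)).
Definition dot f g : bool := \big[addb/false]_i (f i && g i).

Definition F7 : seq 'F_7 := [:: 0; 1; 2; 3; 4; 5; 6].

Lemma mem_F7 i : i \in F7.
Proof. by case: i => [[|[|[|[|[|[|[|]]]]]]] ?]. Qed.

Definition dotx f g := foldr (fun i r => (f i && g i) (+) r) false F7.

Lemma dotE f g : dot f g = dotx f g.
Proof.
rewrite /dot !(big_ord_recl, big_ord0) /dotx /=.
by do ![congr (_ && _) || congr (_ (+) _)]; congr (_ _); apply: val_inj.
Qed.

Lemma allF7 (P : pred 'F_7) : all P F7 -> forall i, P i.
Proof. by move=> /allP h i; apply: h; apply: mem_F7. Qed.

Lemma hasF7 (P : pred 'F_7) : has P F7 -> exists i, P i.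
Proof. by move=> /hasP[i _ Pi]; exists i. Qed.

(** A word is rebuilt from its seven values, so that a decidable property of all words reduces to a
    computation on 128 lists. *)
Definition toword (l : seq bool) : word := fun i => nth false l i.

Lemma towordE f : f = toword (map f F7).
Proof.
apply/funext=> i; have := mem_F7 i; rewrite /toword => iF.
have {1}-> : i = nth 0 F7 i by case: i iF => [[|[|[|[|[|[|[|]]]]]]] ?] //= _; apply: val_inj.
by rewrite (nth_map 0) //= ltn_ord.
Qed.

Lemma word_ind (P : word -> Prop) :
  (forall x0 x1 x2 x3 x4 x5 x6, P (toword [:: x0; x1; x2; x3; x4; x5; x6])) -> forall f, P f.
Proof. by move=> h f; rewrite [f]towordE; apply: h. Qed.

Definition zeroT a f := all (fun i => ~~ parity a f i) F7.

Lemma zeroTP a f : reflect (forall i, parity a f i = false) (zeroT a f).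
Proof.
apply: (iffP idP) => [/allF7 h i|h]; first exact: negbTE.
by apply/allP => i _; rewrite h.
Qed.

(** The image of [parity a] is a simplex code. Since [parity a] correlates with [simplex_word a], it
    is generated by the reversed word. As [simplex_word a] is supported on 0 and on [a] times the
    nonsquares modulo 7, and -1 and 3 are both nonsquares, reversal gives [simplex_word (3 * a)]. *)
Lemma parity_values a f : a \in [:: 1; 3] ->
  (forall i, parity a f i = false) \/ exists j, forall i, parity a f (i + j) = simplex_word (3 * a) i.
Proof.
move=> a13; suff : zeroT a f ||
  has (fun j => all (fun i => parity a f (i + j) == simplex_word (3 * a) i) F7) F7.
  case/orP=> [/zeroTP|/hasF7[j /allF7 h]]; [by left | right].
  by exists j => i; apply/eqP.
elim/word_ind: f; move: a13; rewrite !inE => /orP[]/eqP-> x0 x1 x2 x3 x4 x5 x6; vm_compute;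
  by move: x0 x1 x2 x3 x4 x5 x6; do 7!case.
Qed.

(** The two operators project onto the two summands of degree 3; what both kill lies in the
    remaining summand, the constants. *)
Lemma parity13_const f : (forall i, parity 1 f i = false) -> (forall i, parity 3 f i = false) ->
  forall i, f i = f 0.
Proof.
move=> /zeroTP h1 /zeroTP h3; suff h : all (fun i => f i == f 0) F7.
  by move=> i; apply/eqP/(allF7 h).
apply: (implyP (implyP _ h1) h3); elim/word_ind: f {h1 h3} => x0 x1 x2 x3 x4 x5 x6.
by vm_compute; move: x0 x1 x2 x3 x4 x5 x6; do 7!case.
Qed.

(** The points read by [line_sum] at [i] are the complement of those read by [parity], so the two
    add up to the sum of all values of [f]; the hypothesis makes [parity a f] invariant under
    translation. *)
Lemma line_sum_const a f : a \in [:: 1; 3] ->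
  (forall i, parity a (fun i => f (i + 1) (+) f i) i = false) ->
  forall i, line_sum a f i = line_sum a f 0.
Proof.
move=> a13 /zeroTP h; suff h' : all (fun i => line_sum a f i == line_sum a f 0) F7.
  by move=> i; apply/eqP/(allF7 h').
apply: (implyP _ h); elim/word_ind: f {h}; move: a13; rewrite !inE.
move=> /orP[]/eqP-> x0 x1 x2 x3 x4 x5 x6; vm_compute;
  by move: x0 x1 x2 x3 x4 x5 x6; do 7!case.
Qed.

(** Going once round the cycle adds the common difference seven times, an odd number, so it is 0. *)
Lemma diff_const f : (forall i j, f (i + 1) (+) f i = f (j + 1) (+) f j) ->
  forall i, f i = f 0.
Proof.
move=> h0; suff h : all (fun i => f i == f 0) F7.
  by move=> i; apply/eqP/(allF7 h).
have h : all (fun i => f (i + 1) (+) f i == f (0 + 1) (+) f 0) F7.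
  by apply/allP=> i _; rewrite (h0 i 0).
apply: (implyP _ h); elim/word_ind: f {h h0} => x0 x1 x2 x3 x4 x5 x6.
by vm_compute; move: x0 x1 x2 x3 x4 x5 x6; do 7!case.
Qed.

(** The dual of the simplex code is the Hamming code of length 7, whose 16 words have weights 0, 3,
    4 and 7. *)
Lemma dual_simplex a f : a \in [:: 1; 3] ->
  (forall j, dot (fun i => simplex_word a (i + j)) f = false) ->
  [\/ forall i, f i = false, exists j, forall i, f i = on_line a j i,
      exists j, forall i, f i = ~~ on_line a j i | forall i, f i = true].
Proof.
move=> a13 h0.
have h : all (fun j => ~~ dotx (fun i => simplex_word a (i + j)) f) F7.
  by apply/allP=> j _; rewrite -dotE h0.
suff : [|| all (fun i => ~~ f i) F7, has (fun j => all (fun i => f i == on_line a j i) F7) F7,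
    has (fun j => all (fun i => f i == ~~ on_line a j i) F7) F7 | all f F7].
  case/or4P=> [/allF7|/hasF7[j /allF7]|/hasF7[j /allF7]|/allF7] e.
  - by apply: Or41 => i; apply: negbTE.
  - by apply: Or42; exists j => i; apply/eqP.
  - by apply: Or43; exists j => i; apply/eqP.
  exact: Or44.
apply: (implyP _ h); elim/word_ind: f {h h0}; move: a13; rewrite !inE.
move=> /orP[]/eqP-> x0 x1 x2 x3 x4 x5 x6; vm_compute;
  by move: x0 x1 x2 x3 x4 x5 x6; do 7!case.
Qed.

Lemma dual_even f : (forall j, dot (fun i => (i + j == 0) (+) (i + j == 1)) f = false) ->
  forall i, f i = f 0.
Proof.
move=> h0; have h : all (fun j => ~~ dotx (fun i => (i + j == 0) (+) (i + j == 1)) f) F7.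
  by apply/allP=> j _; rewrite -dotE h0.
suff h' : all (fun i => f i == f 0) F7 by move=> i; apply/eqP/(allF7 h').
apply: (implyP _ h); elim/word_ind: f {h h0} => x0 x1 x2 x3 x4 x5 x6.
by vm_compute; move: x0 x1 x2 x3 x4 x5 x6; do 7!case.
Qed.

(** A nonsquare [c] would turn [simplex_word a] into a translate of [simplex_word (3 * a)], a
    nonzero word of the summand onto which [parity a] projects. *)
Lemma multiplier_residue a c b : a \in [:: 1; 3] -> c != 0 ->
  (forall i, parity a (fun x => simplex_word a (c * x + b)) i = false) -> c \in [:: 1; 2; 4].
Proof.
move=> a13 c0 /zeroTP h; have {c0}h :
  (c != 0) && zeroT a (fun x => simplex_word a (c * x + b)) by rewrite c0.
apply: (implyP _ h) => {h}; move: b; apply: allF7; move: c; apply: allF7.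
by move: a13; rewrite !inE => /orP[]/eqP->; vm_compute.
Qed.

Variable N : word -> Prop.
Hypotheses (N_add : forall f g, N f -> N g -> N (fun i => f i (+) g i))
  (N_shift : forall f j, N f -> N (fun i => f (i + j))).

Lemma N_parity a f : N f -> N (parity a f).
Proof.
move=> Nf; apply: (@N_add f (fun i => f (i + 3 * a) (+) (f (i + 5 * a) (+) f (i + 6 * a)))) => //.
apply: (@N_add (fun i => f (i + 3 * a)) (fun i => f (i + 5 * a) (+) f (i + 6 * a))).
  exact: N_shift.
by apply: (@N_add (fun i => f (i + 5 * a)) (fun i => f (i + 6 * a))); apply: N_shift.
Qed.

(** The image of [parity a] is a minimal ideal whose nonzero words are translates of each other. *)
Lemma parity_dichotomy a : a \in [:: 1; 3] ->
  (forall f, N f -> forall i, parity a f i = false) \/ N (simplex_word (3 * a)).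
Proof.
move=> a13; case: (pselect (exists2 f, N f & ~ forall i, parity a f i = false)) => [[f Nf nz]|none].
  right; have [//|[j e]] := parity_values f a13.
  have -> : simplex_word (3 * a) = fun i => parity a f (i + j) by apply/funext=> i; rewrite e.
  exact/(N_shift (f := parity a f))/N_parity.
by left=> f Nf; apply: contrapT => nz; apply: none; exists f.
Qed.

(** F_2[x]/(x^7 - 1) is the product of F_2 and two fields with 8 elements; [N] contains neither,
    exactly one or both of the summands of degree 3. *)
Lemma code_classification :
  [\/ forall f, N f -> forall i, f i = f 0,
      exists a, [/\ a \in [:: 1; 3],
          forall f, N f -> forall i, parity a f i = false & N (simplex_word a)] |
      forall j, N (fun i => (i + j == 0) (+) (i + j == 1))].
Proof.
have h1 : (1 : 'F_7) \in [:: 1; 3] by [].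
have h3 : (3 : 'F_7) \in [:: 1; 3] by [].
have S1 : simplex_word (3 * 3) = simplex_word 1.
  by apply/funext=> i; apply/eqP; move: i; apply: allF7; vm_compute.
have [z1|N3] := parity_dichotomy h1; have [z3|] := parity_dichotomy h3; rewrite ?S1.
- by apply: Or31 => f Nf; apply: parity13_const; [exact: z1 | exact: z3].
- by move=> N1; apply: Or32; exists 1.
- by apply: Or32; exists 3.
move=> N1; apply: Or33 => j.
(* The supports of the two simplex words cover F_7 and meet only in 0, so their sum is 1 except at
   0; adding a translate cancels the constant and leaves the word supported on 0 and 1. *)
pose f i := (simplex_word 1 i (+) simplex_word 1 (i + 6)) (+)
    (simplex_word 3 i (+) simplex_word 3 (i + 6)).
have Nf : N f.
  apply: (@N_add (fun i => simplex_word 1 i (+) simplex_word 1 (i + 6))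
     (fun i => simplex_word 3 i (+) simplex_word 3 (i + 6))).
    by apply: (@N_add (simplex_word 1) (fun i => simplex_word 1 (i + 6))) => //; apply: N_shift.
  by apply: (@N_add (simplex_word 3) (fun i => simplex_word 3 (i + 6))) => //; apply: N_shift.
have -> : (fun i => (i + j == 0) (+) (i + j == 1)) = fun i => f (i + j).
  apply/funext=> i; move: (i + j) => {}i.
  by apply/eqP; move: i; apply: allF7; vm_compute.
exact: N_shift.
Qed.

End BinaryCodes.

(** * Multiquadratic extensions and sign changes *)

Section Multiquadratic.
Variables (E : fieldType) (F : subfld E) (I : finType) (w : I -> E).
Hypothesis w2 : forall i, w i ^+ 2 \in F.
Implicit Types (S : {ffun I -> bool}) (f g : E).

Definition sqfmon S : E := \prod_i w i ^+ S i.

Definition span (P : {ffun I -> bool} -> Prop) f :=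
  exists al : {ffun I -> bool} -> E,
    [/\ forall S, al S \in F, forall S, al S != 0 -> P S & f = \sum_S al S * sqfmon S].

Definition spanT := span (fun=> True).

Lemma span_term a S : a \in F -> spanT (a * sqfmon S).
Proof.
move=> Fa; exists (fun S' => if S' == S then a else 0); split=> // [S'|].
  by case: ifP => // _; rewrite rpred0.
rewrite (bigD1 S) //= eqxx big1 ?addr0 // => S' /negbTE->.
by rewrite mul0r.
Qed.

Lemma spanD f g : spanT f -> spanT g -> spanT (f + g).
Proof.
move=> [al [Fal _ ->]] [be [Fbe _ ->]]; exists (fun S => al S + be S); split=> // [S|].
  exact: rpredD.
by rewrite -big_split; apply: eq_bigr => S _; rewrite mulrDl.
Qed.

Lemma span_scale a f : a \in F -> spanT f -> spanT (a * f).
Proof.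
move=> Fa [al [Fal _ ->]]; exists (fun S => a * al S); split=> // [S|].
  exact: rpredM.
by rewrite mulr_sumr; apply: eq_bigr => S _; rewrite mulrA.
Qed.

Lemma span0 : spanT 0.
Proof.
exists (fun=> 0); split=> // [S|]; first exact: rpred0.
by rewrite big1 // => S _; rewrite mul0r.
Qed.

Lemma span_sum (J : finType) (h : J -> E) : (forall j, spanT (h j)) -> spanT (\sum_j h j).
Proof. by move=> sh; elim/big_ind: _ => //; [exact: span0 | exact: spanD]. Qed.

Lemma sqfmonM S S' : exists2 a, a \in F &
  sqfmon S * sqfmon S' = a * sqfmon [ffun i => S i (+) S' i].
Proof.
exists (\prod_i (w i ^+ 2) ^+ (S i && S' i)).
  by apply: rpred_prod => i _; apply: rpredX.
rewrite -!big_split /=; apply: eq_bigr => i _; rewrite ffunE -exprD -exprM -exprD.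
by case: (S i); case: (S' i).
Qed.

Lemma spanM f g : spanT f -> spanT g -> spanT (f * g).
Proof.
move=> [al [Fal _ ->]] [be [Fbe _ ->]]; rewrite mulr_suml; apply: span_sum => S.
rewrite mulr_sumr; apply: span_sum => S'.
have [a Fa e] := sqfmonM S S'.
rewrite mulrACA e mulrA; apply: span_term.
by rewrite !rpredM.
Qed.

Lemma sqfmon0 : sqfmon [ffun=> false] = 1.
Proof. by rewrite /sqfmon big1 // => i _; rewrite ffunE. Qed.

Lemma sqfmon1 i : sqfmon [ffun j => j == i] = w i.
Proof.
rewrite /sqfmon (bigD1 i) //= ffunE eqxx big1 ?mulr1 // => j ji.
by rewrite ffunE (negbTE ji).
Qed.

Lemma span_base a : a \in F -> spanT a.
Proof. by move=> Fa; rewrite -[a]mulr1 -sqfmon0; apply: span_term. Qed.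

Lemma alg_w i : alg F (w i).
Proof.
exists ('X^2 - (w i ^+ 2)%:P); split.
- by rewrite rpredB ?polyOverXn // polyOverC.
- by rewrite -size_poly_gt0 size_polyDl ?size_polyXn // size_polyN ltnS (leq_trans (size_polyC_leq1 _)).
by rewrite /root hornerD hornerN hornerXn hornerC subrr.
Qed.

Lemma alg_span f : spanT f -> alg F f.
Proof.
move=> [al [Fal _ ->]]; elim/big_ind: _ => [||S _]; first by apply: alg_in; rewrite rpred0.
  exact: alg_add.
apply: alg_mul; first exact: alg_in.
rewrite /sqfmon; elim/big_ind: _ => [||i _]; first by apply: alg_in; rewrite rpred1.
  exact: alg_mul.
by case: (S i); rewrite ?expr1 ?expr0; [exact: alg_w | apply: alg_in; rewrite rpred1].
Qed.

Lemma span_inv f : spanT f -> spanT f^-1.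
Proof.
move=> sf; have [P [FP P0 Pf]] := alg_span sf.
have [|p [Fp _ ->]] := alg_adj1_poly FP P0 Pf (y := f^-1).
  by rewrite rpredV adj1_gen.
rewrite horner_coef; apply: span_sum => i; apply: span_scale; first by move/polyOverP: Fp.
elim: (i : nat) => [|n IHn]; first by rewrite expr0; apply: span_base; rewrite rpred1.
by rewrite exprS; apply: spanM.
Qed.

Lemma span_closed : divring_closed [pred f | `[< spanT f >]].
Proof.
split=> [|f g|f g]; rewrite !inE.
- by apply/asboolP/span_base; rewrite rpred1.
- move=> /asboolP sf /asboolP sg; apply/asboolP/spanD => //.
  by rewrite -mulN1r; apply: span_scale; rewrite ?rpredN1.
by move=> /asboolP sf /asboolP sg; apply/asboolP/spanM => //; apply: span_inv.
Qed.

Lemma multiquadratic_span f : f \in adjs F (map w (enum I)) -> spanT f.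
Proof.
move=> Ff; apply/asboolP; apply: (@adjs_min _ _ (Subfld span_closed)
  _ _ _ f Ff) => [a Fa|_ /mapP[i _ ->]].
  by rewrite inE; apply/asboolP/span_base.
by rewrite inE; apply/asboolP; rewrite -sqfmon1 -[X in spanT X]mul1r; apply: span_term; rewrite rpred1.
Qed.

Hypothesis two0 : 2%:R != 0 :> E.

(** Twice [f] is f + phi f, in which the monomials that [phi] negates cancel and the others
    double. *)
Lemma span_project (phi : {rmorphism E -> E}) (n : I -> bool) P f :
  (forall a, a \in F -> phi a = a) -> (forall i, phi (w i) = (-1) ^+ n i * w i) ->
  phi f = f -> span P f ->
  span (fun S => P S /\ \big[addb/false]_i (n i && S i) = false) f.
Proof.
move=> phiF phiw phif [al [Fal alP fE]].
pose e (S : {ffun I -> bool}) := \big[addb/false]_i (n i && S i).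
have phim S : phi (sqfmon S) = (-1) ^+ e S * sqfmon S.
  rewrite rmorph_prod /e (big_morph (fun b : bool => (-1) ^+ b : E) (id1 := 1)
    (op1 := *%R)) //; last first.
    by move=> b b'; rewrite signr_addb.
  rewrite -big_split; apply: eq_bigr => i _ /=.
  by rewrite rmorphXn /= phiw exprMn -exprM mulnb.
exists (fun S => if e S then 0 else al S); split=> [S|S|].
- by case: ifP => // _; rewrite rpred0.
- by case: ifP => eS; rewrite ?eqxx // => /alP PS; split.
apply: (mulfI two0); rewrite mulr_natl mulr2n -{1}phif {1}fE rmorph_sum fE -big_split.
rewrite mulr_sumr; apply: eq_bigr => S _ /=.
rewrite rmorphM phiF // phim; case: (e S); rewrite /= ?expr0 ?expr1; ring.
Qed.

End Multiquadratic.

(** * Lines of the two cyclic Fano planes *)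

Section FanoLines.
Implicit Types a c b i : 'F_7.

Definition line a i : seq 'F_7 := [:: i + a; i + 2 * a; i + 4 * a].

Lemma line_uniq a i : a \in [:: 1; 3] -> uniq (line a i).
Proof.
by rewrite !inE => /orP[]/eqP->; move: i; apply: allF7; vm_compute.
Qed.

Lemma line_affine a c b i : a \in [:: 1; 3] -> c \in [:: 1; 2; 4] ->
  perm_eq (map (fun x => c * x + b) (line a i)) (line a (c * i + b)).
Proof.
rewrite !inE => /orP[]/eqP-> /or3P[]/eqP->; move: i; apply: allF7; move: b; apply: allF7;
  by vm_compute.
Qed.

(** Two points lie on a unique line, so the three lines through [i] cover every other point once and
    [i] three times. *)
Lemma lines_through a i : a \in [:: 1; 3] ->
  perm_eq (flatten [seq line a j | j <- [:: i - a; i - 2 * a; i - 4 * a]]) (i :: i :: F7).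
Proof.
by rewrite !inE => /orP[]/eqP->; move: i; apply: allF7; vm_compute.
Qed.

Lemma lines_all a : a \in [:: 1; 3] ->
  perm_eq (flatten [seq line a j | j <- F7]) (F7 ++ F7 ++ F7).
Proof. by rewrite !inE => /orP[]/eqP->; vm_compute. Qed.

Lemma line_sub a i : a \in [:: 1; 3] -> all (on_line a 0) (line a i) = (i == 0).
Proof.
by rewrite !inE => /orP[]/eqP->; apply/eqP; move: i; apply: allF7; vm_compute.
Qed.

Lemma F7_uniq : uniq F7. Proof. by vm_compute. Qed.

Lemma big_F7 (R : Type) (idx : R) (op : Monoid.com_law idx) (f : 'F_7 -> R) :
  \big[op/idx]_i f i = \big[op/idx]_(i <- F7) f i.
Proof.
apply: perm_big; apply: uniq_perm; rewrite ?index_enum_uniq ?F7_uniq // => i.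
by rewrite mem_F7 mem_index_enum.
Qed.

End FanoLines.

(** The quotient is p^r / eta^6 divided by p^r / eta^7. *)
Lemma seven_eta (F : fieldType) (d : 'F_7 -> F) (p eta : F) e r :
  (e * r).+1 = 7%N -> p ^+ r = \prod_(i <- F7) d i -> eta != 0 -> p != 0 ->
  eta = (p / eta ^+ e) ^+ r / \prod_(i <- F7) (d i / eta).
Proof.
move=> er pr eta0 p0.
have -> : \prod_(i <- F7) (d i / eta) = p ^+ r / eta ^+ (e * r).+1.
  rewrite pr big_split /=; congr (_ * _); rewrite er !big_cons big_nil.
  by rewrite -exprVn !exprS expr0.
rewrite expr_div_n -exprM exprS.
have := expf_neq0 r p0; have := expf_neq0 (e * r) eta0.
by move: (p ^+ r) (eta ^+ (e * r)) => x y y0 x0; field; rewrite eta0 x0 y0.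
Qed.

(* [code] is the group of sign patterns by which the kernel of the action of [G] on the
   seven pairs acts on the differences [w i]; it is a cyclic code. *)
Section SevenPairs.
Variables (k : fieldType) (chark : 7 \in [pchar k]).
Local Notation E := (ratfun k 14).
Local Notation act := (@perm_act k 14).
Local Notation rfb := (rfbase k 14).
Let charE : 7 \in [pchar E] := ratfun_char 14 chark.
Variables (G : {group 'S_14}) (lab : 'F_7 -> bool -> 'I_14).
Hypotheses (lab_inj : forall i B i' B', lab i B = lab i' B' -> i = i' /\ B = B')
  (lab_surj : forall x, exists i B, x = lab i B).
Hypothesis HG : forall s, s \in G -> exists (c b : 'F_7) (eps : 'F_7 -> bool),
  c != 0 /\ forall i B, s (lab i B) = lab (c * i + b) (B (+) eps i).
Variable g : 'S_14.
Hypotheses (gG : g \in G) (gE : forall i B, g (lab i B) = lab (i + 1) B).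
Implicit Types (i j c b a : 'F_7) (eps : 'F_7 -> bool).

Definition code (f : 'F_7 -> bool) : Prop :=
  exists2 s, s \in G & forall i B, s (lab i B) = lab i (B (+) f i).

Lemma code_add f f' : code f -> code f' -> code (fun i => f i (+) f' i).
Proof.
move=> [s sG sE] [s' s'G s'E]; exists (s * s')%g; first exact: groupM.
by move=> i B; rewrite permM sE s'E addbA.
Qed.

Lemma shift_in j : exists2 s : 'S_14, s \in G & forall i B, s (lab i B) = lab (i + j) B.
Proof.
exists (g ^+ j)%g; first exact: groupX.
move=> i B; rewrite -{2}[j]natr_Zp; elim: (j : nat) i => [|n IHn] i; first by rewrite expg0 perm1 addr0.
by rewrite expgS permM gE IHn -addrA -natr1 [1 + _]addrC.
Qed.

Lemma code_affine (s : 'S_14) c b eps f : s \in G ->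
  (forall i B, s (lab i B) = lab (c * i + b) (B (+) eps i)) ->
  code f -> code (fun i => f (c * i + b)).
Proof.
move=> sG sE [n nG nE]; exists (s * n * s^-1)%g; first by rewrite !groupM ?groupV.
move=> i B; rewrite !permM; apply: (@perm_inj _ s); rewrite permKV !sE nE.
by rewrite -!addbA [f _ (+) _]addbC.
Qed.

Lemma code_shift f j : code f -> code (fun i => f (i + j)).
Proof.
move=> Nf; have [s sG sE] := shift_in j.
have sE' i B : s (lab i B) = lab (1 * i + j) (B (+) false) by rewrite mul1r addbF.
have := code_affine (eps := fun=> false) sG sE' Nf.
by congr code; apply/funext=> i; rewrite mul1r.
Qed.

(** With [h] the translation by [c], the products [g * s] and [s * h] permute the pairs in the same
    way, so their quotient lies in the kernel. This is how the code controls the signs of elements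
    outside the kernel. *)
Lemma code_diff (s : 'S_14) c b eps : s \in G ->
  (forall i B, s (lab i B) = lab (c * i + b) (B (+) eps i)) ->
  code (fun i => eps (i + 1) (+) eps i).
Proof.
move=> sG sE; have [h hG hE] := shift_in c.
exists (g * s * (s * h)^-1)%g; first by rewrite !groupM ?groupV ?groupM.
move=> i B; rewrite !permM; apply: (@perm_inj _ (s * h)%g); rewrite permKV gE sE permM sE hE.
rewrite mulrDr mulr1 addrAC; congr (lab _ _).
by rewrite -!addbA addbb addbF.
Qed.

Let W i : {mpoly k[14]} := 'X_(lab i false) - 'X_(lab i true).
Let w i : E := tofrac (W i).
Let u i : E := rfX k (lab i false) + rfX k (lab i true).

Lemma wE i : w i = rfX k (lab i false) - rfX k (lab i true).
Proof. exact: tofracB. Qed.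

Lemma act_pair (s : 'S_14) c b eps :
  (forall i B, s (lab i B) = lab (c * i + b) (B (+) eps i)) ->
  (forall i, act s (w i) = (-1) ^+ eps i * w (c * i + b)) /\
  (forall i, act s (u i) = u (c * i + b)).
Proof.
move=> sE; split=> i.
  rewrite !wE; transitivity (act s (rfX k (lab i false)) - act s (rfX k (lab i true))).
    exact: (rmorphB (@perm_act k 14 s)).
  rewrite !perm_act_rfX !sE addFb addTb.
  by case: (eps i); rewrite /= ?expr0 ?expr1 ?mul1r // mulN1r opprB.
rewrite /u; transitivity (act s (rfX k (lab i false)) + act s (rfX k (lab i true))).
  exact: (rmorphD (@perm_act k 14 s)).
rewrite !perm_act_rfX !sE addFb addTb.
by case: (eps i); rewrite //= addrC.
Qed.

(** The point at which each [W i] takes the value [f i]: in pair [i] the first variable is [f i] and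
    the second is 0. *)
Definition pair_point (f : 'F_7 -> bool) (x : 'I_14) : k :=
  [exists i, f i && (x == lab i false)]%:R.

Lemma W_eval f i : (W i).@[pair_point f] = (f i)%:R.
Proof.
rewrite mevalB !mevalXU /pair_point.
have -> : [exists i0, f i0 && (lab i true == lab i0 false)] = false.
  by apply/existsP=> -[i0 /andP[_ /eqP/lab_inj[]]].
rewrite subr0; congr (_%:R); congr nat_of_bool.
apply/existsP/idP => [[i0 /andP[fi /eqP/lab_inj[->]]]//|fi].
by exists i; rewrite fi eqxx.
Qed.

Lemma w_neq0 i : w i != 0.
Proof.
apply: (tofrac_neq0 (a := pair_point (fun=> true))).
by rewrite W_eval oner_neq0.
Qed.

Lemma twoE : 2%:R != 0 :> E.
Proof. by rewrite -[2%:R]/(fe E 2) (fe_eq0 charE). Qed.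

Lemma pair_recover (K : subfld E) : (forall i, u i \in K) -> (forall i, w i \in K) ->
  forall x, rfX k x \in K.
Proof.
move=> Ku Kw x; have [i [B ->]] := lab_surj x.
have [||K0 K1] := half_sum_in (K := K) (a := rfX k (lab i false)) (b := rfX k (lab i true)) twoE.
- exact: Ku.
- by rewrite -wE; apply: Kw.
by case: B; [exact: K1 | exact: K0].
Qed.

Definition pair_base : subfld E := adjs rfb (map u F7 ++ map (fun i => w i ^+ 2) F7).

Lemma pair_base_u i : u i \in pair_base.
Proof.
apply: adjs_gen; rewrite mem_cat; apply/orP; left.
by apply: map_f; apply: mem_F7.
Qed.

Lemma pair_base_w2 i : w i ^+ 2 \in pair_base.
Proof.
apply: adjs_gen; rewrite mem_cat; apply/orP; right.
by apply: (map_f (fun i => w i ^+ 2)); apply: mem_F7.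
Qed.

Lemma pair_base_min (K : subfld E) : {subset rfb <= K} -> (forall i, u i \in K) ->
  (forall i, w i ^+ 2 \in K) -> {subset pair_base <= K}.
Proof.
move=> rK Ku Kw; apply: adjs_min => // y.
by rewrite mem_cat => /orP[]/mapP[i _ ->]; [exact: Ku | exact: Kw].
Qed.

Lemma pair_gen f : f \in adjs pair_base (map w (enum 'F_7)).
Proof.
apply: adjs_min (ratfun_gen f) => [y yr|_ /mapP[x _ ->]].
  by apply: adjs_sub; apply: adjs_sub.
apply: pair_recover => i; first by apply: adjs_sub; apply: pair_base_u.
by apply: adjs_gen; apply: map_f; rewrite mem_enum.
Qed.

(** Each sign change [n j] comes from [G], hence fixes [f], and removes the monomials whose exponent
    word is not orthogonal to it. *)
Lemma inv_span (n : 'F_7 -> 'F_7 -> bool) f : (forall j, code (n j)) -> fixed_by G act f ->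
  span pair_base w (fun S => forall j, dot (n j) S = false) f.
Proof.
move=> nN If.
suff [al [Fal alP fE]] : span pair_base w (fun S => forall j, j \in F7 -> dot (n j) S = false) f.
  by exists al; split=> // S /alP h j; apply: h; apply: mem_F7.
elim: F7 => [|j l [al [Fal alP fE]]].
  have [al [Fal _ fE]] := multiquadratic_span pair_base_w2 (pair_gen f).
  by exists al.
have [s sG sE] := nN j.
have sE' i B : s (lab i B) = lab (1 * i + 0) (B (+) n j i) by rewrite mul1r addr0.
have [sw su] := act_pair sE'.
have sp : span pair_base w (fun S => forall j, j \in l -> dot (n j) S = false) f by exists al.
have [] := span_project twoE (phi := @perm_act k 14 s) (n := n j) _ _ (If s sG) sp.
- apply: fixed_adjs => y; rewrite mem_cat => /orP[]/mapP[i _ ->].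
    by rewrite su mul1r addr0.
  rewrite (_ : act s (w i ^+ 2) = act s (w i) ^+ 2); last exact: (rmorphXn (@perm_act k 14 s)).
  by rewrite sw mul1r addr0 exprMn sqrr_sign mul1r.
- by move=> i; rewrite [LHS]sw mul1r addr0.
move=> be [Fbe beP fE']; exists be; split; [exact: Fbe | | exact: fE'].
move=> S /beP[h1 h2] j'; rewrite in_cons => /orP[/eqP->|jl]; [exact: h2 | exact: h1].
Qed.

Lemma inv_in_of (n : 'F_7 -> 'F_7 -> bool) (K : subfld E) f : (forall j, code (n j)) ->
  {subset rfb <= K} -> (forall i, u i \in K) -> (forall i, w i ^+ 2 \in K) ->
  (forall S : {ffun 'F_7 -> bool}, (forall j, dot (n j) S = false) -> sqfmon w S \in K) ->
  fixed_by G act f -> f \in K.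
Proof.
move=> nN rK Ku Kw KS If; have [al [Fal alP ->]] := inv_span nN If.
apply: rpred_sum => S _; have [->|a0] := eqVneq (al S) 0; first by rewrite mul0r rpred0.
apply: rpredM; first exact: (pair_base_min rK Ku Kw).
by apply: KS; apply: alP.
Qed.

Lemma alg_of_squares (K : subfld E) : (forall i, u i \in K) -> (forall i, w i ^+ 2 \in K) ->
  forall x, alg K (rfX k x).
Proof.
move=> Ku Kw x; apply: (@alg_adjs _ _ (map w F7)) => [_ /mapP[i _ ->]|].
  exact: alg_w.
apply: alg_in; apply: pair_recover => i; first by apply: adjs_sub; apply: Ku.
by apply: adjs_gen; apply: map_f; apply: mem_F7.
Qed.

Lemma rfX_full (K : subfld E) : {subset rfb <= K} -> (forall x, rfX k x \in K) ->
  forall y, y \in K.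
Proof. by move=> rK KX y; apply: adjs_min (ratfun_gen y) => // _ /mapP[x _ ->]; apply: KX. Qed.

(** The word [eps] of an element of [G] has constant differences, hence is constant, so [G] permutes
    the [w i] affinely up to a common sign. They serve as [d], and [q] is their total mass
    itself. *)
Lemma code_const_rational : (forall f, code f -> forall i, f i = f 0) ->
  rational k (perm_fixedfield k G) (fixedC k G).
Proof.
move=> Nc; apply: (@seven_points_rational k chark G w u (moment w 0 0)).
- move=> s sG; have [c [b [eps [c0 sE]]]] := HG sG; have [sw su] := act_pair sE.
  have ec i : eps i = eps 0.
    apply: diff_const => i1 i2.
    exact: (etrans (Nc _ (code_diff sG sE) i1) (esym (Nc _ (code_diff sG sE) i2))).
  have sw' i : act s (w i) = (-1) ^+ eps 0 * w (c * i + b) by rewrite sw ec.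
  exists c, b, (eps 0 : nat), (eps 0 : nat); split; [exact: c0 | exact: sw' | exact: su |].
  exact: (moment00_map charE c0 sw').
- have -> : moment w 0 0 = tofrac (\sum_i W i).
    by rewrite /moment rmorph_sum; apply: eq_bigr => i _; rewrite expr0 mul1r.
  apply: (tofrac_neq0 (a := pair_point (fun i => i == 0))).
  rewrite (raddf_sum (meval _)) (eq_bigr _ (fun i _ => W_eval _ i)).
  rewrite (bigD1 0) //= big1 ?addr0 ?oner_neq0 // => i i0.
  by rewrite (negbTE i0).
- by [].
- move=> K [rK _ Kw Ku] x; apply: alg_in; exact: pair_recover.
by move=> K [rK _ Kw Ku] y _; apply: rfX_full => // x; apply: pair_recover.
Qed.

Let p : E := \prod_(x <- F7) w x.

Lemma act_prod (s : 'S_14) c b eps (l : seq 'F_7) :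
  (forall i B, s (lab i B) = lab (c * i + b) (B (+) eps i)) ->
  act s (\prod_(x <- l) w x) =
  (-1) ^+ (\sum_(x <- l) eps x) * \prod_(x <- map (fun x => c * x + b) l) w x.
Proof.
move=> /act_pair[sw _]; elim: l => [|x l IHl].
  by rewrite !big_nil expr0 mulr1; apply: (rmorph1 (@perm_act k 14 s)).
rewrite map_cons !big_cons exprD mulrACA -IHl -sw.
exact: (rmorphM (@perm_act k 14 s)).
Qed.

Lemma act_full_prod (s : 'S_14) c b eps : c != 0 ->
  (forall i B, s (lab i B) = lab (c * i + b) (B (+) eps i)) ->
  act s p = (-1) ^+ (\sum_(x <- F7) eps x) * p.
Proof.
move=> c0 sE; rewrite [LHS](act_prod _ sE); congr (_ * _); apply: perm_big.
have inj : injective (fun x => c * x + b) by move=> x y /addIr/(mulfI c0).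
have um : uniq (map (fun x => c * x + b) F7) by rewrite (map_inj_uniq inj) F7_uniq.
apply: uniq_perm => //; have [] := uniq_min_size um (s2 := F7); rewrite ?size_map //.
by move=> x _; apply: mem_F7.
Qed.

Lemma prod_w_neq0 (l : seq 'F_7) : \prod_(x <- l) w x != 0.
Proof.
elim: l => [|x l IHl]; first by rewrite big_nil oner_neq0.
by rewrite big_cons; apply: mulf_neq0; [exact: w_neq0 | exact: IHl].
Qed.

Lemma act_ratio_pow (s : 'S_14) (x y : E) m n e : act s x = (-1) ^+ m * x ->
  act s y = (-1) ^+ n * y -> act s (x / y ^+ e) = (-1) ^+ (m + n * e) * (x / y ^+ e).
Proof.
move=> sx sy; transitivity (act s x / act s y ^+ e).
  transitivity (act s x / act s (y ^+ e)); first exact: (fmorph_div (@perm_act k 14 s)).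
  by congr (_ / _); apply: (rmorphXn (@perm_act k 14 s)).
rewrite sx sy exprMn invfM -exprM exprD mulrACA; congr (_ * _ * _).
by rewrite -[LHS]exprVn invrN1.
Qed.

Lemma eta_in_of (K : subfld E) (d : 'F_7 -> E) (eta : E) e r :
  (e * r).+1 = 7%N -> p ^+ r = \prod_(i <- F7) d i -> eta != 0 ->
  p / eta ^+ e \in K -> (forall i, d i / eta \in K) -> eta \in K.
Proof.
move=> er pr eta0 Kq Ky.
suff -> : eta = (p / eta ^+ e) ^+ r / \prod_(i <- F7) (d i / eta).
  by apply: rpred_div; [apply: rpredX | apply: rpred_prod].
exact: (seven_eta er pr eta0 (prod_w_neq0 F7)).
Qed.

Lemma full_prod_in (K : subfld E) (d : 'F_7 -> E) e :
  (forall i, d i \in K) -> moment d 0 0 != 0 -> p / moment d 0 0 ^+ e \in K -> p \in K.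
Proof.
move=> Kd eta0 Kq; have Ke : moment d 0 0 \in K by apply: moment_in => //; apply: rpred0.
have e0 : moment d 0 0 ^+ e != 0 by apply: expf_neq0.
by rewrite -[p](divfK e0); apply: rpredM => //; apply: rpredX.
Qed.

(** Only constant words are orthogonal to all even words, so the invariants lie in the field of the
    [u i], the squares and [p]. As p^2 is the product of the squares, the exponents are r = 2 and e
    = 3. *)
Lemma code_even_rational : (forall j, code (fun i => (i + j == 0) (+) (i + j == 1))) ->
  rational k (perm_fixedfield k G) (fixedC k G).
Proof.
move=> Ne; pose d i := w i ^+ 2; pose eta := moment d 0 0.
have eta0 : eta != 0.
  have -> : eta = tofrac (\sum_i W i ^+ 2).
    rewrite /eta /moment rmorph_sum; apply: eq_bigr => i _.
    by rewrite expr0 mul1r; apply/esym/(rmorphXn (@tofrac {mpoly k[14]})).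
  apply: (tofrac_neq0 (a := pair_point (fun i => i == 0))).
  rewrite (raddf_sum (meval _)) (eq_bigr (fun i => (i == 0)%:R)) => [|i _].
    by rewrite (bigD1 0) //= big1 ?addr0 ?oner_neq0 // => i /negbTE->.
  transitivity ((W i).@[pair_point (fun i => i == 0)] ^+ 2).
    exact: (rmorphXn (meval (pair_point (fun i => i == 0)))).
  by rewrite W_eval; case: (i == 0); rewrite ?expr1n ?expr0n.
apply: (@seven_points_rational k chark G d u (p / eta ^+ 3)).
- move=> s sG; have [c [b [eps [c0 sE]]]] := HG sG; have [sw su] := act_pair sE.
  have sd i : act s (d i) = (-1) ^+ 0 * d (c * i + b).
    rewrite expr0 mul1r (_ : act s (d i) = act s (w i) ^+ 2); last first.
      exact: (rmorphXn (@perm_act k 14 s)).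
    by rewrite sw exprMn sqrr_sign mul1r.
  exists c, b, 0%N, (\sum_(x <- F7) eps x + 0 * 3)%N.
  split; [exact: c0 | exact: sd | exact: su |].
  exact: (act_ratio_pow 3 (act_full_prod c0 sE) (moment00_map charE c0 sd)).
- exact: eta0.
- move=> K rK Kq Ky; apply: (eta_in_of (e := 3) (r := 2)) Kq Ky => //.
  by rewrite -prodrXl.
- by move=> K [rK _ Kw Ku]; apply: alg_of_squares.
move=> K [rK Kq Kd Ku] f.
apply: (inv_in_of Ne rK Ku Kd) => S /dual_even S0.
rewrite /sqfmon (eq_bigr (fun i => w i ^+ S 0)) => [|i _]; last by rewrite S0.
case: (S 0); last by rewrite big1 ?rpred1.
rewrite big_F7; exact: (full_prod_in Kd eta0 Kq).
Qed.

Lemma sqfmon_line (S : {ffun 'F_7 -> bool}) a j : a \in [:: 1; 3] ->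
  (forall i, S i = on_line a j i) -> sqfmon w S = \prod_(x <- line a j) w x.
Proof.
move=> a13 SE; rewrite [RHS](big_uniq _ (line_uniq j a13)) [RHS]big_mkcond /=.
by apply: eq_bigr => i _; rewrite SE; case: ifP => h; rewrite /on_line -/(line a j) h ?expr1 ?expr0.
Qed.

(** By the incidences at [i], the products over the three lines through [i] multiply to w_i^2 p. *)
Lemma line_square_in (K : subfld E) a : a \in [:: 1; 3] ->
  (forall i, \prod_(x <- line a i) w x \in K) -> p \in K -> forall i, w i ^+ 2 \in K.
Proof.
move=> a13 Kd Kp i.
have e : \prod_(x <- flatten [seq line a j | j <- [:: i - a; i - 2 * a; i - 4 * a]]) w x =
    \prod_(x <- i :: i :: F7) w x by apply/perm_big/lines_through.
have {}e : \prod_(j <- [:: i - a; i - 2 * a; i - 4 * a]) \prod_(x <- line a j) w x =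
    w i ^+ 2 * p.
  transitivity (\prod_(x <- i :: i :: F7) w x); first by rewrite -e big_flatten big_map.
  by rewrite [LHS]big_cons [X in _ * X]big_cons /= mulrA -expr2.
have -> : w i ^+ 2 = (w i ^+ 2 * p) / p by rewrite mulfK // prod_w_neq0.
by rewrite -e; apply: rpred_div => //; apply: rpred_prod => j _; apply: Kd.
Qed.

(** The monomials orthogonal to the simplex code are 1, the [d i], the quotients [p / d i] and [p].
    Every point is on three lines, so p^3 is the product of the [d i], which gives r = 3 and e =
    2. *)
Lemma code_simplex_rational a : a \in [:: 1; 3] ->
  (forall f, code f -> forall i, parity a f i = false) -> code (simplex_word a) ->
  rational k (perm_fixedfield k G) (fixedC k G).
Proof.
move=> a13 NT NS; pose d i : E := \prod_(x <- line a i) w x; pose eta := moment d 0 0.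
have eta0 : eta != 0.
  have -> : eta = tofrac (\sum_i \prod_(x <- line a i) W x).
    rewrite /eta /moment rmorph_sum; apply: eq_bigr => i _.
    by rewrite expr0 mul1r; apply/esym/(rmorph_prod (@tofrac {mpoly k[14]})).
  apply: (tofrac_neq0 (a := pair_point (on_line a 0))).
  rewrite (raddf_sum (meval _)) (eq_bigr (fun i => (i == 0)%:R)) => [|i _].
    by rewrite (bigD1 0) //= big1 ?addr0 ?oner_neq0 // => i /negbTE->.
  transitivity (\prod_(x <- line a i) (W x).@[pair_point (on_line a 0)]).
    exact: (rmorph_prod (meval (pair_point (on_line a 0)))).
  rewrite -(line_sub i a13); elim: (line a i) => [|x l IHl]; first by rewrite big_nil.
  by rewrite big_cons IHl W_eval /=; case: (on_line a 0 x); rewrite ?mul1r ?mul0r.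
have NSj j : code (fun i => simplex_word a (i + j)) by apply: code_shift.
apply: (@seven_points_rational k chark G d u (p / eta ^+ 2)).
- move=> s sG; have [c [b [eps [c0 sE]]]] := HG sG; have [sw su] := act_pair sE.
  (* A nonsquare multiplier would bring words of the other simplex code into the code. *)
  have cR : c \in [:: 1; 2; 4].
    by apply: (multiplier_residue (b := b) a13 c0); apply/NT/(code_affine sG sE NS).
  (* The three signs on a line have the same product for every line. *)
  have De : forall i, line_sum a eps i = line_sum a eps 0.
    by apply: line_sum_const => // i; apply: (NT _ (code_diff sG sE)).
  have sd i : act s (d i) = (-1) ^+ line_sum a eps 0 * d (c * i + b).
    rewrite [LHS](act_prod _ sE) -(De i); congr (_ * _); last first.
      exact/perm_big/line_affine.
    rewrite !big_cons big_nil addn0 /line_sum.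
    by case: (eps _); case: (eps _); case: (eps _); rewrite /= ?expr0 ?expr1 // !exprS expr0; ring.
  exists c, b, (line_sum a eps 0 : nat), (\sum_(x <- F7) eps x + line_sum a eps 0%R * 2)%N.
  split; [exact: c0 | exact: sd | exact: su |].
  exact: (act_ratio_pow 2 (act_full_prod c0 sE) (moment00_map charE c0 sd)).
- exact: eta0.
- move=> K rK Kq Ky; apply: (eta_in_of (e := 2) (r := 3)) Kq Ky => //.
  have : \prod_(x <- flatten [seq line a j | j <- F7]) w x = \prod_(x <- F7 ++ F7 ++ F7) w x.
    exact/perm_big/lines_all.
  by rewrite big_flatten big_map !big_cat /= !exprS expr0 mulr1 => ->.
- move=> K [rK Kq Kd Ku]; apply: alg_of_squares; first exact: Ku.
  exact: (line_square_in a13 Kd (full_prod_in Kd eta0 Kq)).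
move=> K [rK Kq Kd Ku] f; have Kp := full_prod_in Kd eta0 Kq.
apply: (inv_in_of NSj rK Ku (line_square_in a13 Kd Kp)) => S' /(dual_simplex a13)[] SE.
- by rewrite /sqfmon big1 ?rpred1 // => i _; rewrite SE.
- by have [j Sj] := SE; rewrite (sqfmon_line a13 Sj); apply: Kd.
- have [j Sj] := SE; have -> : sqfmon w S' = p / d j; last by apply: rpred_div; [exact: Kp | exact: Kd].
  have d0 : d j != 0 := prod_w_neq0 (line a j).
  apply: (mulIf d0); rewrite divfK // /p -big_F7.
  rewrite /d -(sqfmon_line (S := [ffun i => on_line a j i])) // => [|i]; last by rewrite ffunE.
  rewrite -big_split; apply: eq_bigr => i _; rewrite Sj ffunE.
  by case: (on_line a j i); rewrite /= ?expr0 ?expr1 ?mul1r ?mulr1.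
rewrite /sqfmon (eq_bigr w) => [|i _]; last by rewrite SE expr1.
by rewrite big_F7.
Qed.

Lemma seven_pairs_rational : rational k (perm_fixedfield k G) (fixedC k G).
Proof.
have [Nc|[a [a13 NT NS]]|Ne] := code_classification code_add code_shift.
- exact: code_const_rational.
- exact: (code_simplex_rational a13 NT NS).
exact: code_even_rational.
Qed.

End SevenPairs.

(** * Blocks of a solvable transitive group of degree 14 *)

Section NormalOrbits.
Variables (n : nat) (G H : {group 'S_n}).
Hypotheses (HG : (H <| G)%g) (transG : [transitive G, on [set: 'I_n] | 'P]).
Local Notation O x := (orbit 'P H x).

Lemma orbit_act s x : s \in G -> O (s x) = [set s y | y in O x].
Proof.
move=> sG; have sN : s \in 'N(H)%g by apply: (subsetP (normal_norm HG)).
apply/setP=> y; apply/orbitP/imsetP => [[h hH <-]|[z /orbitP[h hH <-] ->]].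
  exists ((h ^ s^-1)%g x); first by apply/orbitP; exists (h ^ s^-1)%g; rewrite ?memJ_norm ?groupV.
  by rewrite -permJ conjgKV.
by exists (h ^ s)%g; rewrite ?memJ_norm // /= /aperm permJ.
Qed.

Lemma orbit_eq_act s x y : s \in G -> O x = O y -> O (s x) = O (s y).
Proof. by move=> sG e; rewrite !orbit_act // e. Qed.

Lemma orbit_point s x : s \in H -> O (s x) = O x.
Proof. by move=> sH; apply/orbit_eqP/orbitP; exists s. Qed.

Lemma trans_point x y : exists2 s, s \in G & s x = y.
Proof.
have /imsetP[z _ e] := transG; have : y \in orbit 'P G x.
  by have : x \in [set: 'I_n] by []; rewrite e => /orbit_eqP->; rewrite -e inE.
by move=> /orbitP[s sG <-]; exists s.
Qed.

Lemma card_orbit_const x y : #|O x| = #|O y|.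
Proof.
have [s sG <-] := trans_point x y.
by rewrite orbit_act // card_imset //; apply: perm_inj.
Qed.

Lemma card_orbit_dvd x : (#|O x| %| n)%N.
Proof.
have P : partition [set O y | y in [set: 'I_n]] [set: 'I_n].
  apply: orbit_partition; apply/actsP=> s _ y; by rewrite !inE.
have cE := card_uniform_partition (n := #|O x|) _ P.
suff : (#|O x| %| #|[set: 'I_n]|)%N by rewrite cardsT card_ord.
rewrite cE; first exact: dvdn_mull.
by move=> _ /imsetP[y _ ->]; apply: card_orbit_const.
Qed.

End NormalOrbits.

Section PowersF7.
Variables (T : finType) (a : {perm T}).
Hypothesis a7 : (a ^+ 7 = 1)%g.
Implicit Types i j : 'F_7.

Lemma expF7D i j : (a ^+ (i + j)%R = a ^+ i * a ^+ j)%g.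
Proof. by rewrite -expgD -[RHS](expg_mod _ a7). Qed.

Lemma expF7M i j : (a ^+ (i * j)%R = a ^+ i ^+ j)%g.
Proof. by rewrite -expgM -[RHS](expg_mod _ a7). Qed.

(** The relation passes to the exponents i - j and 0; as i - j is invertible modulo 7, iterating
    reaches [a] itself. [R] will be equality, or lying in the same orbit. *)
Lemma expF7_orbit (R : T -> T -> Prop) y i j :
  (forall x z, R x z -> R z x) -> (forall x z t, R x z -> R z t -> R x t) ->
  (forall n x z, R x z -> R ((a ^+ n)%g x) ((a ^+ n)%g z)) ->
  R ((a ^+ i)%g y) ((a ^+ j)%g y) -> i != j -> R (a y) y.
Proof.
move=> Rs Rt Ra Rij ij.
have d0 : i - j != 0 by rewrite subr_eq0.
have Rd : R ((a ^+ (i - j)%R)%g y) y.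
  have := Ra (- j : 'F_7) _ _ Rij; rewrite -!permM -!expF7D subrr.
  by rewrite expg0 perm1.
have Rrefl x z : R x z -> R z z by move=> h; apply: Rt (Rs _ _ h) h.
suff : forall n, R ((a ^+ (i - j)%R ^+ n)%g y) y.
  by move=> /(_ ((i - j)^-1 : 'F_7)); rewrite -expF7M mulfV // expg1.
elim=> [|n IHn]; first by rewrite expg0 perm1; apply: Rrefl Rd.
by rewrite expgSr permM; apply: (Rt _ _ _ _ Rd); apply: Ra.
Qed.

End PowersF7.

Lemma inj14_surj (I : finType) (f : I -> 'I_14) : #|I| = 14%N -> injective f ->
  forall x, exists i, x = f i.
Proof.
move=> cI injf x; have : x \in codom f by rewrite inj_card_onto // card_ord cI.
by move=> /codomP.
Qed.

(** * Orbits of size seven: affine labels on two blocks *)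

Section BlocksOfSeven.
Variables (G A : {group 'S_14}).
Hypotheses (AG : (A <| G)%g) (transG : [transitive G, on [set: 'I_14] | 'P]).
Hypotheses (abA : abelian A) (expA : forall s, s \in A -> (s ^+ 7 = 1)%g).
Local Notation O x := (orbit 'P A x).
Hypothesis O7 : forall x, #|O x| = 7%N.

Let AsubG s : s \in A -> s \in G := subsetP (normal_sub AG) s.

Lemma seven_blocks : exists (a0 tau : 'S_14) (y0 : 'I_14),
  [/\ a0 \in A, tau \in G, a0 y0 != y0 & O (tau y0) != O y0].
Proof.
pose y0 : 'I_14 := ord0.
have [z zO] : exists z, z \notin O y0.
  apply/existsP; rewrite -negb_forall; apply/negP=> /forallP h.
  have : O y0 = [set: 'I_14] by apply/setP=> z; rewrite h inE.
  by move=> e; have := O7 y0; rewrite e cardsT card_ord.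
have [tau tG te] := trans_point transG y0 z.
have [z' z'O z'y] : exists2 z', z' \in O y0 & z' != y0.
  have : (0 < #|O y0 :\ y0|)%N by have := O7 y0; rewrite (cardsD1 y0) orbit_refl add1n => /eq_add_S->.
  by move=> /card_gt0P[z']; rewrite !inE => /andP[? ?]; exists z'.
have /orbitP[a0 a0A a0E] := z'O.
exists a0, tau, y0; split=> //; first by rewrite -[a0 y0]/('P%act y0 a0) a0E.
by rewrite te; apply: contra zO => /eqP <-; apply: orbit_refl.
Qed.

Variables (a0 tau : 'S_14) (y0 : 'I_14).
Hypotheses (a0A : a0 \in A) (tauG : tau \in G) (a0y : a0 y0 != y0)
  (tauO : O (tau y0) != O y0).

Let aB (B : bool) : 'S_14 := if B then (a0 ^ tau)%g else a0.
Let yB (B : bool) : 'I_14 := if B then tau y0 else y0.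
(** Powers of an element of order 7 applied to a base point; conjugation by [tau] carries the labels
    of one block to those of the other. *)
Definition block_lab (B : bool) (i : 'F_7) : 'I_14 := (aB B ^+ i)%g (yB B).
Local Notation lab := block_lab.

Lemma tau_norm s : s \in G -> forall x, x \in A -> (x ^ s)%g \in A.
Proof. by move=> sG x xA; rewrite memJ_norm // (subsetP (normal_norm AG)). Qed.

Lemma aB_in B : aB B \in A.
Proof. by case: B => //; apply: tau_norm. Qed.

Lemma aB7 B : (aB B ^+ 7 = 1)%g.
Proof. exact/expA/aB_in. Qed.

Lemma aB_move B : aB B (yB B) != yB B.
Proof. by case: B => //=; rewrite permJ (inj_eq perm_inj). Qed.

Lemma block_lab_inj1 B : injective (lab B).
Proof.
move=> i j e; apply/eqP; apply: contraNT (aB_move B) => ij; apply/eqP.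
apply: (expF7_orbit (aB7 B) (R := eq)) e ij => //; first by move=> x z t -> ->.
by move=> n x z ->.
Qed.

Lemma block_labO B i : O (lab B i) = O (yB B).
Proof. by apply: orbit_point; rewrite groupX ?aB_in. Qed.

Lemma block_lab_orbit B x : O x = O (yB B) -> exists i, x = lab B i.
Proof.
move=> xO; have : [set lab B i | i : 'F_7] = O (yB B).
  apply/eqP; rewrite eqEcard (card_imset _ (@block_lab_inj1 B)) card_Fp // O7 andbT.
  by apply/subsetP=> _ /imsetP[i _ ->]; rewrite -(block_labO B i) orbit_refl.
have : x \in O (yB B) by rewrite -xO orbit_refl.
by move=> xin e; move: xin; rewrite -e => /imsetP[i _ ->]; exists i.
Qed.

Lemma block_OB B B' : O (yB B) = O (yB B') -> B = B'.
Proof. by case: B; case: B' => //= e; case/eqP: tauO; rewrite e. Qed.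

Lemma block_lab_inj B i B' i' : lab B i = lab B' i' -> B = B' /\ i = i'.
Proof.
move=> e; have BB : B = B' by apply: block_OB; rewrite -(block_labO B i) e block_labO.
by split=> //; move: e; rewrite BB => /block_lab_inj1.
Qed.

Lemma block_lab_surj x : exists B i, x = lab B i.
Proof.
have [||[B i] ->] := @inj14_surj (bool * 'F_7)%type (fun z => lab z.1 z.2) _ _ x.
- by rewrite card_prod card_bool card_Fp.
- by move=> [B i] [B' i'] /block_lab_inj[/= -> ->].
by exists B, i.
Qed.

Lemma block_shiftA s : s \in A -> exists e : bool -> 'F_7, forall B i, s (lab B i) = lab B (i + e B).
Proof.
move=> sA; have /choice[e eP] : forall B, exists e, s (yB B) = lab B e.
  by move=> B; apply: block_lab_orbit; apply: orbit_point.
exists e => B i.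
have cm : (aB B ^+ i * s = s * aB B ^+ i)%g.
  by apply: (centsP abA); rewrite ?groupX ?aB_in.
rewrite /block_lab addrC (expF7D (aB7 B)) permM -[in RHS]/(lab B (e B)) -eP.
by rewrite -!permM cm.
Qed.

Lemma block_shiftX (s : 'S_14) (e : bool -> 'F_7) n : (forall B i, s (lab B i) = lab B (i + e B)) ->
  forall B i, (s ^+ n)%g (lab B i) = lab B (i + n%:R * e B).
Proof.
move=> sE B; elim: n => [|n IHn] i; first by rewrite expg0 perm1 mul0r addr0.
by rewrite expgS permM sE IHn -natr1 mulrDl mul1r -addrA [_ + e B]addrC.
Qed.

(** Conjugation by [s] turns the unit translation of block [B] into an element of [A]; the amount by
    which it translates the image block is the multiplier. *)
Lemma block_affine s : s \in G -> exists (sw : bool) (c b : bool -> 'F_7),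
  (forall B, c B != 0) /\ forall B i, s (lab B i) = lab (B (+) sw) (c B * i + b B).
Proof.
move=> sG.
have /choice[t tP] B : exists Bb : bool * 'F_7, s (yB B) = lab Bb.1 Bb.2.
  by have [B' [b e]] := block_lab_surj (s (yB B)); exists (B', b).
have tO B : O (s (yB B)) = O (yB (t B).1) by rewrite tP block_labO.
have tI : (t false).1 != (t true).1.
  apply/eqP=> e; have : O (yB false) = O (yB true).
    have h : O (s (yB false)) = O (s (yB true)) by rewrite !tO e.
    have := orbit_eq_act AG (groupVr sG) h; rewrite -!permM.
    by rewrite !permM !permK.
  by move=> /block_OB.
have tE B : (t B).1 = B (+) (t false).1.
  by case: B => //; move: tI; case: (t false).1; case: (t true).1.
have /choice[e eP] B : exists e : bool -> 'F_7,
    forall B' i, (aB B ^ s)%g (lab B' i) = lab B' (i + e B').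
  by apply: block_shiftA; rewrite tau_norm ?aB_in.
exists (t false).1, (fun B => e B (t B).1), (fun B => (t B).2).
have sE B i : s (lab B i) = lab (B (+) (t false).1) (e B (t B).1 * i + (t B).2).
  rewrite /block_lab -(permJ (aB B ^+ i)%g s (yB B)) conjXg tP.
  by rewrite (block_shiftX _ (eP B)) -tE natr_Zp addrC mulrC.
split=> // B; apply/eqP=> e0.
have : s (lab B 0) = s (lab B 1) by rewrite !sE e0 !mul0r.
by move=> /perm_inj/block_lab_inj[].
Qed.

Lemma block_tau : exists ct bt : bool -> 'F_7, (forall B, ct B != 0) /\
  forall B i, tau (lab B i) = lab (~~ B) (ct B * i + bt B).
Proof.
have [sw [c [b [c0 sE]]]] := block_affine tauG; exists c, b; split=> // B i.
have -> : ~~ B = B (+) sw; last exact: sE.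
suff -> : sw = true by rewrite addbT.
have := sE false 0; have -> : tau (lab false 0) = lab true 0.
  by rewrite /block_lab /= !expg0 !perm1.
by move=> /block_lab_inj[->].
Qed.

Lemma block_single_shift (s : 'S_14) B d : s \in A -> d != 0 ->
  (forall B' i, s (lab B' i) = lab B' (i + if B' == B then d else 0)) ->
  forall e, exists2 r, r \in G & forall B' i, r (lab B' i) = lab B' (i + if B' == B then e else 0).
Proof.
move=> sA d0 sE e; exists (s ^+ (e / d)%R)%g; first by rewrite AsubG // groupX.
move=> B' i; rewrite (block_shiftX _ sE) natr_Zp.
by case: (B' == B); rewrite ?divfK ?mulr0.
Qed.

Lemma block_other_shift (s : 'S_14) B d : s \in A -> d != 0 ->
  (forall B' i, s (lab B' i) = lab B' (i + if B' == B then d else 0)) ->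
  exists2 d', d' != 0 & exists2 r, r \in A &
    forall B' i, r (lab B' i) = lab B' (i + if B' == ~~ B then d' else 0).
Proof.
move=> sA d0 sE; have [ct [bt [ct0 tE]]] := block_tau.
exists (ct B * d); first by rewrite mulf_neq0.
exists (s ^ tau)%g; first exact: tau_norm.
move=> B' i; have -> : lab B' i = tau (lab (~~ B') ((i - bt (~~ B')) / ct (~~ B'))).
  by rewrite tE negbK mulrC divfK // subrK.
rewrite permJ sE !tE negbK; congr (lab _ _).
have -> : (~~ B' == B) = (B' == ~~ B) by case: (B'); case: (B).
have cK x : ct (~~ B') * (x / ct (~~ B')) = x by rewrite mulrC divfK.
rewrite mulrDr cK addrAC subrK; congr (_ + _).
by case: eqP => [->|_]; rewrite ?negbK ?mulr0.
Qed.

Variables (k : fieldType) (chark : 7 \in [pchar k]).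

(** The translation vectors of [A] form a nonzero subspace of F_7^2. If it contains a nonzero vector
    supported on one block, conjugation by [tau] gives one on the other block, and all of F_7^2 is
    reached; otherwise it is a line spanned by a vector without zero coordinates. *)
Lemma blocks_rational : rational k (perm_fixedfield k G) (fixedC k G).
Proof.
pose single (s : 'S_14) B d := forall B' i, s (lab B' i) = lab B' (i + if B' == B then d else 0).
case: (pselect (exists s B d, [/\ s \in A, d != 0 & single s B d])) => [[s [B [d [sA d0 sE]]]]|none].
  have [d' d'0 [r rA rE]] := block_other_shift sA d0 sE.
  have [ct [bt [ct0 tE]]] := block_tau.
  apply: (two_blocks_rational_full chark block_lab_inj block_lab_surj block_affine _ tauG ct0 tE).
  move=> B' e; have [->|BB] := eqVneq B' B; first exact: (block_single_shift sA d0 sE).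
  have -> : B' = ~~ B by move: BB; case: B'; case: (B).
  exact: (block_single_shift rA d'0 rE).
have zero s (e : bool -> 'F_7) B : s \in A -> (forall B i, s (lab B i) = lab B (i + e B)) ->
    e B = 0 -> e (~~ B) = 0.
  move=> sA sE eB; apply/eqP; apply: contrapT => /negP e0; apply: none.
  exists s, (~~ B), (e (~~ B)); split=> // B' i; rewrite sE.
  by case: eqP => [->//|/eqP]; case: B eB {e0}; case: B' => //= ->.
have [d dE] := block_shiftA a0A.
have d0 B : d B != 0.
  apply/eqP=> dB; have dnB := zero _ _ B a0A dE dB.
  have : a0 (lab false 0) = lab false 0.
    by rewrite dE; case: B dB dnB => /= e1 e2; rewrite ?e1 ?e2 addr0.
  by rewrite /block_lab expg0 perm1 => /eqP; rewrite (negbTE a0y).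
apply: (two_blocks_rational_line chark block_lab_inj block_lab_surj block_affine d0) => s sG.
have [sw [c [b [c0 sE]]]] := block_affine sG.
have rA : (a0 ^ s)%g \in A by apply: tau_norm.
have [e eE] := block_shiftA rA.
have ce B : c B * d B = e (B (+) sw).
  have : (a0 ^ s)%g (s (lab B 0)) = s (lab B (d B)) by rewrite permJ dE add0r.
  rewrite !sE eE mulr0 add0r => /block_lab_inj[_].
  by rewrite addrC => /addIr.
(* The vector [e] minus [m] times [d] comes from [A] and vanishes on one block, hence on both. *)
pose m := e false / d false; exists sw, c, b, m; split=> // B; rewrite ce.
pose r := (a0 ^ s * a0 ^+ (- m)%R)%g.
have rrA : r \in A by rewrite groupM // groupX.
have rE B' i : r (lab B' i) = lab B' (i + (e B' - m * d B')).
  by rewrite permM eE (block_shiftX _ dE) natr_Zp mulNr addrA.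
have r0 : e false - m * d false = 0 by rewrite /m divfK // subrr.
have r1 := zero r (fun B => e B - m * d B) false rrA rE r0.
by case: (B (+) sw); apply/eqP; rewrite -subr_eq0; apply/eqP.
Qed.

End BlocksOfSeven.

Lemma blocks_of_seven_rational (k : fieldType) (chark : 7 \in [pchar k])
    (G A : {group 'S_14}) : (A <| G)%g -> [transitive G, on [set: 'I_14] | 'P] ->
  abelian A -> (forall s, s \in A -> (s ^+ 7 = 1)%g) ->
  (forall x, #|orbit 'P A x| = 7%N) -> rational k (perm_fixedfield k G) (fixedC k G).
Proof.
move=> AG transG abA expA O7.
have [a0 [tau [y0 [a0A tauG a0y tauO]]]] := seven_blocks transG O7.
exact: (blocks_rational AG abA expA O7 a0A tauG a0y tauO chark).
Qed.

(** * Orbits of size two: affine labels on seven pairs *)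

Section BlocksOfTwo.
Variables (G A : {group 'S_14}).
Hypotheses (AG : (A <| G)%g) (transG : [transitive G, on [set: 'I_14] | 'P]).
Hypotheses (solG : solvable G) (A2 : pgroup 2%N A).
Local Notation O x := (orbit 'P A x).
Hypothesis O2 : forall x, #|O x| = 2%N.

Let AsubG s : s \in A -> s \in G := subsetP (normal_sub AG) s.

Definition blockwise : {set 'S_14} := [set s in G | [forall x, O (s x) == O x]].

Lemma blockwiseP s : reflect (s \in G /\ forall x, O (s x) = O x) (s \in blockwise).
Proof. by rewrite inE; apply: (iffP andP) => -[sG /'forall_eqP]. Qed.

Lemma block_two x y z : O x = O y -> O x = O z -> x != y -> x != z -> y = z.
Proof.
move=> xy xz nxy nxz; apply/eqP; apply: contraT => nyz.
have : (#|[set x; y; z]| <= #|O x|)%N.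
  apply: subset_leq_card; apply/subsetP=> t; rewrite !inE -orbA => /or3P[]/eqP->.
  - exact: orbit_refl.
  - by rewrite xy orbit_refl.
  by rewrite xz orbit_refl.
by rewrite O2 setUC cardsU1 cards2 !inE nxy negb_or [z == x]eq_sym nxz [z == y]eq_sym nyz.
Qed.

Lemma blockwise_sq s : s \in blockwise -> (s ^+ 2 = 1)%g.
Proof.
move=> /blockwiseP[sG sO]; apply/permP=> x; rewrite expgS expg1 permM perm1.
have [e|sx] := eqVneq (s x) x; first by rewrite !e.
apply: (@block_two (s x)); [by rewrite (sO (s x)) | exact: sO | | exact: sx].
by rewrite (inj_eq perm_inj) eq_sym.
Qed.

Lemma O_exchange : exists2 s, s \in G & s \notin blockwise.
Proof.
have [z zO] : exists z, z \notin O ord0.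
  apply/existsP; rewrite -negb_forall; apply/negP=> /forallP h.
  have : O ord0 = [set: 'I_14] by apply/setP=> z; rewrite h inE.
  by move=> e; have := O2 ord0; rewrite e cardsT card_ord.
have [s sG se] := trans_point transG ord0 z.
exists s => //; apply: contra zO => /blockwiseP[_ sO].
by rewrite -se -(sO ord0) orbit_refl.
Qed.

(* Take [M] minimal among the normal subgroups of [G] that move some block: its derived
   subgroup is smaller, as [G] is solvable, hence moves no block. *)
Lemma min_normal_blocks : exists M : {group 'S_14}, [/\ (M <| G)%g,
  exists2 s, s \in M & s \notin blockwise &
  forall s r, s \in M -> r \in M -> [~ s, r]%g \in blockwise].
Proof.
pose P (H : {group 'S_14}) := (H <| G)%g && ~~ (H \subset blockwise).
have PG : P G.
  rewrite /P normal_refl /=; have [s sG sN] := O_exchange.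
  by apply: contra sN => /subsetP; apply.
have [M /mingroupP[/andP[MG nM] minM] _] := mingroup_exists PG.
exists M; split=> //.
  by have /subsetPn[s sM sN] := nM; exists s.
move=> s r sM rM.
have M1 : M :!=: 1%g.
  apply: contraNneq nM => ->; apply/subsetP=> t /set1P->; apply/blockwiseP.
  by split=> // x; rewrite perm1.
have pr : (M^`(1) \proper M)%g := sol_der1_proper solG (normal_sub MG) M1.
have : (M^`(1) \subset blockwise)%g.
  apply: contraTT pr => nD; rewrite properE negb_and negbK.
  have DG : (M^`(1) <| G)%g by apply: char_normal_trans MG; apply: der_char.
  by rewrite (minM [group of M^`(1)%g]) ?subxx ?orbT //= /P ?DG ?nD ?der_sub.
by move=> /subsetP; apply; rewrite derg1; apply: mem_commg.
Qed.

(** The orbits of [M A] are unions of pairs, of size dividing 14, and not single pairs as [M] moves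
    some pair; so [M A] is transitive. Hence 7 divides its order, and that of [M], since [A] is a
    2-group. An element of order 7 moves a pair because the elements of [blockwise] square to 1. *)
Lemma rotation_exists : exists (M : {group 'S_14}) (g : 'S_14) (x0 : 'I_14),
  [/\ (M <| G)%g, g \in M, (g ^+ 7 = 1)%g, O (g x0) != O x0 &
    forall s r, s \in M -> r \in M -> [~ s, r]%g \in blockwise].
Proof.
have [M [MG [m mM mN] comm]] := min_normal_blocks.
pose H := (M <*> A)%G.
have HG : (H <| G)%g by apply: normalY.
have OH x : O x \subset orbit 'P H x.
  apply/subsetP=> y /orbitP[s sA <-]; apply/orbitP; exists s => //.
  by rewrite mem_gen // inE sA orbT.
have even x : (2 %| #|orbit 'P H x|)%N.
  have Px : partition [set O y | y in orbit 'P H x] (orbit 'P H x).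
    apply: orbit_partition; apply/actsP=> s sA y.
    have sH : s \in H by rewrite mem_gen // inE sA orbT.
    exact: orbit_actr.
  have cE := card_uniform_partition (n := 2%N) _ Px.
  rewrite cE; first exact: dvdn_mull.
  by move=> _ /imsetP[y _ ->]; apply: O2.
have c14 : #|orbit 'P H (ord0 : 'I_14)| = 14%N.
  have d14 := card_orbit_dvd HG transG (ord0 : 'I_14); have ev := even ord0.
  have : #|orbit 'P H (ord0 : 'I_14)| \in divisors 14 by rewrite -dvdn_divisors.
  rewrite (_ : divisors 14 = [:: 1; 2; 7; 14]%N) //.
  move: ev; rewrite !inE; case: eqP => [-> //|_]; case: eqP => [c2 _|_]; last first.
    by case: eqP => [-> //|_] _ /eqP.
  case/negP: mN; apply/blockwiseP; split; first exact: (subsetP (normal_sub MG)).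
  move=> x; have e : O x = orbit 'P H x.
    by apply/eqP; rewrite eqEcard OH O2 (card_orbit_const HG transG x ord0) c2.
  have : m x \in orbit 'P H x by apply/orbitP; exists m; rewrite // mem_gen // inE mM.
  by rewrite -e => /orbit_eqP.
have d7 : (7 %| #|M|)%N.
  have : (7 %| #|M| * #|A|)%N.
    have dH : (7 %| #|H|)%N.
      by have := dvdn_orbit 'P H (ord0 : 'I_14); rewrite c14; apply: dvdn_trans.
    apply: dvdn_trans dH _; rewrite /= norm_joinEr.
      by rewrite mul_cardG dvdn_mulr.
    exact: subset_trans (normal_sub AG) (normal_norm MG).
  rewrite Euclid_dvdM // => /orP[//|d7A].
  have := pnatP; have := pgroupP A2 7 (isT : prime 7) d7A; by [].
have [g gM g7] := Cauchy (isT : prime 7) d7.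
have gG : g \in G by apply: (subsetP (normal_sub MG)).
have gN : g \notin blockwise.
  apply/negP=> /blockwise_sq g2; have := order_dvdn g 2; rewrite g2 eqxx g7.
  by [].
have [x0 x0N] : exists x, O (g x) != O x.
  by apply/existsP; move: gN; rewrite inE gG /= negb_forall.
exists M, g, x0; split=> //.
by have := expg_order g; rewrite g7.
Qed.

Variables (M : {group 'S_14}) (g : 'S_14) (x0 : 'I_14).
Hypotheses (MG : (M <| G)%g) (gM : g \in M) (g7 : (g ^+ 7 = 1)%g) (gx0 : O (g x0) != O x0)
  (comm : forall s r, s \in M -> r \in M -> [~ s, r]%g \in blockwise).

Let MsubG s : s \in M -> s \in G := subsetP (normal_sub MG) s.

Lemma pair_mate : exists2 x1, O x1 = O x0 & x1 != x0.
Proof.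
have : (0 < #|O x0 :\ x0|)%N.
  by have := O2 x0; rewrite (cardsD1 x0) orbit_refl add1n => /eq_add_S->.
move=> /card_gt0P[x1]; rewrite !inE => /andP[x10 x1O]; exists x1 => //.
exact/orbit_eqP.
Qed.

Variable x1 : 'I_14.
Hypotheses (x1O : O x1 = O x0) (x10 : x1 != x0).

Let xB (B : bool) : 'I_14 := if B then x1 else x0.
Definition pair_lab (i : 'F_7) (B : bool) : 'I_14 := (g ^+ i)%g (xB B).
Local Notation lab := pair_lab.

Lemma O_lab i B : O (lab i B) = O (lab i false).
Proof.
apply: (orbit_eq_act AG) => //; first by rewrite groupX // MsubG.
by case: B.
Qed.

Lemma O_lab_inj i j : O (lab i false) = O (lab j false) -> i = j.
Proof.
move=> e; apply/eqP; apply: contraNT gx0 => ij; apply/eqP.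
apply: (expF7_orbit g7 (R := fun x y => O x = O y)) e ij => [x z|x z t -> //|n x z].
  by [].
by apply: (orbit_eq_act AG); rewrite groupX // MsubG.
Qed.

Lemma pair_lab_inj i B i' B' : lab i B = lab i' B' -> i = i' /\ B = B'.
Proof.
move=> e; have ii : i = i' by apply: O_lab_inj; rewrite -(O_lab i B) e O_lab.
split=> //; move: e; rewrite ii => /perm_inj.
by case: B; case: B' => //= e; case/eqP: x10; rewrite e.
Qed.

Lemma pair_lab_surj x : exists i B, x = lab i B.
Proof.
have [||[i B] ->] := @inj14_surj ('F_7 * bool)%type (fun z => lab z.1 z.2) _ _ x.
- by rewrite card_prod card_bool card_Fp.
- by move=> [i B] [i' B'] /pair_lab_inj[/= -> ->].
by exists i, B.
Qed.

Lemma rotation_lab i B : g (lab i B) = lab (i + 1) B.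
Proof. by rewrite /pair_lab (expF7D g7) permM expg1. Qed.

(** Modulo [blockwise], [s] commutes with the powers of [g], so it shifts all pairs by the same
    amount as the pair of [x0]. *)
Lemma M_shift s : s \in M -> exists e,
  forall n i, O ((s ^+ n)%g (lab i false)) = O (lab (i + n%:R * e) false).
Proof.
move=> sM; have [e [B eE]] := pair_lab_surj (s x0); exists e.
have s1 i : O (s (lab i false)) = O (lab (i + e) false).
  have gi : (g ^+ i)%g \in M by rewrite groupX.
  have -> : O (s (lab i false)) = O ((g ^+ i)%g (s x0)).
    rewrite /pair_lab -[s _]permM commgC permM.
    by have /blockwiseP[_ ->] := comm gi sM; rewrite permM.
  rewrite eE -(O_lab (i + e) B) /pair_lab [i + e]addrC (expF7D g7) permM.
  by [].
elim=> [|n IHn] i; first by rewrite expg0 perm1 mul0r addr0.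
rewrite expgSr permM (orbit_eq_act AG _ (IHn i)) ?MsubG // s1.
by rewrite -natr1 mulrDl mul1r addrA.
Qed.

(** The conjugate of [g] by [s] lies in [M], hence translates the pairs by some [c]; since [s]
    carries powers of [g] to powers of this conjugate, it acts on the pairs as c i + b. *)
Lemma pair_affine s : s \in G -> exists (c b : 'F_7) (eps : 'F_7 -> bool),
  c != 0 /\ forall i B, s (lab i B) = lab (c * i + b) (B (+) eps i).
Proof.
move=> sG; have [b [B0 sx0]] := pair_lab_surj (s x0).
have rM : (g ^ s)%g \in M by rewrite memJ_norm // (subsetP (normal_norm MG)).
have [c cE] := M_shift rM.
have sO i B : O (s (lab i B)) = O (lab (c * i + b) false).
  rewrite (orbit_eq_act AG sG (O_lab i B)).
  rewrite /pair_lab -(permJ (g ^+ i)%g s) conjXg sx0.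
  have rG : ((g ^ s) ^+ i)%g \in G by rewrite MsubG // groupX.
  by rewrite (orbit_eq_act AG rG (O_lab b B0)) cE natr_Zp addrC mulrC.
have sE i B : exists B', s (lab i B) = lab (c * i + b) B'.
  have [j [B' e]] := pair_lab_surj (s (lab i B)); exists B'; rewrite e.
  by congr (lab _ _); apply: O_lab_inj; rewrite -(O_lab j B') -e sO.
have /choice[eps epsE] i := sE i false.
have sF i B : s (lab i B) = lab (c * i + b) (B (+) eps i).
  case: B; last by rewrite addFb epsE.
  have [B' e] := sE i true; rewrite e; congr (lab _ _); rewrite addTb.
  have : B' != eps i; last by case: B' {e}; case: (eps i).
  apply/eqP=> eB; have : lab i true = lab i false by apply: (@perm_inj _ s); rewrite e epsE eB.
  by move=> /pair_lab_inj[].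
exists c, b, eps; split=> //; apply/eqP=> c0.
have : s (lab 0 (eps 0)) = s (lab 1 (eps 1)) by rewrite !sF c0 !mul0r !addbb.
by move=> /perm_inj/pair_lab_inj[].
Qed.

End BlocksOfTwo.

Lemma blocks_of_two_rational (k : fieldType) (chark : 7 \in [pchar k])
    (G A : {group 'S_14}) : (A <| G)%g -> [transitive G, on [set: 'I_14] | 'P] ->
  solvable G -> pgroup 2%N A -> (forall x, #|orbit 'P A x| = 2%N) ->
  rational k (perm_fixedfield k G) (fixedC k G).
Proof.
move=> AG transG solG A2 O2.
have [M [g [x0 [MG gM g7 gx0 comm]]]] := rotation_exists AG transG solG A2 O2.
have [x1 x1O x10] := pair_mate O2 x0.
have gG : g \in G by apply: (subsetP (normal_sub MG)).
have inj := pair_lab_inj AG MG gM g7 gx0 x1O x10.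
have surj := pair_lab_surj AG MG gM g7 gx0 x1O x10.
have aff := pair_affine AG MG gM g7 gx0 comm x1O x10.
have rot := rotation_lab x0 g7 x1.
exact: (seven_pairs_rational chark inj surj aff gG rot).
Qed.

Local Close Scope ring_scope.

Theorem theorem1p8 (k : fieldType) (chark : 7 \in [pchar k]%R)
    (G : {group 'S_14}) (solG : solvable G)
    (transG : [transitive G, on [set: 'I_14] | 'P]) :
  rational k (perm_fixedfield k G) (fixedC k G).
Proof.
have G1 : G :!=: 1%g.
  have [s sG s0] := trans_point transG (ord0 : 'I_14) ord_max.
  apply: contra_eq_neq s0 => G1; move: sG; rewrite G1 => /set1P->.
  by rewrite perm1.
have [A minA AsubG] := minnormal_exists G1 (normG G).
have [nAG A1 /is_abelemP[p pp abA]] := minnormal_solvable minA AsubG solG.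
have AG : (A <| G)%g by rewrite /normal AsubG; have /mingroupp/andP[] := minA.
have [cA expA] := abelemP pp abA.
have cO x : #|orbit 'P A x| = #|orbit 'P A (ord0 : 'I_14)|.
  exact: (card_orbit_const AG transG).
(* Orbit sizes divide the order of the p-group [A]; this excludes 14, while size 1 would make [A]
   trivial. *)
have only_p r : prime r -> r %| #|orbit 'P A (ord0 : 'I_14)| -> r = p.
  move=> pr rO; have := pgroupP (abelem_pgroup abA) r pr.
  by move=> /(_ (dvdn_trans rO (dvdn_orbit _ _ _)))/eqP.
have : #|orbit 'P A (ord0 : 'I_14)| \in divisors 14.
  by rewrite -dvdn_divisors // (card_orbit_dvd AG transG).
rewrite (_ : divisors 14 = [:: 1; 2; 7; 14]) // !inE => /or4P[]/eqP O_n.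
- case/negP: A1; apply/eqP/trivgP/subsetP=> s sA; apply/set1P/permP=> x; rewrite perm1.
  have /eqP/cards1P[y Oy] : #|orbit 'P A x| = 1 by rewrite cO.
  have : s x \in orbit 'P A x by apply/orbitP; exists s.
  have := orbit_refl 'P A x; rewrite Oy => /set1P <- /set1P.
  by [].
- have p2 : 2 = p by apply: only_p; rewrite // O_n.
  apply: (blocks_of_two_rational chark AG transG solG) => [|x].
    by move: abA; rewrite -p2 => /abelem_pgroup.
  by rewrite cO.
- have p7 : 7 = p by apply: only_p; rewrite // O_n.
  apply: (blocks_of_seven_rational chark AG transG cA) => [s sA|x].
    by have := expA s sA; rewrite -p7.
  by rewrite cO.
have p2 : 2 = p by apply: only_p; rewrite // O_n.
have p7 : 7 = p by apply: only_p; rewrite // O_n.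
by move: p7; rewrite -p2.
Qed.
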